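(* Let $R=\mathbb{k}[x_1,\dots,x_d]$ be a polynomial ring over a field $\mathbb{k}$ of characteristic zero. If $L$ is a lex-segment ideal of height $g\geqslant2$ generated in degree $\delta\geqslant2$, then $$\operatorname{core}(L)\subseteq\operatorname{adj}(L^g),$$ where $\operatorname{adj}(L^g)$ denotes the adjoint of $L^g$.
   Context: Lex-segment ideal: a monomial ideal $L=\bigoplus_{i\geqslant 0}L_i$ of $R$ such that, for every $i$, $L_i$ is spanned by the $\dim_{\mathbb{k}}L_i$ largest monomials of degree $i$ in the lexicographic order with $x_1>x_2>\cdots>x_d$. ''Generated in degree $\delta$'' means all minimal monomial generators have degree $\delta$. A subideal $J\subseteq L$ is a reduction of $L$ if $L^{m+1}=JL^m$ for $m\gg0$; $\operatorname{core}(L)$ is the intersection of all reductions of $L$. Adjoint (Lipman): for an ideal $I$ of the regular domain $R$ with fraction field $K$, $$\operatorname{adj}(I)=\bigcap_v\{r\in K\mid v(r)\geqslant v(I)-v(\mathrm{Jac}_{R_v/R})\},$$ where $v$ ranges over all divisorial valuations of $R$, i.e. discrete valuations of $K$ with value group $\mathbb{Z}$ whose valuation ring $R_v$ contains $R$ and such that, if $\mathfrak p$ is the center of $v$ on $R$, the residue field of $R_v$ has transcendence degree $\operatorname{ht}(\mathfrak p)-1$ over the residue field of $R_{\mathfrak p}$; $\mathrm{Jac}_{R_v/R}$ is the Jacobian ideal, i.e. the $0$th Fitting ideal of the module of Kähler differentials $\Omega_{R_v/R}$, and $v$ of an ideal is the minimum of $v$ on its elements. *)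

(* Defs.v *)
From HB Require Import structures.
From mathcomp Require Import all_boot all_order all_algebra.
From mathcomp Require Import freeg mpoly.
From mathcomp Require Import boolp classical_sets.

Set Implicit Arguments.
Unset Strict Implicit.
Unset Printing Implicit Defensive.

Import Order.TTheory GRing.Theory Num.Theory.

Local Open Scope ring_scope.
Local Open Scope quotient_scope.
Local Open Scope classical_set_scope.

(* Ideals are [Prop]-valued sets and may be improper: the [idealr] structure of
   ring_quotient is boolean and excludes the unit ideal. *)
Section Ideals.
Variable A : comNzRingType.
Implicit Types I J L P S : set A.

Definition is_ideal I : Prop :=
  [/\ I 0, forall x y, I x -> I y -> I (x + y)
    & forall a x, I x -> I (a * x)].

Definition ideal_gen S : set A := smallest is_ideal S.

Definition ideal_mul I J : set A := ideal_gen [set x * y | x in I & y in J].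

Definition ideal_pow I (n : nat) : set A := iter n (ideal_mul I) setT.

Definition is_reduction L J : Prop :=
  [/\ is_ideal J, J `<=` L &
      exists m0 : nat, forall m : nat, (m0 <= m)%N ->
        ideal_pow L m.+1 = ideal_mul J (ideal_pow L m)].

Definition ideal_core L : set A := \bigcap_(J in is_reduction L) J.

Definition is_prime P : Prop :=
  [/\ is_ideal P, ~ P 1 & forall x y, P (x * y) -> P x \/ P y].

Definition prime_chain P (n : nat) : Prop :=
  exists c : nat -> set A,
    [/\ forall i, (i <= n)%N -> is_prime (c i),
        forall i, (i < n)%N -> c i `<` c i.+1 & c n = P].

Definition prime_height P (n : nat) : Prop :=
  prime_chain P n /\ forall m, prime_chain P m -> (m <= n)%N.

(* The minimum of the heights of the primes containing [I]; primes of infinite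
   height satisfy [prime_height] for no [n] and do not affect it. *)
Definition ideal_height I (n : nat) : Prop :=
  (exists P, [/\ is_prime P, I `<=` P & prime_height P n]) /\
  (forall P m, is_prime P -> I `<=` P -> prime_height P m -> (n <= m)%N).

End Ideals.

Section Linear.
Variables (k : fieldType) (V : lmodType k).

Definition lin_span (s : seq V) : set V :=
  [set u | exists c : 'I_(size s) -> k, u = \sum_(i < size s) c i *: s`_i].

Definition lin_free (s : seq V) : Prop :=
  forall c : 'I_(size s) -> k,
    \sum_(i < size s) c i *: s`_i = 0 -> forall i, c i = 0.

Definition lin_dim (W : set V) (n : nat) : Prop :=
  exists s : seq V, [/\ size s = n, lin_free s & W = lin_span s].

End Linear.

Section Monomials.
Variables (k : fieldType) (d : nat).
Implicit Types (L : set {mpoly k[d]}) (m : 'X_{1..d}).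

Definition monomial_ideal L : Prop :=
  exists M : set 'X_{1..d}, L = ideal_gen [set 'X_[m] | m in M].

Definition graded_part L (i : nat) : set {mpoly k[d]} :=
  [set f | L f /\ f \is i.-homog].

(* The pure lexicographic order on exponent vectors, with 'X_0 the largest
   variable; the default order on 'X_{1..d} compares degrees first. *)
Definition mlex_ge : rel 'X_{1..d} :=
  fun m1 m2 => ((m2 : d.-tuplelexi nat) <= (m1 : d.-tuplelexi nat))%O.

Definition lex_monomials (i : nat) : seq 'X_{1..d} :=
  sort mlex_ge
    [seq m <- [seq bmnm b | b : 'X_{1..d < i.+1}] | mdeg m == i].

Definition lex_segment L : Prop :=
  monomial_ideal L /\
  forall i : nat, exists n : nat,
    lin_dim (graded_part L i) n /\
    graded_part L i =
      lin_span [seq 'X_[m] : {mpoly k[d]} | m <- take n (lex_monomials i)].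

Definition minimal_monomial_generator L m : Prop :=
  L 'X_[m] /\ forall m', L 'X_[m'] -> (m' <= m)%MM -> m' = m.

Definition generated_in_degree L (delta : nat) : Prop :=
  forall m, minimal_monomial_generator L m -> mdeg m = delta.

End Monomials.

Section QuotientModule.
Variables (B : pzRingType) (M : lmodType B) (N : submodClosed M).

(* [submodClosed] does not inherit from [zmodClosed], which [Quotient]
   requires. *)
Definition submod_pred : {pred M} := fun x => x \in N.

Fact submod_pred_closed : zmod_closed submod_pred.
Proof.
split=> [|x y Nx Ny]; rewrite unfold_in /submod_pred ?rpred0 //.
by rewrite -scaleN1r rpredD // rpredZ.
Qed.

HB.instance Definition _ := GRing.isZmodClosed.Build M submod_pred
  submod_pred_closed.

Definition quotmod := {ideal_quot submod_pred}.
HB.instance Definition _ := GRing.Zmodule.on quotmod.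

Definition quotmod_pi (x : M) : quotmod := \pi_quotmod x.

Lemma quotmod_piD : {morph quotmod_pi : x y / x + y}.
Proof. by move=> x y; rewrite /quotmod_pi raddfD. Qed.

Lemma quotmod_piK (q : quotmod) : quotmod_pi (repr q) = q.
Proof. exact: reprK. Qed.

Lemma quotmod_pi_eq x y : (quotmod_pi x == quotmod_pi y) = (x - y \in N).
Proof. by rewrite -(Quotient.idealrBE submod_pred). Qed.

Definition quotmod_scale (a : B) (q : quotmod) : quotmod :=
  quotmod_pi (a *: repr q).

Lemma quotmod_scale_pi a x :
  quotmod_scale a (quotmod_pi x) = quotmod_pi (a *: x).
Proof.
apply/eqP; rewrite quotmod_pi_eq -scalerBr rpredZ //.
by rewrite -quotmod_pi_eq quotmod_piK.
Qed.

Fact quotmod_scaleA a b q :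
  quotmod_scale a (quotmod_scale b q) = quotmod_scale (a * b) q.
Proof. by rewrite -[q]quotmod_piK !quotmod_scale_pi scalerA. Qed.

Fact quotmod_scale1 : left_id 1 quotmod_scale.
Proof. by move=> q; rewrite -[q]quotmod_piK quotmod_scale_pi scale1r. Qed.

Fact quotmod_scaleDr : right_distributive quotmod_scale +%R.
Proof.
move=> a p q; rewrite -[p]quotmod_piK -[q]quotmod_piK -quotmod_piD.
by rewrite !quotmod_scale_pi scalerDr quotmod_piD.
Qed.

Fact quotmod_scaleDl q : {morph quotmod_scale^~ q : a b / a + b}.
Proof.
move=> a b; rewrite -[q]quotmod_piK !quotmod_scale_pi scalerDl.
by rewrite quotmod_piD.
Qed.

HB.instance Definition _ := GRing.Zmodule_isLmodule.Build B quotmod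
  quotmod_scaleA quotmod_scale1 quotmod_scaleDr quotmod_scaleDl.

End QuotientModule.

(* The module of Kaehler differentials of [phi : A -> B]: the free [B]-module
   on the symbols [<< b >>] (standing for [db]) modulo additivity, the Leibniz
   rule and [d (phi a) = 0]. *)
Section Kahler.
Variables (A B : comNzRingType) (phi : {rmorphism A -> B}).
Local Notation F := {freeg B / B}.

Definition is_submodule (N : set F) : Prop :=
  [/\ N 0, forall x y, N x -> N y -> N (x + y)
    & forall (b : B) x, N x -> N (b *: x)].

Definition kahler_relations : set F :=
  [set f | [\/ exists x y : B, f = << x + y >> - << x >> - << y >>,
               exists x y : B, f = << x * y >> - x *: << y >> - y *: << x >>
             | exists a : A, f = << phi a >>]].

Definition kahler_rel : {pred F} :=
  fun f => `[< smallest is_submodule kahler_relations f >].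

Fact kahler_rel_closed : submod_closed kahler_rel.
Proof.
split=> [|b x y]; rewrite !unfold_in /kahler_rel.
  by apply/asboolP => N [[]].
move=> /asboolP Nx /asboolP Ny; apply/asboolP => N subN.
have [[_ ND NZ] _] := subN.
by apply: ND; [apply: NZ; apply: Nx | apply: Ny].
Qed.

HB.instance Definition _ := GRing.isSubmodClosed.Build B F kahler_rel
  kahler_rel_closed.

Definition kahler : lmodType B := quotmod kahler_rel.

End Kahler.

(* The ideal generated by the maximal minors of the relation matrix of a finite
   generating family; the union over all such families does not enlarge it,
   by Fitting's lemma. *)
Definition fitting0 (B : comNzRingType) (M : lmodType B) : set B :=
  [set b | exists (n : nat) (e : 'I_n -> M),
      (forall x : M, exists c : 'I_n -> B, x = \sum_j c j *: e j) /\
      ideal_gen [set \det C | C in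
        [set C : 'M[B]_n | forall i, \sum_j C i j *: e j = 0]] b].

Section TranscendenceDegree.
Variables (E : fieldType) (F : set E).

Definition alg_indep (n : nat) (t : 'I_n -> E) : Prop :=
  forall p : {mpoly E[n]}, (forall m, F p@_m) -> p.@[t] = 0 -> p = 0.

(* The size of a maximal family algebraically independent over the
   subfield [F]. *)
Definition trdeg (n : nat) : Prop :=
  exists t : 'I_n -> E, alg_indep t /\
    forall x : E, ~ alg_indep (fun i : 'I_n.+1 => oapp t x (unlift ord_max i)).

End TranscendenceDegree.

(* The value at 0, which should be +oo, is left unspecified. *)
Record discrete_valuation (K : fieldType) := DiscreteValuation {
  dval :> K -> int;
  dvalM : forall x y, x != 0 -> y != 0 -> dval (x * y) = dval x + dval y;
  dvalD : forall x y, x != 0 -> y != 0 -> x + y != 0 ->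
    Num.min (dval x) (dval y) <= dval (x + y);
  dval_onto : forall n : int, exists2 x, x != 0 & dval x = n }.

Section ValuationRing.
Variables (K : fieldType) (v : discrete_valuation K).

Definition in_valring : {pred K} := fun x => (x == 0) || (0 <= v x).
Definition in_valmax : pred K := fun x => (x == 0) || (0 < v x).

Lemma dval1 : v 1 = 0.
Proof.
have := dvalM v (oner_neq0 K) (oner_neq0 K); rewrite mulr1 => h.
by apply: (addrI (v 1)); rewrite addr0 -h.
Qed.

Lemma dvalN1 : v (-1) = 0.
Proof.
have N1 : -1 != 0 :> K by rewrite oppr_eq0 oner_neq0.
have := dvalM v N1 N1; rewrite mulrNN mulr1 dval1 => /esym/eqP.
by rewrite -mulr2n mulrn_eq0 /= => /eqP.
Qed.

Lemma dvalV x : x != 0 -> v x^-1 = - v x.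
Proof.
move=> x0; have := dvalM v x0; move=> /(_ x^-1); rewrite invr_eq0 => /(_ x0).
by rewrite divff // dval1 => /esym/eqP; rewrite addrC addr_eq0 => /eqP.
Qed.

Lemma valD_ge (c : int) x y :
  (x == 0) || (c <= v x) -> (y == 0) || (c <= v y) ->
  (x + y == 0) || (c <= v (x + y)).
Proof.
have [->|x0] := eqVneq x 0; first by rewrite add0r.
have [->|y0] := eqVneq y 0; first by rewrite addr0 (negPf x0).
have [//|xy0] := eqVneq (x + y) 0.
move=> /= cx cy; apply: le_trans (dvalD v x0 y0 xy0).
by rewrite le_min cx cy.
Qed.

Lemma valM_ge (a b : int) x y :
  (x == 0) || (a <= v x) -> (y == 0) || (b <= v y) ->
  (x * y == 0) || (a + b <= v (x * y)).
Proof.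
rewrite mulf_eq0.
have [//|x0] := eqVneq x 0; have [//|y0] := eqVneq y 0.
by move=> /= ax by_; rewrite dvalM // lerD.
Qed.

Fact in_valring_closed : subring_closed in_valring.
Proof.
have valN1 : (-1 == 0 :> K) || (0 <= v (-1)) by rewrite dvalN1 lexx orbT.
split=> [|x y vx vy|x y vx vy]; rewrite unfold_in /in_valring.
- by rewrite dval1 lexx orbT.
- by apply: valD_ge => //; have := valM_ge valN1 vy; rewrite add0r mulN1r.
- by have := valM_ge vx vy; rewrite add0r.
Qed.

HB.instance Definition _ := GRing.isSubringClosed.Build K in_valring
  in_valring_closed.

Record valring := ValRing {
  valring_val :> K;
  valring_valP : valring_val \in in_valring }.

HB.instance Definition _ := [isSub for valring_val].
HB.instance Definition _ := [Choice of valring by <:].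
HB.instance Definition _ := [SubChoice_isSubComNzRing of valring by <:].

HB.instance Definition _ := GRing.RMorphism.copy valring_val
  (\val : valring -> K).

Definition valring_max : {pred valring} := fun x => in_valmax (valring_val x).

Fact valring_max_closed : idealr_closed valring_max.
Proof.
split=> [||a x y vx vy]; rewrite unfold_in /valring_max /in_valmax.
- by rewrite [valring_val 0]rmorph0 eqxx.
- by rewrite [valring_val 1]rmorph1 oner_eq0 dval1 ltxx.
rewrite gtz0_ge1; apply: valD_ge; last first.
  by have := vy; rewrite unfold_in /valring_max /in_valmax gtz0_ge1.
have := vx; rewrite unfold_in /valring_max /in_valmax gtz0_ge1 => vx1.
by have := valM_ge (valring_valP a) vx1; rewrite add0r.
Qed.

HB.instance Definition _ := isIdealr.Build valring valring_max
  valring_max_closed.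

Definition residue_field := {ideal_quot valring_max}.
HB.instance Definition _ := GRing.ComNzRing.on residue_field.

Definition residue : valring -> residue_field := \pi_residue_field.
HB.instance Definition _ := GRing.RMorphism.on residue.

Definition residue_inv (q : residue_field) : residue_field :=
  if q == 0 then 0 else residue (insubd (0 : valring) (valring_val (repr q))^-1).

Fact residue_mulVf q : q != 0 -> residue_inv q * q = 1.
Proof.
move=> q0; rewrite /residue_inv (negPf q0).
set x := repr q; have qE : q = residue x by rewrite /residue reprK.
have : x \notin valring_max.
  apply: contraNN q0 => mx; rewrite qE -[0](rmorph0 residue).
  by rewrite /residue -Quotient.idealrBE subr0.
rewrite unfold_in /valring_max /in_valmax negb_or -leNgt => /andP[x0 vx_le].
have vx : v (valring_val x) = 0.
  apply/eqP; rewrite eq_le vx_le /=.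
  by have := valring_valP x; rewrite unfold_in /in_valring (negPf x0).
have xV : (valring_val x)^-1 \in in_valring.
  by rewrite unfold_in /in_valring dvalV // vx oppr0 lexx orbT.
rewrite qE -rmorphM -[1](rmorph1 residue); congr residue.
by apply: val_inj; rewrite /= insubdK // mulVf.
Qed.

Fact residue_inv0 : residue_inv 0 = 0.
Proof. by rewrite /residue_inv eqxx. Qed.

HB.instance Definition _ := GRing.ComNzRing_isField.Build residue_field
  residue_mulVf residue_inv0.

Definition val_min (S : set K) (n : int) : Prop :=
  (exists x, [/\ S x, x != 0 & v x = n]) /\
  forall x, S x -> x != 0 -> n <= v x.

End ValuationRing.

Notation "x %:F" := (tofrac x) : ring_scope.

Section Adjoint.
Variable R : idomainType.
Local Notation K := {fraction R}.
Implicit Types (v : discrete_valuation K) (I P : set R) (S : set K).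

(* [R_P], as a subring of the fraction field. *)
Definition localization P : set K := [set a%:F / b%:F | a in setT & b in ~` P].

Section Valuation.
Variable v : discrete_valuation K.

Definition center : set R := [set a | a%:F \in in_valmax v].

(* The residue field of [R_P], [P] the center of [v], embeds in that of [R_v];
   this is its image. *)
Definition center_residue_field : set (residue_field v) :=
  [set residue x | x in [set x : valring v | localization center (valring_val x)]].

Definition valring_contains : Prop := forall a : R, a%:F \in in_valring v.

Definition is_divisorial : Prop :=
  valring_contains /\
  exists n : nat, prime_height center n.+1 /\ trdeg center_residue_field n.

Section Jacobian.
Variable Rv : valring_contains.

Definition to_valring (a : R) : valring v := ValRing (Rv a).

Fact to_valring_zmod_morphism : zmod_morphism to_valring.
Proof. by move=> a b; apply: val_inj; rewrite /= rmorphB. Qed.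

Fact to_valring_monoid_morphism : monoid_morphism to_valring.
Proof.
by split=> [|a b]; apply: val_inj; rewrite /= ?rmorph1 ?rmorphM.
Qed.

HB.instance Definition _ := GRing.isZmodMorphism.Build R (valring v) to_valring
  to_valring_zmod_morphism.
HB.instance Definition _ := GRing.isMonoidMorphism.Build R (valring v)
  to_valring to_valring_monoid_morphism.

Definition jacobian_ideal : set (valring v) := fitting0 (kahler to_valring).

End Jacobian.
End Valuation.

Definition adjoint I : set K :=
  [set r | forall v (div_v : is_divisorial v),
     r = 0 \/
     exists a b : int,
       [/\ val_min v [set x%:F | x in I] a,
           val_min v [set valring_val x | x in jacobian_ideal div_v.1] b
         & a - b <= v r]].

End Adjoint.

(* Main.v *)
(* Number the variables x_1, ..., x_d as in the paper, let v be a divisorial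
   valuation with valuation ring V, and let f be in the core of L.

   The core is stable under every automorphism preserving L, in particular under
   x_i -> x_i + t x_1 (i > 1), hence, in characteristic zero, under x_1 d/dx_i. Let J
   consist of the elements of L whose image under x_1 -> x_1 + ... + x_g involves
   no monomial in x_1, ..., x_g with all exponents less than delta; it is a
   reduction of L. If f had a nonzero component of degree e <= g (delta - 1), the
   derivations would turn it into a multiple of x_1^e; its image involves every
   monomial of degree e in x_1, ..., x_g, so f could not be in J. Hence all the
   monomials of f have degree at least g (delta - 1) + 1. As L contains x_g^delta
   and every monomial of degree delta involving one of x_1, ..., x_(g-1), an
   estimate on exponents gives v(f) >= g v(L) - sum_i v(x_i) + 1 if v(L) > 0.

   It remains to bound v(Jac) below by sum_i v(x_i) - 1, and to see that Jac is
   nonzero. The bound comes from the derivations x_i d/dx_i of the fraction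
   field, which map polynomials into x_i V. For the second point, there are at
   least d - 1 elements y of V with residues algebraically independent over k,
   so, p being a uniformizer, the fraction field is finite and separable over
   k(y, p). The trace form yields elements eta of V that generate V, up to
   inverting units, over its trace on k(y, p). So Omega_V is generated by the
   d eta, dy and dp, each of which is torsion. *)

Require Import Defs.
From HB Require Import structures.
From mathcomp Require Import all_boot all_order all_algebra.
From mathcomp Require Import freeg mpoly.
From mathcomp Require Import boolp classical_sets.
From mathcomp Require Import zify ring lra.
Set Implicit Arguments. Unset Strict Implicit. Unset Printing Implicit Defensive.
Import Order.TTheory GRing.Theory Num.Theory.
Local Open Scope ring_scope.
Local Open Scope classical_set_scope.

(** * Kaehler differentials *)

(** The number g (delta - 1) is the top degree of k[x_1, ..., x_g]/(x_1^delta, ..., x_g^delta): this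
    ring has monomials in every degree up to it, which keeps the powers of x_1 + ... + x_g away from
    J, and none beyond it, which makes J a reduction. The same number fits the valuations. Let x_p
    have least value among all variables and x_q among x_1, ..., x_(g-1). As x_q x_p^(delta-1) is in
    L, v(L) <= v(x_q) + (delta - 1) v(x_p). A monomial of degree at least g (delta - 1) + 1 is a
    generator of L times at least (g - 1)(delta - 1) further variables, and g - 1 copies of this
    inequality turn these, with the values of x_1, ..., x_(g-1), into (g - 1) v(L). The leftover
    v(x_g) > 0 is the + 1 that offsets the - 1 in the bound for Jac. The adjoint condition asks for
    an actual minimum of v on Jac, so a lower bound alone does not suffice. Since V is not known to
    be essentially of finite type, its differentials have to be generated by hand. One count of
    monomials provides all the dimension theory: the bounds on heights and the finiteness of the
    extension of k(y, p). *)

Section FreeLift.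
Variables (B : comNzRingType) (M : lmodType B) (f : B -> M).
Local Notation F := {freeg B / B}.

Lemma freeg_span (x : F) :
  x = \sum_(z <- dom x) coeff z x *: (<< z >> : F).
Proof.
rewrite -[LHS]freeg_sumE; apply: eq_bigr => z _.
apply/eqP/freeg_eqP => y; rewrite coeffZ !coeffU mul1r.
by case: eqVneq; rewrite ?mulr1 ?mulr0.
Qed.

Definition free_lift : F -> M := fglift f.
HB.instance Definition _ :=
  GRing.isZmodMorphism.Build F M free_lift (lift_is_additive f).

Lemma free_lift1 b : free_lift << b >> = f b.
Proof. by rewrite /free_lift liftU scale1r. Qed.

Lemma free_liftD x y : free_lift (x + y) = free_lift x + free_lift y.
Proof. exact: raddfD. Qed.

Lemma free_liftN x : free_lift (- x) = - free_lift x.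
Proof. exact: raddfN. Qed.

Lemma free_lift0 : free_lift 0 = 0.
Proof. exact: raddf0. Qed.

Lemma free_liftZ b x : free_lift (b *: x) = b *: free_lift x.
Proof.
have hU (a c : B) : a *: (<< c >> : F) = << a *g c >>.
  apply/eqP/freeg_eqP => y; rewrite coeffZ !coeffU mul1r.
  by case: eqVneq; rewrite ?mulr1 ?mulr0.
rewrite (freeg_span x); elim: (dom x) => [|z s IH].
  by rewrite big_nil scaler0 free_lift0 scaler0.
rewrite big_cons scalerDr !free_liftD IH scalerDr scalerA !hU.
by rewrite /free_lift !liftU scalerA.
Qed.

End FreeLift.

Section KahlerTheory.
Variables (A B : comNzRingType) (phi : {rmorphism A -> B}).
Local Notation F := {freeg B / B}.

Definition kdiff (b : B) : kahler phi := quotmod_pi (kahler_rel phi) (<< b >> : F).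

Lemma kahler_piZ (a : B) (x : F) :
  quotmod_pi (kahler_rel phi) (a *: x) =
  a *: (quotmod_pi (kahler_rel phi) x : kahler phi).
Proof. by rewrite -[RHS]/(quotmod_scale _ _) quotmod_scale_pi. Qed.

Lemma kahler_pi0 (x : F) : x \in kahler_rel phi ->
  quotmod_pi (kahler_rel phi) x = 0 :> kahler phi.
Proof.
move=> xN; have := kahler_piZ 0 0; rewrite !scale0r => <-.
by apply/eqP; rewrite quotmod_pi_eq subr0.
Qed.

Lemma kahler_relP (f : F) : kahler_relations phi f -> f \in kahler_rel phi.
Proof.
by move=> hf; rewrite unfold_in /kahler_rel; apply/asboolP => N [_]; apply.
Qed.

Lemma kahler_relW (N : set F) : is_submodule N ->
  kahler_relations phi `<=` N -> forall f, f \in kahler_rel phi -> N f.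
Proof.
move=> subN relN f; rewrite unfold_in /kahler_rel => /asboolP; apply.
by split.
Qed.

Lemma quotmod_piN (x : F) : quotmod_pi (kahler_rel phi) (- x) =
  - (quotmod_pi (kahler_rel phi) x : kahler phi).
Proof. by rewrite -[- x]scaleN1r kahler_piZ scaleN1r. Qed.

Lemma kdiffD (x y : B) : kdiff (x + y) = kdiff x + kdiff y.
Proof.
apply/eqP; rewrite -subr_eq0 opprD addrA; apply/eqP.
rewrite -!quotmod_piN -!quotmod_piD; apply/kahler_pi0/kahler_relP.
by constructor 1; exists x, y.
Qed.

Lemma kdiffM (x y : B) : kdiff (x * y) = x *: kdiff y + y *: kdiff x.
Proof.
apply/eqP; rewrite -subr_eq0 opprD addrA; apply/eqP.
rewrite /kdiff -!kahler_piZ -!quotmod_piN -!quotmod_piD; apply/kahler_pi0/kahler_relP.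
by constructor 2; exists x, y.
Qed.

Lemma kdiff_alg (a : A) : kdiff (phi a) = 0.
Proof. by apply/kahler_pi0/kahler_relP; constructor 3; exists a. Qed.

Lemma kahler_ind (P : kahler phi -> Prop) :
  P 0 -> (forall x y, P x -> P y -> P (x + y)) ->
  (forall b x, P x -> P (b *: x)) -> (forall b, P (kdiff b)) ->
  forall x, P x.
Proof.
move=> P0 PD PZ Pd x; rewrite -[x]quotmod_piK (freeg_span (repr x)).
elim: (dom _) => [|z s IH].
  by rewrite big_nil kahler_pi0 ?rpred0 //; exact: P0.
rewrite big_cons quotmod_piD kahler_piZ; apply: PD; last exact: IH.
exact/PZ/Pd.
Qed.

End KahlerTheory.

Lemma big_in_span (B : pzRingType) (M : lmodType B) n (e : 'I_n -> M) (P : M -> Prop) :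
  P = (fun x => exists c : 'I_n -> B, x = \sum_j c j *: e j) ->
  [/\ P 0, forall x y, P x -> P y -> P (x + y),
      forall b x, P x -> P (b *: x) & forall j, P (e j)].
Proof.
move=> ->; split.
- by exists (fun=> 0); rewrite big1 // => j _; rewrite scale0r.
- move=> _ _ [c ->] [c' ->]; exists (fun j => c j + c' j).
  by rewrite -big_split /=; apply: eq_bigr => j _; rewrite scalerDl.
- move=> b _ [c ->]; exists (fun j => b * c j).
  by rewrite scaler_sumr; apply: eq_bigr => j _; rewrite scalerA.
- move=> j; exists (fun i => (i == j)%:R).
  rewrite (bigD1 j) //= eqxx scale1r big1 ?addr0 // => i /negPf ->.
  by rewrite scale0r.
Qed.

(** * A lower bound for the Jacobian ideal *)

Section Valuations.
Variables (K : fieldType) (v : discrete_valuation K).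
Implicit Types x y : K.

Lemma in_valringP x : x != 0 -> (x \in in_valring v) = (0 <= v x).
Proof. by move=> x0; rewrite unfold_in /in_valring (negPf x0). Qed.

Lemma valring_ge0 (a : valring v) : valring_val a != 0 -> 0 <= v (valring_val a).
Proof. by move=> a0; rewrite -in_valringP // valring_valP. Qed.

Lemma dvalX x n : x != 0 -> v (x ^+ n) = v x *+ n.
Proof.
move=> x0; elim: n => [|n IH]; first by rewrite expr0 dval1 mulr0n.
by rewrite exprS dvalM ?expf_neq0 // IH mulrS.
Qed.

Lemma dvalN x : v (- x) = v x.
Proof.
have [->|x0] := eqVneq x 0; first by rewrite oppr0.
by rewrite -mulN1r dvalM ?dvalN1 ?add0r // oppr_eq0 oner_eq0.
Qed.

Lemma dval_prod (I : eqType) (r : seq I) (P : pred I) (F : I -> K) :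
  (forall i, P i -> F i != 0) ->
  v (\prod_(i <- r | P i) F i) = \sum_(i <- r | P i) v (F i).
Proof.
move=> F0; elim: r => [|i r IH]; first by rewrite !big_nil dval1.
rewrite !big_cons; case: ifP => // Pi; rewrite dvalM ?F0 ?IH //.
by rewrite prodf_seq_neq0; apply/allP => j _; apply/implyP => /F0.
Qed.

(* The junk value of [dval] at 0 is bypassed by the disjunction [x == 0]. *)
Definition val_ge (c : int) : set K := [set x | (x == 0) || (c <= v x)].

Lemma val_ge_sum c (I : Type) (r : seq I) (P : pred I) (F : I -> K) :
  (forall i, P i -> val_ge c (F i)) -> val_ge c (\sum_(i <- r | P i) F i).
Proof.
move=> F0; elim/big_ind: _ => //; first by rewrite /val_ge /= eqxx.
by move=> x y; apply: valD_ge.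
Qed.

Lemma val_ge_le c c' x : c' <= c -> val_ge c x -> val_ge c' x.
Proof. by move=> le_c /orP[x0|h]; apply/orP; [left|right; apply: le_trans h]. Qed.

End Valuations.

(* [M] itself, seen as a module over the valuation ring. *)
Definition valmod (K : fieldType) (_ : discrete_valuation K) (M : lmodType K) : Type := M.

Section ValringModule.
Variables (K : fieldType) (v : discrete_valuation K) (M : lmodType K).
Local Notation valmod := (valmod v M).

HB.instance Definition _ := GRing.Zmodule.copy valmod M.

Definition valmod_scale (a : valring v) (x : valmod) : valmod :=
  (valring_val a *: (x : M))%R.

Fact valmod_scaleA a b x :
  valmod_scale a (valmod_scale b x) = valmod_scale (a * b) x.
Proof. exact: scalerA. Qed.
Fact valmod_scale1 : left_id 1 valmod_scale.
Proof. by move=> x; exact: scale1r. Qed.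
Fact valmod_scaleDr : right_distributive valmod_scale +%R.
Proof. by move=> a x y; exact: scalerDr. Qed.
Fact valmod_scaleDl x : {morph valmod_scale^~ x : a b / a + b}.
Proof. by move=> a b; exact: scalerDl. Qed.

HB.instance Definition _ := GRing.Zmodule_isLmodule.Build (valring v) valmod
  valmod_scaleA valmod_scale1 valmod_scaleDr valmod_scaleDl.

Lemma valmodZ (a : valring v) (x : valmod) : a *: x = valring_val a *: (x : M) :> M.
Proof. by []. Qed.
End ValringModule.

Section LogJacobian.
Variables (K : fieldType) (v : discrete_valuation K) (A : comNzRingType).
Variables (phi : {rmorphism A -> valring v}) (d : nat).
Variables (x : 'I_d -> K) (theta : 'I_d -> K -> K).
Hypothesis x_neq0 : forall i, x i != 0.
Hypothesis x_ge0 : forall i, 0 <= v (x i).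
Hypothesis thetaD : forall i, {morph theta i : a b / a + b}.
Hypothesis thetaM : forall i a b, theta i (a * b) = a * theta i b + b * theta i a.
Hypothesis theta_x : forall i j, theta i (x j) = (i == j)%:R * x j.
Hypothesis theta_alg : forall i a, exists y : valring v,
  theta i (valring_val (phi a)) = valring_val y * x i.

Local Notation V := (valring v).
Local Notation F := {freeg V / V}.
Local Notation VK := (@valring_val K v).
Local Notation E := (valmod v 'rV[K]_d).

(* The derivation [theta i], to be [x i * d/dx i], does not kill [A]: [log_lift]
   does not factor through the differentials, but sends their relations into the
   lattice spanned by the [x j]. *)
Definition log_diff (b : V) : E := \row_j theta j (VK b).
Definition log_lift : F -> E := free_lift log_diff.

Definition log_lattice : set F :=
  [set f | exists y : 'rV[V]_d,
     (log_lift f : 'rV[K]_d) = map_mx VK y *m diag_mx (\row_j x j)].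

Lemma mulmx_diag_row (y : 'rV[K]_d) : y *m diag_mx (\row_j x j) = \row_j (y 0 j * x j).
Proof. by apply/rowP => j; rewrite mul_mx_diag !mxE. Qed.

Lemma log_lattice_submodule : is_submodule log_lattice.
Proof.
split.
- by exists 0; rewrite map_mx0 mul0mx /log_lift free_lift0.
- move=> f g [y hy] [z hz]; exists (y + z).
  by rewrite /log_lift free_liftD map_mxD mulmxDl -hy -hz.
- move=> b f [y hy]; exists (b *: y).
  by rewrite /log_lift free_liftZ valmodZ -/log_lift hy map_mxZ scalemxAl.
Qed.

(** Additivity and the Leibniz rule go to zero because every [theta i] is a derivation. Only the
    relations killing [phi a] can have a nonzero image, and [theta_alg] makes its entry of index [j]
    a multiple of [x j]. *)
Lemma kahler_rel_log_lattice f : f \in kahler_rel phi -> log_lattice f.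
Proof.
apply: kahler_relW; first exact: log_lattice_submodule.
move=> {}f [[a [b ->]]|[a [b ->]]|[a ->]].
- exists 0; rewrite map_mx0 mul0mx /log_lift !free_liftD !free_liftN !free_lift1.
  apply/rowP => j; rewrite !mxE /= thetaD; ring.
- exists 0; rewrite map_mx0 mul0mx /log_lift !free_liftD !free_liftN !free_liftZ !free_lift1.
  apply/rowP => j; rewrite !mxE /= thetaM; ring.
- have [y hy] := choice (fun i => theta_alg i a).
  exists (\row_j y j); rewrite /log_lift free_lift1 mulmx_diag_row.
  by apply/rowP => j; rewrite !mxE hy.
Qed.

Local Notation X := (diag_mx (\row_j x j)).

Section Presentation.
Variables (n : nat) (e : 'I_n -> kahler phi).
Local Notation W :=
  (\matrix_(j < n, i < d) (log_lift (repr (e j)) : 'rV[K]_d) 0 i).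

Lemma quotmod_pi_sum (c : 'I_n -> V) :
  \sum_j c j *: e j =
  quotmod_pi (kahler_rel phi) (\sum_j c j *: (repr (e j) : F)) :> kahler phi.
Proof.
apply: (big_ind2 (fun a b => a = quotmod_pi (kahler_rel phi) b :> kahler phi)).
- by rewrite kahler_pi0 ?rpred0.
- by move=> _ a _ b -> ->; rewrite quotmod_piD.
- by move=> j _; rewrite kahler_piZ quotmod_piK.
Qed.

Lemma log_lift_sum (c : 'I_n -> V) :
  log_lift (\sum_j c j *: (repr (e j) : F)) = map_mx VK (\row_j c j) *m W.
Proof.
rewrite mulmx_sum_row.
apply: (big_ind2 (fun (a : F) (b : 'rV[K]_d) => log_lift a = b)).
- by rewrite /log_lift free_lift0.
- by move=> a a' b b' <- <-; rewrite /log_lift free_liftD.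
- move=> j _; rewrite /log_lift free_liftZ valmodZ !mxE; congr (_ *: _).
  by apply/rowP => i; rewrite !mxE.
Qed.

(** Two lifts to [F] of the same differential differ by a relation, so [log_lift] is well defined on
    differentials modulo the rows of [X]. *)
Lemma log_lift_span (f : F) (c : 'I_n -> V) :
  quotmod_pi (kahler_rel phi) f = \sum_j c j *: e j ->
  exists y : 'rV[V]_d,
    log_lift f = map_mx VK (\row_j c j) *m W + map_mx VK y *m X.
Proof.
rewrite quotmod_pi_sum => /eqP; rewrite quotmod_pi_eq => /kahler_rel_log_lattice[y].
rewrite /log_lift free_liftD free_liftN -/log_lift log_lift_sum => hy.
by exists y; rewrite -hy addrC subrK.
Qed.

Hypothesis gen_e : forall y : kahler phi, exists c : 'I_n -> V, y = \sum_j c j *: e j.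
Variable C : 'M[V]_n.
Hypothesis relC : forall i, \sum_j C i j *: e j = 0.

Lemma log_diff_span (b : V) : exists (s : 'rV[V]_n) (t : 'rV[V]_d),
  log_diff b = map_mx VK s *m W + map_mx VK t *m X.
Proof.
have [c hc] := gen_e (kdiff phi b).
have [y] := log_lift_span hc; rewrite /log_lift free_lift1 => ->.
by exists (\row_j c j), y.
Qed.

Lemma relation_log_lattice : exists Y : 'M[V]_(n, d), map_mx VK C *m W = map_mx VK Y *m X.
Proof.
have /choice[y hy] i : exists y : 'rV[V]_d, row i (map_mx VK C *m W) = map_mx VK y *m X.
  have := relC i; rewrite quotmod_pi_sum => /eqP.
  rewrite -[X in _ == X](kahler_pi0 (rpred0 (kahler_rel phi))) quotmod_pi_eq subr0.
  move=> /kahler_rel_log_lattice[y]; rewrite log_lift_sum => hy; exists y.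
  rewrite -hy row_mul; congr (_ *m _).
  by apply/rowP => j; rewrite !mxE.
exists (\matrix_i y i); apply/row_matrixP => i.
by rewrite hy row_mul; congr (_ *m _); apply/rowP => j; rewrite !mxE.
Qed.

Lemma theta1 i : theta i 1 = 0.
Proof. by apply: (addrI (theta i 1)); rewrite addr0 -{3}[1]mulr1 thetaM !mul1r. Qed.

Lemma thetaX i a k : theta i (a ^+ k) = k%:R * (a ^+ k * (theta i a / a)).
Proof.
have [->|a0] := eqVneq a 0.
  have t0 : theta i 0 = 0 by have := thetaM i 0 0; rewrite !mul0r addr0.
  by rewrite t0 mul0r !mulr0 expr0n; case: k => [|k] /=; rewrite ?theta1 ?t0.
elim: k => [|k IH]; first by rewrite expr0 theta1 mul0r.
by rewrite exprS thetaM IH -natr1; field.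
Qed.

(** Write [x i] as [u] times the power [k] of [p], with [u] a unit; then dlog x_i = dlog u + k dlog
    p. The left side is the standard row by [theta_x], and dlog u is [u^-1], an element of the
    valuation ring, times a row given by [log_diff_span]. Hence [a] is [k]. *)
Lemma log_standard (i : 'I_d) (p : V) : v (VK p) = 1 -> VK p != 0 ->
  exists (s : 'rV[V]_n) (t : 'rV[V]_d) (a : V),
    delta_mx 0 i = map_mx VK s *m W + map_mx VK t *m X
      + VK a *: ((VK p)^-1 *: log_diff p : 'rV[K]_d).
Proof.
move=> vp p0; pose k := `|v (x i)|%N.
have pk0 : VK p ^+ k != 0 by rewrite expf_neq0.
pose u := x i / VK p ^+ k.
have u0 : u != 0 by rewrite mulf_neq0 ?invr_eq0.
have vu : v u = 0.
  rewrite dvalM ?invr_eq0 // dvalV // dvalX // vp natz.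
  by rewrite gez0_abs // subrr.
have uV : u \in in_valring v by rewrite in_valringP // vu.
have uVV : u^-1 \in in_valring v by rewrite in_valringP ?invr_eq0 // dvalV // vu oppr0.
have [s [t hst]] := log_diff_span (ValRing uV).
exists (ValRing uVV *: s), (ValRing uVV *: t), k%:R.
rewrite !map_mxZ -!scalemxAl -scalerDr -hst /=.
apply/rowP => j; rewrite !mxE rmorph_nat eqxx /=.
have := thetaM j u (VK p ^+ k); rewrite divfK // theta_x thetaX eq_sym.
set D := (i == j)%:R => h; have x0 := x_neq0 i.
have -> : theta j u = (D * x i - u * (k%:R * (VK p ^+ k * (theta j (VK p) / VK p)))) / VK p ^+ k.
  by rewrite h addrAC subrr add0r mulrAC mulfV ?mul1r.
by rewrite /u; field; rewrite p0 pk0.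
Qed.

(* With [W] the matrix of the [log_lift]s of the generators, [X] the diagonal
   matrix of the [x i], [p] a uniformizer and [tau = dlog p], there are matrices
   over the valuation ring such that
     [C W = Y X], [1 = S W + T X + a tau], [p tau = s0 W + t0 X].
   These say that [Z G] below is block triangular of determinant [p \det C]. *)
Lemma jacobian_det_bound : \det C != 0 ->
  \sum_i v (x i) - 1 <= v (VK (\det C)).
Proof.
move=> detC0; have [u u0 vu] := dval_onto v 1.
have uV : u \in in_valring v by rewrite in_valringP // vu.
pose p := ValRing uV; have [Y hY] := relation_log_lattice.
have [s0 [t0 hp]] := log_diff_span p.
have /choice[st hst] i : exists st : 'rV[V]_n * 'rV[V]_d * V,
    delta_mx 0 i = map_mx VK st.1.1 *m W + map_mx VK st.1.2 *m X
      + VK st.2 *: (u^-1 *: log_diff p : 'rV[K]_d).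
  by have [s [t [a h]]] := @log_standard i p vu u0; exists (s, t, a).
pose S := \matrix_i (st i).1.1; pose T := \matrix_i (st i).1.2.
pose a : 'cV[V]_d := \col_i (st i).2.
pose tau : 'rV[K]_d := u^-1 *: (log_diff p : 'rV[K]_d).
pose Z := block_mx C (row_mx (- Y) (0 : 'M_(n, 1)))
  (col_mx S (- s0)) (block_mx T a (- t0) p%:M).
pose G := block_mx (1%:M : 'M[K]_n) (row_mx W 0) 0 (block_mx X 0 tau 1%:M).
have hST : map_mx VK S *m W + map_mx VK T *m X + map_mx VK a *m tau = 1%:M.
  apply/row_matrixP => i; rewrite row1 (hst i) !linearD /= !row_mul -/tau.
  congr (_ + _ + _).
  - by congr (_ *m _); apply/rowP => j; rewrite !mxE.
  - by congr (_ *m _); apply/rowP => j; rewrite !mxE.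
  - by rewrite [row i _]mx11_scalar mul_scalar_mx !mxE.
have hut : u *: tau = map_mx VK s0 *m W + map_mx VK t0 *m X.
  by rewrite /tau scalerA mulfV // scale1r hp.
have ZG : map_mx VK Z *m G = block_mx (map_mx VK C) 0
    (col_mx (map_mx VK S) (- map_mx VK s0)) (block_mx 1%:M (map_mx VK a) 0 u%:M).
  rewrite /Z /G map_block_mx map_row_mx map_col_mx map_block_mx !map_mxN !map_mx0.
  rewrite map_scalar_mx mulmx_block !mulmx1 !mulmx0 !addr0; congr block_mx.
    rewrite mul_mx_row mul_row_block !mulNmx !mul0mx !addr0 !mulmx0 hY oppr0.
    by rewrite add_row_mx subrr addr0 row_mx0.
  rewrite mul_col_row !mulmx0 mulmx_block !mulmx0 !mulmx1 !add0r add_block_mx.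
  rewrite !add0r addrA hST; congr block_mx.
  by rewrite !mulNmx addrA -opprD -hut mul_scalar_mx addNr.
have := congr1 determinant ZG.
rewrite det_mulmx det_lblock !det_ublock det_lblock !det_scalar1 !det1 !mul1r !mulr1.
rewrite det_diag !det_map_mx => hdet'.
have hdet : VK (\det Z) * \prod_i (\row_j x j) 0 i = VK (\det C) * u := hdet'.
have vC : v (VK (\det C) * u) = v (VK (\det C)) + 1 by rewrite dvalM ?vu.
have prod0 : \prod_i (\row_j x j) 0 i != 0.
  by apply/prodf_neq0 => i _; rewrite mxE.
have detZ0 : VK (\det Z) != 0.
  by apply: contraNneq detC0 => Z0; move/eqP: hdet; rewrite Z0 mul0r eq_sym mulf_eq0 (negPf u0) orbF.
(* The entries of [Z] lie in the valuation ring, so its determinant has nonnegative value; the [- 1]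
   of the bound is the value of the uniformizer [u]. *)
rewrite lerBlDr -vC -hdet dvalM // dval_prod; last by move=> i _; rewrite mxE.
rewrite -[leLHS]add0r lerD ?valring_ge0 // le_eqVlt; apply/orP; left; apply/eqP.
by apply: eq_bigr => i _; rewrite mxE.
Qed.

End Presentation.
End LogJacobian.

Lemma fraction_split (R : idomainType) (z : {fraction R}) :
  exists a b : R, b != 0 /\ z = a%:F / b%:F.
Proof.
elim/quotW: z => x; exists (frac x).1, (frac x).2; split; first exact: denom_ratioP.
apply: (@mulIf _ ((frac x).2)%:F); rewrite ?tofrac_eq0 ?denom_ratioP //.
rewrite divfK ?tofrac_eq0 ?denom_ratioP //; unlock FracField.tofrac.
rewrite -[LHS]FracField.pi_mul; apply/eqmodP; rewrite /= FracField.equivfE /=.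
by rewrite /FracField.mulf !numden_Ratio ?(oner_eq0, mulr1, mulf_neq0, denom_ratioP) // mulrC.
Qed.

Lemma quotient_ruleD (K : fieldType) (A B C E A' B' C' E' : K) :
  B != 0 -> E != 0 ->
  ((A * E' + E * A' + (C * B' + B * C')) * (B * E) -
   (A * E + C * B) * (B * E' + E * B')) / (B * E) ^+ 2 =
  (A' * B - A * B') / B ^+ 2 + (C' * E - C * E') / E ^+ 2.
Proof. by move=> B0 E0; field; rewrite B0 E0. Qed.

Lemma quotient_ruleM (K : fieldType) (A B C E A' B' C' E' : K) :
  B != 0 -> E != 0 ->
  ((A * C' + C * A') * (B * E) - A * C * (B * E' + E * B')) / (B * E) ^+ 2 =
  A / B * ((C' * E - C * E') / E ^+ 2) + C / E * ((A' * B - A * B') / B ^+ 2).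
Proof. by move=> B0 E0; field; rewrite B0 E0. Qed.

Section FractionDerivation.
Variables (R : idomainType) (D : R -> R).
Hypothesis DD : {morph D : a b / a + b}.
Hypothesis DM : forall a b, D (a * b) = a * D b + b * D a.

Lemma fraction_derivation : exists D' : {fraction R} -> {fraction R},
  [/\ {morph D' : a b / a + b},
      forall a b, D' (a * b) = a * D' b + b * D' a &
      forall a, D' a%:F = (D a)%:F].
Proof.
have /choice[ab hab] (z : {fraction R}) :
    exists ab : R * R, ab.2 != 0 /\ z = ab.1%:F / ab.2%:F.
  by have [a [b h]] := fraction_split z; exists (a, b).
pose dq (a b : R) := ((D a)%:F * b%:F - a%:F * (D b)%:F) / b%:F ^+ 2.
pose D' z := dq (ab z).1 (ab z).2.
have D'E a b : b != 0 -> D' (a%:F / b%:F) = dq a b.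
  move=> b0; have [] := hab (a%:F / b%:F); rewrite /D'.
  move: (ab _) => [c e] /= e0 /eqP.
  have bF : b%:F != 0 by rewrite tofrac_eq0.
  have eF : e%:F != 0 by rewrite tofrac_eq0.
  rewrite eqr_div // -!tofracM tofrac_eq => /eqP h.
  have h' := congr1 D h; move: h'; rewrite !DM => h'.
  rewrite /dq; apply/eqP; rewrite eqr_div ?expf_neq0 //.
  rewrite -!tofracM -!tofracXn -!tofracB -!tofracM tofrac_eq -subr_eq0; apply/eqP.
  (* The difference of the two quotient-rule numerators, cross-multiplied, is a combination of the
     relation between the two fractions and of its derivative. *)
  have -> : (D c * e - c * D e) * b ^+ 2 - (D a * b - a * D b) * e ^+ 2 =
      e * b * ((c * D b + b * D c) - (a * D e + e * D a)) -
      (b * D e + e * D b) * (c * b - a * e) by ring.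
  by rewrite h h' !subrr !mulr0 subrr.
have D'F a : D' a%:F = (D a)%:F.
  have D1 : D 1 = 0.
    by apply: (addrI (D 1)); rewrite addr0 -{3}[1]mulr1 DM !mul1r.
  rewrite -[a%:F]divr1 -tofrac1 D'E ?oner_eq0 // /dq D1 tofrac1 tofrac0.
  by rewrite mulr0 subr0 mulr1 expr1n divr1.
have fr (z : {fraction R}) : exists a b, [/\ b%:F != 0, b != 0 & z = a%:F / b%:F].
  by have [a [b [b0 ->]]] := fraction_split z; exists a, b; split; rewrite ?tofrac_eq0.
exists D'; split=> // z1 z2; have [a [b [bF b0 ->]]] := fr z1;
  have [c [e [eF e0 ->]]] := fr z2.
  have -> : a%:F / b%:F + c%:F / e%:F = (a * e + c * b)%:F / (b * e)%:F.
    by rewrite tofracD !tofracM addf_div.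
  rewrite !D'E ?mulf_neq0 // /dq !(DD, DM, tofracD, tofracM).
  exact: quotient_ruleD.
have -> : a%:F / b%:F * (c%:F / e%:F) = (a * c)%:F / (b * e)%:F.
  by rewrite !tofracM mulf_div.
rewrite !D'E ?mulf_neq0 // /dq !(DM, tofracD, tofracM).
exact: quotient_ruleM.
Qed.

End FractionDerivation.

Section JacobianBound.
Variables (k : fieldType) (d : nat).
Local Notation R := {mpoly k[d]}.
Local Notation K := {fraction R}.
Variables (v : discrete_valuation K) (Rv : valring_contains v).

Lemma mpolyXU_neq0 (i : 'I_d) : 'X_i != 0 :> R.
Proof. by apply/eqP => /(congr1 (mcoeff U_(i))); rewrite mcoeffX eqxx mcoeff0 => /eqP; rewrite oner_eq0. Qed.

(** The elements satisfying the bound form an ideal, so one minor at a time may be treated, by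
    [jacobian_det_bound] with the derivations x_i d/dx_i extended to the fraction field. *)
Lemma jacobian_lower_bound (z : valring v) : jacobian_ideal Rv z ->
  val_ge v (\sum_(i < d) v ('X_i : R)%:F - 1) (valring_val z).
Proof.
have x0 i : ('X_i : R)%:F != 0 by rewrite tofrac_eq0 mpolyXU_neq0.
have x_ge0 i : 0 <= v ('X_i : R)%:F by rewrite -in_valringP //; apply: Rv.
have /choice[theta htheta] (i : 'I_d) : exists D' : K -> K,
    [/\ {morph D' : a b / a + b}, forall a b, D' (a * b) = a * D' b + b * D' a &
      forall a : R, D' a%:F = ('X_i * a^`M(i))%:F].
  apply: (@fraction_derivation R (fun a => 'X_i * a^`M(i))) => a b.
    by rewrite mderivD mulrDr.
  by rewrite mderivM mulrDr addrC mulrCA [X in _ + X]mulrA [X in _ + X]mulrC.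
move=> [n [e [gen_e]]].
move=> /(_ [set y : valring v | val_ge v (\sum_(i < d) v ('X_i : R)%:F - 1) (valring_val y)]).
apply; split; last first.
  move=> _ [C relC <-]; have [->|detC0] := eqVneq (\det C) 0.
    by apply/orP; left; apply/eqP; exact: (rmorph0 (@valring_val K v)).
  apply/orP; right.
  apply: (@jacobian_det_bound K v R (to_valring Rv) d (fun i => ('X_i : R)%:F) theta x0 x_ge0 _ _ _ _ n e gen_e C relC detC0).
  - by move=> i; have [] := htheta i.
  - by move=> i; have [] := htheta i.
  - move=> i j; have [_ _ ->] := htheta i; rewrite mderivX mnm1E.
    have [->|ij] := eqVneq i j; last by rewrite scale0r mulr0 tofrac0 mul0r.
    have -> : (U_(j) - U_(j) = 0 :> 'X_{1..d})%MM.
      by apply/mnmP => l; rewrite mnmBE subnn mnm0E.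
    by rewrite mpolyX0 scale1r mulr1 mul1r.
  - move=> i a; have [_ _ D_alg] := htheta i; exists (to_valring Rv (a^`M(i))).
    by rewrite /= D_alg tofracM mulrC.
split.
- by apply/orP; left; apply/eqP; exact: (rmorph0 (@valring_val K v)).
- by move=> a b; exact: valD_ge.
- move=> a b hb; rewrite -[X in val_ge _ X]add0r.
  exact: (valM_ge (valring_valP a) hb).
Qed.

End JacobianBound.

(** * Counting monomials *)

(** Polynomials of [msize] at most [B] only involve exponents below [B], so each is described by
    [B ^ d] coefficients, fewer than there are polynomials. *)
Lemma mpoly_lin_dep (k : fieldType) d (T : finType) (B : nat) (h : T -> {mpoly k[d]}) :
  (forall t, msize (h t) <= B)%N -> (B ^ d < #|T|)%N ->
  exists lam : T -> k, (exists t, lam t != 0) /\ \sum_t lam t *: h t = 0.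
Proof.
move=> hB ltBT.
pose J := {ffun 'I_d -> 'I_B}.
pose mon (j : J) : 'X_{1..d} := [multinom val (j i) | i < d].
pose A : 'M[k]_(#|T|, #|J|) :=
  \matrix_(i, j) (h (enum_val i))@_(mon (enum_val j)).
have : ~~ row_free A.
  rewrite /row_free neq_ltn; apply/orP; left.
  by rewrite (leq_ltn_trans (rank_leq_col A)) // card_ffun !card_ord.
rewrite -kermx_eq0 => /rowV0Pn[u /sub_kermxP uA u0].
exists (fun t => u 0 (enum_rank t)); split.
  apply: contrapT => nu; case/eqP: u0; apply/rowP => i; rewrite mxE.
  apply: contrapT => /eqP ui; case: nu; exists (enum_val i); by rewrite enum_valK.
apply/mpolyP => m; rewrite mcoeff0 raddf_sum /=.
have [/forallP mB|] := boolP [forall i, m i < B]%N; last first.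
  rewrite negb_forall => /existsP[i]; rewrite -leqNgt => Bm.
  rewrite big1 // => t _; rewrite mcoeffZ.
  rewrite (_ : _@_m = 0) ?mulr0 //; apply: memN_msupp_eq0; apply: msize_mdeg_ge.
  apply: leq_trans (hB t) _; apply: leq_trans Bm _.
  by rewrite mdegE (bigD1 i) //= leq_addr.
pose j : J := [ffun i => Ordinal (mB i)].
have /rowP/(_ (enum_rank j)) := uA; rewrite !mxE => uAj; rewrite -[RHS]uAj.
rewrite [RHS](reindex (@enum_rank T)) /=; last by apply: onW_bij; apply: enum_rank_bij.
apply: eq_bigr => t _; rewrite mcoeffZ !mxE !enum_rankK; congr (_ * _@__).
by apply/mnmP => i; rewrite mnmE ffunE.
Qed.

Lemma common_denominator (R : idomainType) (I : finType) (f : I -> {fraction R}) :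
  exists (g : R) (a : I -> R), g != 0 /\ forall i, f i = (a i)%:F / g%:F.
Proof.
have /choice[ab hab] i : exists ab : R * R, ab.2 != 0 /\ f i = ab.1%:F / ab.2%:F.
  by have [a [b h]] := fraction_split (f i); exists (a, b).
exists (\prod_i (ab i).2), (fun i => (ab i).1 * \prod_(j | j != i) (ab j).2).
split; first by apply/prodf_neq0 => i _; have [] := hab i.
move=> i; have [bi ->] := hab i; rewrite [X in _ = _ / X%:F](bigD1 i) //= !tofracM.
have pF : (\prod_(j | j != i) (ab j).2)%:F != 0.
  by rewrite tofrac_eq0; apply/prodf_neq0 => j _; have [] := hab j.
by rewrite -mulf_div mulfV // mulr1.
Qed.

Lemma msizeM_le (k : fieldType) d (p q : {mpoly k[d]}) a b :
  (msize p <= a.+1)%N -> (msize q <= b.+1)%N -> (msize (p * q) <= (a + b).+1)%N.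
Proof.
have [->|p0] := eqVneq p 0; first by rewrite mul0r msize0.
have [->|q0] := eqVneq q 0; first by rewrite mulr0 msize0.
by rewrite msizeM //; move: (msize p) (msize q) => x y; lia.
Qed.

Lemma msizeX_le (k : fieldType) d (p : {mpoly k[d]}) a n :
  (msize p <= a.+1)%N -> (msize (p ^+ n) <= (n * a).+1)%N.
Proof.
move=> pa; elim: n => [|n IH]; first by rewrite expr0 msize1.
by rewrite exprS mulSn msizeM_le.
Qed.

Lemma msize_prod_le (k : fieldType) d (I : finType) (p : I -> {mpoly k[d]}) a :
  (forall i, msize (p i) <= a.+1)%N -> (msize (\prod_i p i) <= (#|I| * a).+1)%N.
Proof.
move=> pa; rewrite cardE -big_enum /=; elim: (enum I) => [|i s IH].
  by rewrite big_nil msize1.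
by rewrite big_cons /= mulSn msizeM_le.
Qed.

Lemma clear_denominators (K : fieldType) (J : finType) (u a : J -> K) (g g' a' : K)
    (m : nat) (b : J -> nat) :
  g != 0 -> g' != 0 -> (forall j, u j = a j / g) -> (forall j, (b j <= m)%N) ->
  (g ^+ m) ^+ #|J| * g' * ((\prod_j u j ^+ b j) * (a' / g')) =
  \prod_j (a j ^+ b j * g ^+ (m - b j)) * a'.
Proof.
move=> g0 g'0 ua bm.
have -> : (g ^+ m) ^+ #|J| * g' * ((\prod_j u j ^+ b j) * (a' / g')) =
    ((g ^+ m) ^+ #|J| * \prod_j u j ^+ b j) * a' by field.
congr (_ * _); rewrite -prodr_const -big_split /=; apply: eq_bigr => j _.
rewrite ua expr_div_n mulrCA; congr (_ * _).
by rewrite -[X in g ^+ X / _](subnK (bm j)) exprD mulfK // expf_neq0.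
Qed.

(* Dimension count: the products [f i * u ^ b], cleared of denominators, are more
   numerous than the monomials of their degree. *)
Lemma fraction_lin_dep (k : fieldType) d (J : finType) (u : J -> {fraction {mpoly k[d]}}) :
  exists c, forall (I : finType) (f : I -> {fraction {mpoly k[d]}}),
  exists c', forall M, (0 < M)%N -> ((c * M + c') ^ d < #|I| * M ^ #|J|)%N ->
  exists lam : I -> {ffun J -> 'I_M} -> k, (exists i b, lam i b != 0) /\
    \sum_i \sum_b ((lam i b)%:MP : {mpoly k[d]})%:F * (\prod_j u j ^+ b j) * f i = 0.
Proof.
have [g [a [g0 ua]]] := common_denominator u.
pose D := (msize g + \max_j msize (a j))%N.
have aD j : (msize (a j) <= D.+1)%N.
  apply/leqW/(leq_trans _ (leq_addl _ _)).
  exact: (@leq_bigmax _ (fun j => msize (a j)) j).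
have gD : (msize g <= D.+1)%N by apply/leqW/leq_addr.
(* This slope depends on [u] alone, and [f] affects only the constant [D'.+1]; [eval_K_dependent]
   needs this order, as it chooses the size of [f] after the slope. *)
exists (#|J| * D)%N => I f.
have [g' [a' [g'0 fa]]] := common_denominator f.
pose D' := \max_i msize (a' i).
exists D'.+1 => M M0 lt_card.
pose h (t : I * {ffun J -> 'I_M}) :=
  \prod_j (a j ^+ t.2 j * g ^+ (M.-1 - t.2 j)) * a' t.1.
have hsize t : (msize (h t) <= #|J| * D * M + D'.+1)%N.
  rewrite addnS; apply: msizeM_le; last first.
    by apply/leqW; exact: (@leq_bigmax _ (fun i => msize (a' i)) t.1).
  have -> : (#|J| * D * M = #|J| * (M * D))%N by rewrite -mulnA [(D * M)%N]mulnC.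
  apply: msize_prod_le => j.
  have -> : (M * D = t.2 j * D + (M - t.2 j) * D)%N.
    by rewrite -mulnDl subnKC // ltnW.
  apply: msizeM_le; first exact: msizeX_le.
  apply: leq_trans (msizeX_le _ gD) _; rewrite ltnS leq_mul2r; apply/orP; right.
  by lia.
have [|lam [[[i b] lam0] rel]] := mpoly_lin_dep hsize.
  by rewrite card_prod card_ffun card_ord.
exists (fun i b => lam (i, b)); split; first by exists i, b.
have gF : g%:F != 0 by rewrite tofrac_eq0.
have g'F : g'%:F != 0 by rewrite tofrac_eq0.
have G0 : (g%:F ^+ M.-1) ^+ #|J| * g'%:F != 0
  := mulf_neq0 (expf_neq0 _ (expf_neq0 _ gF)) g'F.
apply: (mulfI G0); rewrite mulr0 pair_bigA mulr_sumr /= -[RHS]tofrac0.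
rewrite -[X in _ = X%:F]rel [RHS](rmorph_sum (@FracField.tofrac _)) /=.
apply: eq_bigr => t _; rewrite -mul_mpolyC tofracM -surjective_pairing fa.
have bM j : (t.2 j <= M.-1)%N by have := ltn_ord (t.2 j); lia.
have := clear_denominators (a' t.1)%:F gF g'F ua bM.
have -> : (h t)%:F = \prod_j ((a j)%:F ^+ t.2 j * g%:F ^+ (M.-1 - t.2 j)) * (a' t.1)%:F.
  rewrite /h tofracM (rmorph_prod (@FracField.tofrac _)); congr (_ * _).
  by apply: eq_bigr => j _; rewrite rmorphM !rmorphXn.
by move=> <-; rewrite -[_ * _ * (_ / _)]mulrA mulrCA.
Qed.

(** * Chains of primes and independence modulo a prime *)

Lemma mpoly_rmorph_ext (k : comNzRingType) n (S : comNzRingType)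
    (f g : {rmorphism {mpoly k[n]} -> S}) :
  (forall c, f c%:MP = g c%:MP) -> (forall i, f 'X_i = g 'X_i) -> f =1 g.
Proof.
move=> fgC fgX; elim/mpolyind => [|c m p _ _ IH]; first by rewrite !rmorph0.
rewrite !rmorphD IH -mul_mpolyC !rmorphM fgC; congr (_ * _ + _).
rewrite mpolyXE_id !rmorph_prod; apply: eq_bigr => i _.
by rewrite !rmorphXn fgX.
Qed.

Section Univariate.
Variables (k : fieldType) (n : nat).

Lemma muniXU (i : 'I_n.+1) : muni ('X_i : {mpoly k[n.+1]}) =
  oapp (fun j => ('X_j)%:P) 'X (unlift ord_max i).
Proof.
rewrite /muni mmapX mmap1U; case: splitP => j /= ij; case: unliftP => [l|] il /=.
- congr ('X__)%:P; apply: val_inj => /=; rewrite -ij il /= /bump.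
  by rewrite leqNgt ltn_ord.
- by have := ltn_ord j; rewrite -ij il /= ltnn.
- move: ij; rewrite il /= /bump leqNgt ltn_ord /= add0n => ij.
  by have := ltn_ord l; rewrite ij ltnNge leq_addr.
- by [].
Qed.

Variables (S : comNzRingType) (c : {rmorphism k -> S}).

Lemma mmap_muni (u : 'I_n.+1 -> S) (p : {mpoly k[n.+1]}) :
  mmap c u p = (map_poly (mmap c (u \o fintype.lift ord_max)) (muni p)).[u ord_max].
Proof.
pose f : {rmorphism {mpoly k[n.+1]} -> S} := mmap c u.
pose h : {rmorphism {mpoly k[n]} -> S} := mmap c (u \o fintype.lift ord_max).
have cm : commr_rmorph h (u ord_max) by move=> x; exact: mulrC.
pose g : {rmorphism {mpoly k[n.+1]} -> S} := horner_morph cm \o (@muni n k).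
suff : f =1 g by move/(_ p).
apply: mpoly_rmorph_ext => [a|i]; rewrite /f /g /= /horner_morph.
  by rewrite muniC map_polyC hornerC /= !mmapC.
rewrite mmapX mmap1U muniXU; case: unliftP => [j ->|->] /=.
  by rewrite map_polyC hornerC /= mmapX mmap1U.
by rewrite map_polyX hornerX.
Qed.
End Univariate.

Lemma muni_inj (k : fieldType) n : injective (@muni n k).
Proof.
move=> p q eq_pq.
pose c : {rmorphism k -> {mpoly k[n.+1]}} := @mpolyC n.+1 k.
have id_mmap (r : {mpoly k[n.+1]}) : mmap c (fun i => 'X_i) r = r.
  rewrite -[RHS]comp_mpoly_id /comp_mpoly; apply: eq_bigr => m _; congr (_ * _).
  by apply: mmap1_eq => i; rewrite tnth_mktuple.
by rewrite -[p]id_mmap -[q]id_mmap !mmap_muni eq_pq.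
Qed.

Lemma poly_coef0_split (A : nzRingType) (q : {poly A}) :
  exists q', q = q' * 'X + (q`_0)%:P.
Proof.
exists (\poly_(i < (size q).-1) q`_i.+1); apply/polyP => i.
rewrite coefD coefC coefMX coef_poly; case: i => [|i] /=; first by rewrite add0r.
rewrite addr0; case: ltnP => // le_q; rewrite nth_default //.
by case: (size q) le_q => // *; rewrite ltnW.
Qed.

Lemma poly_Xn_factor (A : idomainType) (q : {poly A}) : q != 0 ->
  exists a (q' : {poly A}), q'`_0 != 0 /\ q = q' * 'X^a.
Proof.
move=> q0; have [a [q' + qE]] := multiplicity_XsubC q 0.
rewrite q0 /= => q'r; exists a, q'; split; last by rewrite subr0 in qE.
by rewrite -horner_coef0.
Qed.

Section Independence.
Variables (k : fieldType) (d : nat).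
Local Notation R := {mpoly k[d]}.

(** Algebraic independence over [k] of the residues of the [u i] modulo [P], expressed in [R] to
    avoid forming the quotient. *)
Definition indep_mod (P : set R) n (u : 'I_n -> R) : Prop :=
  forall p : {mpoly k[n]}, p != 0 -> ~ P (mmap (@mpolyC d k) u p).

Lemma ideal_sum (A : comNzRingType) (P : set A) (I : Type) (r : seq I) (Q : pred I) (f : I -> A) :
  is_ideal P -> (forall i, Q i -> P (f i)) -> P (\sum_(i <- r | Q i) f i).
Proof. by move=> [P0 PD _] h; elim/big_ind: _. Qed.

Lemma idealN (A : comNzRingType) (P : set A) x : is_ideal P -> P x -> P (- x).
Proof. by move=> [_ _ PM] Px; rewrite -mulN1r; apply: PM. Qed.

Lemma idealB (A : comNzRingType) (P : set A) x y : is_ideal P -> P x -> P y -> P (x - y).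
Proof. by move=> iP Px Py; have [_ PD _] := iP; apply: PD => //; apply: idealN. Qed.

Lemma prime_expn (A : comNzRingType) (P : set A) x n : is_prime P -> P (x ^+ n) -> P x.
Proof.
move=> [_ P1 PM]; elim: n => [//|n IH]; rewrite exprS => /PM[//|]; exact: IH.
Qed.

(* A relation [p] involving the new element [h] may be divided by powers of [h],
   since [h] is not in [P]; its constant term is then a relation modulo [Q]. *)
Lemma indep_mod_extend (P Q : set R) n (u : 'I_n -> R) (h : R) :
  is_prime P -> is_ideal Q -> P `<=` Q -> Q h -> ~ P h -> indep_mod Q u ->
  indep_mod P (fun i : 'I_n.+1 => oapp u h (unlift ord_max i)).
Proof.
move=> Pp Qi PQ Qh nPh indQ p p0; pose c : {rmorphism k -> R} := @mpolyC d k.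
rewrite (mmap_muni c) /= unlift_none /=.
have -> : mmap c ((fun i : 'I_n.+1 => oapp u h (unlift ord_max i)) \o fintype.lift ord_max)
    = mmap c u.
  apply/funext => q; apply: eq_bigr => m _; congr (_ * _).
  by apply: mmap1_eq => i /=; rewrite liftK.
have : muni p != 0 by rewrite -[0](muni0 n k) (inj_eq (@muni_inj k n)).
move: (muni p) => q q0.
have [a [q1 [q1r qE]]] := poly_Xn_factor q0.
pose ev : {rmorphism {mpoly k[n]} -> R} := mmap c u.
rewrite qE (rmorphM (map_poly ev)) /= map_polyXn hornerM hornerXn mulrC.
have [_ _ PM] := Pp; move=> /PM[/(prime_expn Pp)//|].
move=> /PQ Qq1; apply: (indQ _ q1r); rewrite -/ev.
have [q2 q1E] := poly_coef0_split q1.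
have : Q (map_poly ev (q2 * 'X + (q1`_0)%:P)).[h] by rewrite -q1E.
rewrite rmorphD rmorphM /= map_polyX map_polyC hornerD hornerMX hornerC => Qs.
have [_ _ QM] := Qi.
rewrite -[X in Q X](addKr ((map_poly ev q2).[h] * h)) addrC.
by apply: idealB => //; apply: QM.
Qed.

Lemma mpoly_dependent n (u : 'I_n -> R) : (d < n)%N ->
  exists2 p : {mpoly k[n]}, p != 0 & mmap (@mpolyC d k) u p = 0.
Proof.
move=> lt_dn.
have [c hc] := fraction_lin_dep (fun i => (u i)%:F).
have [c' hc'] := hc 'I_1 (fun=> 1).
(* As [(c * M + c') ^ d] is at most [(c + c') ^ d * M ^ d], it is below [M ^ d.+1], hence below
   [M ^ n], once [M] exceeds [(c + c') ^ d]. *)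
pose M := ((c + c') ^ d).+1.
have [|lam [[i0 [b]]]] := hc' M (ltn0Sn _).
  rewrite !card_ord mul1n; apply: (@leq_trans (M ^ d.+1)); last first.
    by rewrite leq_pexp2l.
  rewrite expnS [X in (_ < X)%N]mulnC.
  apply: (@leq_ltn_trans (M ^ d * (c + c') ^ d)).
    by rewrite -expnMn; case: (d) => // d'; rewrite leq_exp2r // mulnDr [(M * c)%N]mulnC leq_add2l leq_pmull.
  by rewrite ltn_pmul2l ?expn_gt0.
rewrite big_ord1 (ord1 i0) => lam0 rel.
pose mon (b : {ffun 'I_n -> 'I_M}) : 'X_{1..n} := [multinom val (b i) | i < n].
have mon_inj : injective mon.
  move=> b1 b2 /mnmP e; apply/ffunP => i; apply: val_inj.
  by have := e i; rewrite !mnmE.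
exists (\sum_b lam ord0 b *: 'X_[mon b]).
  apply: contraNneq lam0 => /(congr1 (mcoeff (mon b))).
  rewrite mcoeff0 raddf_sum /= (bigD1 b) //= mcoeffZ mcoeffX eqxx mulr1 big1 ?addr0 => [->//|b' bb'].
  by rewrite mcoeffZ mcoeffX (inj_eq mon_inj) (negPf bb') mulr0.
apply/eqP; rewrite -tofrac_eq0; apply/eqP; rewrite -[RHS]rel.
pose cc : {rmorphism k -> R} := @mpolyC d k.
rewrite (raddf_sum (mmap cc u)) (rmorph_sum (@FracField.tofrac _)) /=.
apply: eq_bigr => b' _; rewrite mulr1 mmapZ tofracM mmapX; congr (_ * _).
rewrite (rmorph_prod (@FracField.tofrac _)); apply: eq_bigr => i _.
by rewrite rmorphXn mnmE.
Qed.

(** Going down the chain, every strict inclusion adds one independent element by [indep_mod_extend];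
    at the bottom there are [m + n] algebraically independent polynomials. This is the inequality
    between height, transcendence degree of the quotient and [d]. *)
Lemma prime_chain_indep (P : set R) m n (u : 'I_n -> R) :
  prime_chain P m -> indep_mod P u -> (m + n <= d)%N.
Proof.
move=> [c [cp cs cm]] ind.
have step j : (j <= m)%N -> exists u' : 'I_(j + n) -> R, indep_mod (c (m - j)%N) u'.
  elim: j => [_|j IH le_jm]; first by exists u; rewrite subn0 cm.
  have [u' ind'] := IH (ltnW le_jm).
  have [sub nsub] : c (m - j.+1)%N `<` c (m - j.+1).+1 by apply: cs; lia.
  have ej : (m - j.+1).+1 = (m - j)%N by lia.
  rewrite ej in sub nsub.
  have [h [ch nch]] : exists h, c (m - j)%N h /\ ~ c (m - j.+1)%N h.
    by apply: contrapT => nh; apply: nsub => h ch; apply: contrapT => nch; apply: nh; exists h.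
  exists (fun i : 'I_(j + n).+1 => oapp u' h (unlift ord_max i)).
  apply: (indep_mod_extend _ _ sub ch nch ind'); first by apply: cp; lia.
  by have [] : is_prime (c (m - j)%N) by apply: cp; lia.
have [u' ind'] := step m (leqnn m).
rewrite leqNgt; apply/negP => /(mpoly_dependent u')[p p0 pu].
apply: (ind' p p0); rewrite subnn pu.
by have [[]] : is_prime (c 0%N) by apply: cp.
Qed.

End Independence.

(** As in the lemma of Gauss: if [a] and [b] are the first indices of coefficients of [F] and [G]
    outside [P], all terms but one of the product coefficient of index [a + b] lie in [P], hence so
    does the last one. *)
Lemma poly_coef_prime (A : comNzRingType) (P : set A) (F G : {poly A}) :
  is_prime P -> (forall l, P (F * G)`_l) ->
  (forall l, P F`_l) \/ (forall l, P G`_l).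
Proof.
move=> [iP nP1 PM] FG; have [_ PD PZ] := iP.
have minex (H : {poly A}) : ~ (forall l, P H`_l) ->
    exists a, ~ P H`_a /\ forall l, (l < a)%N -> P H`_l.
  move=> nH; have exH : exists a, `[< ~ P H`_a >].
    apply: contrapT => nex; apply: nH => l; apply: contrapT => nPl.
    by apply: nex; exists l; apply/asboolP.
  case: (ex_minnP exH) => a /asboolP nPa mina; exists a; split=> // l lt_la.
  apply: contrapT => nPl; have := mina l; rewrite asboolT // => /(_ isT).
  by rewrite leqNgt lt_la.
have [|nF] := pselect (forall l, P F`_l); first by left.
have [|nG] := pselect (forall l, P G`_l); first by right.
have [a [nFa ltF]] := minex _ nF; have [b [nGb ltG]] := minex _ nG.
exfalso; suff /PM[] : P (F`_a * G`_b) by [].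
have ha : (a < (a + b).+1)%N by rewrite ltnS leq_addr.
have := FG (a + b)%N; rewrite coefM (bigD1 (Ordinal ha)) //= addKn.
set S := \sum_(_ | _) _ => PS; rewrite -[_ * _](addrK S).
apply: idealB => //; apply: ideal_sum => // j ja.
have [lt_ja|lt_aj|eq_ja] := ltngtP j a.
- by rewrite mulrC; apply: PZ; apply: ltF.
- by apply: PZ; apply: ltG; have := ltn_ord j; lia.
- by case/eqP: ja; apply: val_inj.
Qed.

Section GenericVariable.
Variables (k : fieldType) (d : nat).
Local Notation R := {mpoly k[d]}.

(** The coefficients do not involve ['X_j] but are kept in [R], so that the construction can be
    repeated for other variables in the same ring. *)
Definition var_expand (j : 'I_d) : {rmorphism R -> {poly R}} :=
  mmap (@polyC R \o @mpolyC d k) (fun i => if i == j then 'X else ('X_i)%:P).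

Arguments var_expand : simpl never.

Lemma var_expandC j c : var_expand j c%:MP = (c%:MP)%:P.
Proof. by rewrite /var_expand /= mmapC. Qed.

Lemma var_expandX j i : var_expand j 'X_i = if i == j then 'X else ('X_i)%:P.
Proof. by rewrite /var_expand /= mmapX mmap1U. Qed.

Lemma var_expandK j f : (var_expand j f).['X_j] = f.
Proof.
have cm : commr_rmorph (idfun : {rmorphism R -> R}) ('X_j) by move=> x; exact: mulrC.
pose h : {rmorphism R -> R} := horner_morph cm \o var_expand j.
have : h =1 (idfun : {rmorphism R -> R}).
  apply: mpoly_rmorph_ext => [c|i] /=; rewrite /horner_morph map_poly_id //.
    by rewrite var_expandC hornerC.
  by rewrite var_expandX; case: eqP => [->|_]; rewrite ?hornerX ?hornerC.
by move/(_ f) => /=; rewrite /horner_morph map_poly_id.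
Qed.

(* The largest ideal contained in [P] that is extended from the subring of
   polynomials not involving ['X_j]. *)
Definition generic_var (j : 'I_d) (P : set R) : set R :=
  [set f | forall l, P (var_expand j f)`_l].

Lemma generic_var_prime j P : is_prime P -> is_prime (generic_var j P).
Proof.
move=> Pp; have [iP nP1 PM] := Pp; have [P0 PD PZ] := iP; split.
- split.
  + by move=> l; rewrite rmorph0 coef0.
  + by move=> x y Px Py l; rewrite (rmorphD (var_expand j)) coefD; exact: PD (Px l) (Py l).
  + move=> a x Px l; rewrite (rmorphM (var_expand j)) coefM; apply: ideal_sum => // i _.
    exact: PZ.
- by move/(_ 0%N); rewrite rmorph1 coef1.
- by move=> x y Pxy; apply: poly_coef_prime => // l; rewrite -(rmorphM (var_expand j)).
Qed.

Lemma generic_var_sub j P : is_ideal P -> generic_var j P `<=` P.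
Proof.
move=> iP f Pf; rewrite -(var_expandK j f) horner_coef.
by have [_ _ PZ] := iP; apply: ideal_sum => // i _; rewrite mulrC; apply: PZ.
Qed.

Lemma var_expand_free n (u : 'I_n -> R) (j : 'I_d) (p : {mpoly k[n]}) :
  (forall i, var_expand j (u i) = (u i)%:P) ->
  var_expand j (mmap (@mpolyC d k) u p) = (mmap (@mpolyC d k) u p)%:P.
Proof.
move=> hu; pose c : {rmorphism k -> R} := @mpolyC d k.
pose ev : {rmorphism {mpoly k[n]} -> R} := mmap c u.
pose f : {rmorphism {mpoly k[n]} -> {poly R}} := var_expand j \o ev.
pose g : {rmorphism {mpoly k[n]} -> {poly R}} := @polyC R \o ev.
have : f =1 g.
  apply: mpoly_rmorph_ext => [a|i]; rewrite /f /g /ev /=.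
    by rewrite [mmap c u _]mmapC var_expandC.
  by rewrite [mmap c u _]mmapX mmap1U hu.
by move/(_ p).
Qed.

(* Starting from [P], apply [generic_var j] successively to the variables outside
   a maximal independent subset: each step is a strict inclusion. *)
Lemma prime_chain_exists (P : set R) : is_prime P ->
  exists s (x : 'I_s -> 'I_d), indep_mod P (fun i => 'X_(x i)) /\ prime_chain P (d - s).
Proof.
move=> Pp; have [iP nP1 PM] := Pp; have [P0 PD PZ] := iP.
pose Q s := exists x : 'I_s -> 'I_d, indep_mod P (fun i => 'X_(x i)).
have Q0 : exists s, `[< Q s >].
  have x0 : 'I_0 -> 'I_d by case.
  exists 0%N; apply/asboolP; exists x0.
  move=> p; rewrite [p]nvar0_mpolyC mpolyC_eq0 => c0; rewrite mmapC => Pc; apply: nP1.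
  have -> : 1 = (p@_0%MM)^-1%:MP * (p@_0%MM)%:MP :> R.
    by rewrite -mpolyCM mulVf // mpolyC1.
  exact: PZ.
have Qle s : `[< Q s >] -> (s <= d)%N.
  move=> /asboolP[x ind]; rewrite leqNgt; apply/negP.
  move/(mpoly_dependent (fun i => 'X_(x i) : R)) => [p p0 pu].
  by apply: (ind p p0); rewrite pu.
case: (ex_maxnP Q0 Qle) => s /asboolP[x ind] maxs.
exists s, x; split=> //.
have x_inj : injective x.
  move=> i i' xi; apply: contrapT => /eqP ii'.
  apply: (ind ('X_i - 'X_i')).
    apply/eqP => /(congr1 (mcoeff U_(i))); rewrite mcoeffB !mcoeffX eqxx mcoeff0 eq_mnm1.
    by rewrite eq_sym (negPf ii') subr0 => /eqP; rewrite oner_eq0.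
  by rewrite mmapB !mmapX !mmap1U xi subrr.
pose js := [seq j <- enum 'I_d | j \notin codom x].
have size_js : size js = (d - s)%N.
  rewrite size_filter -[LHS](addnK (count (mem (codom x)) (enum 'I_d))).
  rewrite addnC count_predC size_enum_ord; congr (_ - _)%N.
  have <- : #|codom x| = count (mem (codom x)) (enum 'I_d).
    by rewrite cardE {1}/enum_mem size_filter -enumT.
  by rewrite (card_codom x_inj) card_ord.
have uniq_js : uniq js by rewrite filter_uniq ?enum_uniq.
pose ch (l : seq 'I_d) := foldr generic_var P l.
have ch_prime l : is_prime (ch l).
  by elim: l => [|j l IH]; [exact: Pp|exact: (generic_var_prime j IH)].
have ch_ideal l : is_ideal (ch l) by have [] := ch_prime l.
have ch_sub l : ch l `<=` P.
  elim: l => [|j l IH]; first exact: subset_refl.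
  by apply: (subset_trans _ IH); exact: (@generic_var_sub j _ (ch_ideal l)).
have ch_free l n (u : 'I_n -> R) p :
    (forall i j, j \in l -> var_expand j (u i) = (u i)%:P) ->
    P (mmap (@mpolyC d k) u p) -> ch l (mmap (@mpolyC d k) u p).
  elim: l => [_ //|j l IH hu Pu m].
  rewrite var_expand_free => [|i]; last by apply: hu; rewrite inE eqxx.
  rewrite coefC; case: eqP => _; last by have [] := ch_ideal l.
  by apply: IH => // i j' j'l; apply: hu; rewrite inE j'l orbT.
(* Maximality of [x] gives a relation [p] in [P] between the variables of [x] and ['X_j]. Not
   involving the variables of [l], it lies in [ch l]. Were it in [ch (j :: l)], its coefficients
   with respect to ['X_j] would lie in [P], against the independence of [x]. *)
have strict j l : j \notin codom x -> j \notin l -> {subset l <= js} -> ch (j :: l) `<` ch l.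
  move=> jx jl ljs; split; first exact: (@generic_var_sub j _ (ch_ideal l)).
  pose u (i : 'I_s.+1) : R := oapp (fun i => 'X_(x i)) ('X_j) (unlift ord_max i).
  have [p [p0 Pp0]] : exists p : {mpoly k[s.+1]}, p != 0 /\ P (mmap (@mpolyC d k) u p).
    apply: contrapT => nex; suff : (s.+1 <= s)%N by rewrite ltnn.
    apply: maxs; apply/asboolP; exists (fun i => oapp x j (unlift ord_max i)).
    move=> p p0 Pu; apply: nex; exists p; split=> //; move: Pu.
    congr (P _); apply: eq_bigr => m _; congr (_ * _).
    by apply: mmap1_eq => i; rewrite /u; case: unliftP.
  have xj i : x i != j by apply: contraNneq jx => <-; exact: codom_f.
  move=> sub; have chu : ch l (mmap (@mpolyC d k) u p).
    apply: ch_free => // i j' j'l; rewrite /u; have j'x := ljs _ j'l.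
    rewrite mem_filter in j'x; case/andP: j'x => j'x _.
    case: unliftP => [i' _|_] /=; rewrite var_expandX.
      by rewrite ifN //; apply: contraNneq j'x => <-; exact: codom_f.
    by rewrite ifN //; apply: contraNneq jl => ->.
  have muni0' : muni p != 0 by rewrite -[0](muni0 s k) (inj_eq (@muni_inj k s)).
  have [l0 q0] : exists l0, (muni p)`_l0 != 0.
    by exists (size (muni p)).-1; rewrite -[_`__]/(lead_coef _) lead_coef_eq0.
  move: (sub _ chu) => /(_ l0)/ch_sub; apply: contra_not (ind _ q0).
  pose c : {rmorphism k -> R} := @mpolyC d k.
  have uE : u \o fintype.lift ord_max = (fun i => 'X_(x i)).
    by apply/funext => i /=; rewrite /u liftK.
  suff -> : var_expand j (mmap c u p) = map_poly (mmap c (fun i => 'X_(x i))) (muni p).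
    by rewrite coef_map.
  rewrite (mmap_muni c) uE /u unlift_none /= -horner_map /=.
  rewrite var_expandX eqxx -map_poly_comp.
  rewrite (eq_map_poly (g := @polyC R \o mmap c (fun i => 'X_(x i)))); last first.
    move=> r /=; apply: var_expand_free => i.
    by rewrite var_expandX ifN.
  rewrite map_poly_comp; set r := map_poly _ _.
  exact: comp_polyXr.
exists (fun i => ch (drop i js)); rewrite -size_js; split.
- by [].
- move=> i lt_i; have [j0 _] : exists j : 'I_d, True by case: (js) lt_i => // j; exists j.
  rewrite (drop_nth j0 lt_i); apply: strict.
  + by have := mem_nth j0 lt_i; rewrite mem_filter => /andP[].
  + have := drop_uniq i uniq_js; rewrite (drop_nth j0 lt_i) /=.
    by case/andP.
  + by move=> j /mem_drop.
- by rewrite drop_size.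
Qed.

End GenericVariable.

(** * Valuation rings in finite extensions *)

Lemma det_replace_row (F : comNzRingType) n (A : 'M[F]_n) (l : 'I_n) (u : 'rV[F]_n) :
  \det (\matrix_i (if i == l then u else row i A)) = (u *m \adj A) 0 l.
Proof.
rewrite (expand_det_row _ l) mxE; apply: eq_bigr => j _.
rewrite !mxE eqxx; congr (_ * (_ * \det _)).
by apply/matrixP => i i'; rewrite !mxE eq_sym (negPf (neq_lift _ _)) mxE.
Qed.

Section TraceIntegral.
Variables (F K : fieldType) (iota : {rmorphism F -> K}) (v : discrete_valuation K).

Definition base_valring : {pred F} := fun w => iota w \in in_valring v.

Fact base_valring_subring : subring_closed base_valring.
Proof.
have [V1 VB VM] := in_valring_closed v.
split=> [|x y|x y]; rewrite !unfold_in /base_valring ?rmorph1 ?rmorphB ?rmorphM //.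
  exact: VB.
exact: VM.
Qed.
HB.instance Definition _ := GRing.isSubringClosed.Build F base_valring
  base_valring_subring.
Local Notation W := base_valring.
Local Notation w := (fun x : F => v (iota x)).

Lemma base_valringE x : x != 0 -> (x \in W) = (0 <= w x).
Proof. by move=> x0; rewrite unfold_in /base_valring in_valringP ?fmorph_eq0. Qed.

Lemma base_valM x y : x != 0 -> y != 0 -> w (x * y) = w x + w y.
Proof. by move=> x0 y0 /=; rewrite rmorphM dvalM ?fmorph_eq0. Qed.

Lemma base_valV x : x != 0 -> w x^-1 = - w x.
Proof. by move=> x0 /=; rewrite fmorphV dvalV ?fmorph_eq0. Qed.

(* A minor of minimal valuation among the generators of the lattice spans it. *)
Lemma lattice_trace n (I : finType) (a : I -> 'rV[F]_n) (M : 'M[F]_n) (f0 : 'I_n -> I) :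
  \det (\matrix_l a (f0 l)) != 0 ->
  (forall i, exists2 c : I -> F, forall j, c j \in W & a i *m M = \sum_j c j *: a j) ->
  \tr M \in W.
Proof.
move=> det0 stab; pose A (f : {ffun 'I_n -> I}) := \matrix_l a (f l).
have A0 : \det (A (finfun f0)) != 0.
  by congr (\det _ != 0): det0; apply/matrixP => i j; rewrite !mxE ffunE.
pose f := [arg min_(f < finfun f0 | \det (A f) != 0) w (\det (A f))]%O.
have [detf minf] : \det (A f) != 0 /\
    forall g, \det (A g) != 0 -> w (\det (A f)) <= w (\det (A g)).
  by rewrite /f; case: Order.TotalTheory.arg_minP => // g g0 ming; split.
have unitA : A f \in unitmx by rewrite unitmxE unitfE.
pose u i := a i *m invmx (A f).
have uE i : a i = u i *m A f by rewrite mulmxKV.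
(* Cramer's rule: this coordinate is the quotient of two minors, the denominator being the one of
   least value. *)
have uW i l : u i 0 l \in W.
  pose g := [ffun l' => if l' == l then i else f l'].
  have gE : \det (A g) = \det (A f) * u i 0 l.
    have -> : A g = \matrix_l' (if l' == l then a i else row l' (A f)).
      by apply/row_matrixP => l'; rewrite !rowK ffunE; case: eqP.
    rewrite det_replace_row /u /invmx unitA -scalemxAr [in RHS]mxE mulrA mulfV //.
    by rewrite mul1r.
  have [->|u0] := eqVneq (u i 0 l) 0; first exact: rpred0.
  have := minf g; rewrite gE mulf_neq0 // base_valM // lerDl => /(_ isT).
  by rewrite base_valringE.
have /choice[c hc] i : exists c : I -> F,
    (forall j, c j \in W) /\ a i *m M = \sum_j c j *: a j.
  by have [c cW h] := stab i; exists c.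
(* [M] is conjugate to [Y], whose entries lie in [W], and the trace does not change. *)
pose Y := \matrix_l (\sum_j c (f l) j *: u j).
have AM : A f *m M = Y *m A f.
  apply/row_matrixP => l; rewrite !row_mul !rowK (hc _).2 mulmx_suml.
  by apply: eq_bigr => j _; rewrite -scalemxAl -uE.
have -> : \tr M = \tr Y.
  by rewrite -[M](mulKmx unitA) AM mxtrace_mulC mulmxK.
rewrite rpred_sum // => l _; rewrite mxE summxE rpred_sum // => j _.
by rewrite mxE rpredM // (hc _).1.
Qed.

Definition wspan (I : finType) (mu : I -> K) : set K :=
  [set z | exists2 c : I -> F, forall i, c i \in W & z = \sum_i iota (c i) * mu i].

Lemma wspan0 (I : finType) (mu : I -> K) : wspan mu 0.
Proof.
exists (fun=> 0) => [i|]; first exact: rpred0.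
by rewrite big1 // => i _; rewrite rmorph0 mul0r.
Qed.

Lemma wspanD (I : finType) (mu : I -> K) x y :
  wspan mu x -> wspan mu y -> wspan mu (x + y).
Proof.
move=> [c cW ->] [c' c'W ->]; exists (fun i => c i + c' i) => [i|].
  exact: rpredD.
by rewrite -big_split; apply: eq_bigr => i _; rewrite rmorphD mulrDl.
Qed.

Lemma wspanZ (I : finType) (mu : I -> K) a x :
  a \in W -> wspan mu x -> wspan mu (iota a * x).
Proof.
move=> aW [c cW ->]; exists (fun i => a * c i) => [i|]; first exact: rpredM.
by rewrite mulr_sumr; apply: eq_bigr => i _; rewrite rmorphM mulrA.
Qed.

Lemma wspan_gen (I : finType) (mu : I -> K) i : wspan mu (mu i).
Proof.
exists (fun j => (j == i)%:R) => [j|]; first by case: eqP; rewrite ?rpred1 ?rpred0.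
rewrite (bigD1 i) //= eqxx rmorph1 mul1r big1 ?addr0 // => j /negPf ->.
by rewrite rmorph0 mul0r.
Qed.

Lemma wspan_sum (I J : finType) (mu : I -> K) (P : pred J) (G : J -> K) :
  (forall j, P j -> wspan mu (G j)) -> wspan mu (\sum_(j | P j) G j).
Proof.
by move=> h; elim/big_ind: _ => //; [exact: wspan0|exact: wspanD].
Qed.

(* Integrality over W in the form: z stabilises a nonzero finitely generated
   W-submodule of K. *)
Definition integral_over (z : K) : Prop :=
  exists (I : finType) (mu : I -> K),
    (exists i, mu i != 0) /\ forall i, wspan mu (z * mu i).

(** Compare values in [z * mu i] for a nonzero generator [mu i] of least value: everything in the
    span has at least that value. *)
Lemma integral_over_val z : integral_over z -> z \in in_valring v.
Proof.
move=> [I [mu [[i0 mu0] stab]]].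
have [->|z0] := eqVneq z 0; first exact: rpred0.
pose i := [arg min_(i < i0 | mu i != 0) v (mu i)]%O.
have [mui mini] : mu i != 0 /\ forall j, mu j != 0 -> v (mu i) <= v (mu j).
  by rewrite /i; case: Order.TotalTheory.arg_minP => // j j0 minj; split.
have [c cW zmu] := stab i.
have : val_ge v (v (mu i)) (z * mu i).
  rewrite zmu; apply: val_ge_sum => j _; rewrite -[v (mu i)]add0r.
  apply: valM_ge; first by have := cW j.
  by have [->//|j0] := eqVneq (mu j) 0; rewrite /= mini.
by rewrite /val_ge /= mulf_eq0 (negPf z0) (negPf mui) dvalM //= lerDr -in_valringP.
Qed.

Lemma integral_overM x y : integral_over x -> integral_over y -> integral_over (x * y).
Proof.
move=> [I [mu [[i0 mui] hx]]] [J [nu [[j0 nuj] hy]]].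
exists (I * J)%type, (fun ij => mu ij.1 * nu ij.2); split.
  by exists (i0, j0); rewrite mulf_neq0.
move=> [i j] /=; have [c cW cE] := hx i; have [e eW eE] := hy j.
have -> : x * y * (mu i * nu j) = (x * mu i) * (y * nu j) by rewrite mulrACA.
rewrite cE eE mulr_suml; apply: wspan_sum => i' _.
rewrite mulr_sumr; apply: wspan_sum => j' _.
rewrite mulrACA -rmorphM; apply: wspanZ; first exact: rpredM.
exact: (wspan_gen (fun ij => mu ij.1 * nu ij.2) (i', j')).
Qed.

Lemma val_unit_add (x y : K) : x != 0 -> v x = 0 -> val_ge v 1 y ->
  x + y != 0 /\ v (x + y) = 0.
Proof.
move=> x0 vx vy.
have N1 : ~ val_ge v 1 (x + y).
  move=> h; have : val_ge v 1 (x + y - y).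
    by apply: valD_ge => //; rewrite oppr_eq0 dvalN.
  by rewrite addrK /val_ge /= (negPf x0) vx.
have xy0 : x + y != 0 by apply: contra_notN N1 => /eqP ->; rewrite /val_ge /= eqxx.
split=> //; have : val_ge v 0 (x + y).
  by apply: valD_ge; [rewrite vx lexx orbT | apply: val_ge_le vy].
move: N1; rewrite /val_ge /= (negPf xy0) /= => /negP; lia.
Qed.

(* Normalise the relation to have integral coefficients, not all in the maximal
   ideal, and take for [b] its truncation at the last unit coefficient. *)
Lemma val_quotient_integral (N : nat) (c : 'I_N -> F) (a : K) :
  a \in in_valring v -> (exists i, c i != 0) -> \sum_i iota (c i) * a ^+ i = 0 ->
  exists b, [/\ b != 0, v b = 0, integral_over b & integral_over (a * b)].
Proof.
move=> aV [i0 ci0] rel.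
pose i1 := [arg min_(i < i0 | c i != 0) w (c i)]%O.
have [c1 min1] : c i1 != 0 /\ forall j, c j != 0 -> w (c i1) <= w (c j).
  by rewrite /i1; case: Order.TotalTheory.arg_minP => // j j0 minj; split.
pose e i := c i / c i1.
have eW i : e i \in W.
  have [c0|c0] := eqVneq (c i) 0; first by rewrite /e c0 mul0r rpred0.
  rewrite base_valringE ?mulf_neq0 ?invr_eq0 // base_valM ?invr_eq0 // base_valV //.
  by rewrite subr_ge0 min1.
have erel : \sum_i iota (e i) * a ^+ i = 0.
  have := congr1 ( *%R (iota (c i1))^-1) rel; rewrite mulr0 mulr_sumr => h.
  rewrite -[RHS]h; apply: eq_bigr => i _.
  by rewrite /e rmorphM fmorphV mulrA [(iota (c i1))^-1 * _]mulrC.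
have e1 : e i1 = 1 by rewrite /e mulfV.
have ex1 : (e i1 != 0) && (w (e i1) == 0) by rewrite e1 oner_eq0 rmorph1 dval1.
case: (@arg_maxnP _ i1 (fun i => (e i != 0) && (w (e i) == 0)) val ex1) => s /andP[es0 /eqP ws] maxs.
(* The first coefficient is a unit and, by the choice of [s], all later ones have positive value, so
   [b] is a unit. *)
pose b := \sum_(i < N | (s <= i)%N) iota (e i) * a ^+ (i - s).
have [b0 vb] : b != 0 /\ v b = 0.
  rewrite /b (bigD1 s) //= subnn expr0 mulr1; apply: val_unit_add; rewrite ?fmorph_eq0 //.
  apply: val_ge_sum => i /andP[si is_].
  have lt_si : (s < i)%N by rewrite ltn_neqAle eq_sym -val_eqE in is_ *; rewrite is_.
  rewrite -[X in val_ge _ X]addr0; apply: valM_ge; last by have := rpredX (i - s) aV.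
  have [ei|ei] := eqVneq (e i) 0; first by rewrite ei rmorph0 eqxx.
  rewrite fmorph_eq0 (negPf ei) /=; have := eW i; rewrite base_valringE // => w0.
  have : w (e i) != 0.
    by apply: contraTneq lt_si => wi; rewrite -leqNgt; apply: maxs; rewrite ei wi eqxx.
  by move: w0; rewrite /=; lia.
have brel : a ^+ s * b = - \sum_(i < N | ~~ (s <= i)%N) iota (e i) * a ^+ i.
  apply/eqP; rewrite -addr_eq0; apply/eqP; rewrite -[RHS]erel [RHS](bigID (fun i : 'I_N => (s <= i)%N)) /=.
  congr (_ + _); rewrite /b mulr_sumr; apply: eq_bigr => i si.
  by rewrite mulrCA -exprD subnKC.
pose mu (j : 'I_N.-1) := a ^+ j.
(* For [m < s] expand [b]; for [s <= m] use [brel]. Only exponents below [N.-1] occur, yet [m] may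
   reach [N.-1], one more than the generators, which covers both [b] and [a * b]. *)
have span m : (m < N)%N -> wspan mu (b * a ^+ m).
  move=> mN; have [ms|sm] := ltnP m s.
    rewrite /b mulr_suml; apply: wspan_sum => i si.
    rewrite -mulrA -exprD; apply: wspanZ => //.
    have h : (i - s + m < N.-1)%N by have := ltn_ord i; have := ltn_ord s; lia.
    exact: (wspan_gen mu (Ordinal h)).
  rewrite -(subnK sm) exprD mulrCA [b * _]mulrC brel mulrN -mulNr.
  rewrite mulr_sumr; apply: wspan_sum => i; rewrite -ltnNge => lt_is.
  rewrite mulrCA mulNr -exprD mulrN -mulNr -rmorphN; apply: wspanZ; first by rewrite rpredN.
  have h : (m - s + i < N.-1)%N by lia.
  exact: (wspan_gen mu (Ordinal h)).
(* If [s] were 0, [brel] would say that [b] vanishes; hence [N] is at least 2 and [mu] contains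
   1. *)
have N1 : (0 < N.-1)%N.
  case: (posnP s) => s0; last by have := ltn_ord s; lia.
  move: brel; rewrite s0 expr0 mul1r big_pred0 => [bz|i]; last by rewrite leq0n.
  by rewrite bz oppr0 eqxx in b0.
have mu_neq0 : exists i, mu i != 0 by exists (Ordinal N1); rewrite /mu /= expr0 oner_eq0.
exists b; split=> //; exists 'I_N.-1, mu; split=> // j.
  by apply: span; have := ltn_ord j; lia.
have -> : a * b * mu j = b * a ^+ j.+1 by rewrite exprS mulrA [b * a]mulrC.
by apply: span; have := ltn_ord j; lia.
Qed.

Section FiniteExtension.
Variables (n : nat) (beta : 'I_n -> K) (coord : K -> 'rV[F]_n).
Definition comb (c : 'rV[F]_n) : K := \sum_i iota (c 0 i) * beta i.
Hypothesis coordK : cancel coord comb.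
Hypothesis combK : cancel comb coord.

Lemma combD x y : comb (x + y) = comb x + comb y.
Proof. by rewrite -big_split; apply: eq_bigr => i _; rewrite mxE rmorphD mulrDl. Qed.

Lemma combZ a x : comb (a *: x) = iota a * comb x.
Proof. by rewrite mulr_sumr; apply: eq_bigr => i _; rewrite mxE rmorphM mulrA. Qed.

Lemma comb0 : comb 0 = 0.
Proof. by rewrite -(scale0r 0) combZ rmorph0 mul0r. Qed.

Lemma comb_sum (I : Type) (r : seq I) (G : I -> 'rV[F]_n) :
  comb (\sum_(i <- r) G i) = \sum_(i <- r) comb (G i).
Proof.
by elim: r => [|i r IH]; rewrite ?big_nil ?comb0 // !big_cons combD IH.
Qed.

Lemma comb_inj : injective comb. Proof. exact: can_inj combK. Qed.

Definition mulmatrix (z : K) : 'M[F]_n := \matrix_i coord (z * beta i).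

Lemma comb_mul z c : comb (c *m mulmatrix z) = z * comb c.
Proof.
rewrite mulmx_sum_row comb_sum mulr_sumr; apply: eq_bigr => i _.
by rewrite combZ rowK coordK mulrCA.
Qed.

Lemma mulmatrix_eq z (M : 'M[F]_n) :
  (forall c, comb (c *m M) = z * comb c) -> M = mulmatrix z.
Proof.
move=> h; apply/row_matrixP => i; rewrite !rowE; apply: comb_inj.
by rewrite h comb_mul.
Qed.

Definition ftrace (z : K) : F := \tr (mulmatrix z).

Lemma ftraceD : {morph ftrace : x y / x + y}.
Proof.
move=> x y; rewrite /ftrace -linearD /=; congr (\tr _); apply/esym/mulmatrix_eq => c.
by rewrite mulmxDr combD !comb_mul mulrDl.
Qed.

Lemma ftraceZ a x : ftrace (iota a * x) = a * ftrace x.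
Proof.
rewrite /ftrace -linearZ /=; congr (\tr _); apply/esym/mulmatrix_eq => c.
by rewrite -scalemxAr combZ comb_mul mulrA.
Qed.

Lemma ftrace1 : ftrace 1 = n%:R.
Proof.
rewrite -mxtrace1; congr (\tr _); apply/esym/mulmatrix_eq => c.
by rewrite mulmx1 mul1r.
Qed.

Lemma ftrace0 : ftrace 0 = 0.
Proof. by have := ftraceZ 0 0; rewrite mulr0 mul0r. Qed.

Lemma ftrace_sum (I : Type) (r : seq I) (G : I -> K) :
  ftrace (\sum_(i <- r) G i) = \sum_(i <- r) ftrace (G i).
Proof.
by elim: r => [|i r IH]; rewrite ?big_nil ?ftrace0 // !big_cons ftraceD IH.
Qed.

Lemma mulmatrix_unit z : z != 0 -> mulmatrix z \in unitmx.
Proof.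
move=> z0; have: mulmatrix z *m mulmatrix z^-1 = 1%:M.
  apply/row_matrixP => i; rewrite row_mul rowE; apply: comb_inj.
  by rewrite !comb_mul mulrA mulVf // mul1r row1.
by case/mulmx1_unit.
Qed.

(** The module stabilised by [z] need not have full rank over [F]. Multiplying its generators by the
    basis [beta] gives a lattice that does, still stable under [z], and [lattice_trace] applies. *)
Lemma ftrace_integral z : integral_over z -> ftrace z \in W.
Proof.
move=> [I [mu [[i0 mu0] stab]]].
apply: (@lattice_trace n (I * 'I_n)%type (fun ij => coord (mu ij.1 * beta ij.2))
  (mulmatrix z) (fun l => (i0, l))).
  have := mulmatrix_unit mu0; rewrite unitmxE unitfE.
  by congr (\det _ != 0); apply/row_matrixP => i; rewrite !rowK.
move=> [i j] /=; have [c cW cE] := stab i.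
exists (fun ij' => c ij'.1 * (ij'.2 == j)%:R) => [[i' j']|] /=.
  by rewrite rpredM //; case: eqP; rewrite ?rpred1 ?rpred0.
apply: comb_inj; rewrite comb_mul coordK mulrA cE comb_sum.
rewrite -(pair_bigA _ (fun i' j' => comb ((c i' * (j' == j)%:R) *: coord (mu i' * beta j')))) /=.
rewrite mulr_suml; apply: eq_bigr => i' _.
rewrite (bigD1 j) //= eqxx mulr1 combZ coordK mulrA big1 ?addr0 // => j' /negPf ->.
by rewrite mulr0 scale0r comb0.
Qed.

Definition gram (eta : 'I_n -> K) : 'M[F]_n := \matrix_(i, j) ftrace (eta i * eta j).

Lemma gram_change (eta eta' : 'I_n -> K) (P : 'M[F]_n) :
  (forall i, eta' i = \sum_j iota (P i j) * eta j) -> gram eta' = P *m gram eta *m P^T.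
Proof.
move=> h; apply/matrixP => i j; rewrite !mxE !h mulr_suml ftrace_sum.
under eq_bigr do rewrite mulr_sumr ftrace_sum.
rewrite exchange_big; apply: eq_bigr => l _; rewrite !mxE mulr_suml.
apply: eq_bigr => l' _; rewrite !mxE mulrACA -rmorphM ftraceZ; ring.
Qed.

(** An element of the radical of the trace form would, when multiplied by its inverse, force the
    trace of 1, which is [n], to vanish. Separability enters only through [n] being nonzero. *)
Lemma gram_neq0 : (n%:R != 0 :> F) -> \det (gram beta) != 0.
Proof.
move=> n0; apply: contraNneq n0 => det0.
have : ~~ row_free (gram beta) by rewrite row_free_unit unitmxE unitfE det0 eqxx.
rewrite -kermx_eq0 => /rowV0Pn[u /sub_kermxP uG u0].
have cu0 : comb u != 0.
  by apply: contraNneq u0 => cu; apply/eqP/comb_inj; rewrite cu comb0.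
have tr0 j : ftrace (comb u * beta j) = 0.
  have /rowP/(_ j) := uG; rewrite !mxE => <-.
  rewrite mulr_suml ftrace_sum; apply: eq_bigr => i _.
  by rewrite mxE -mulrA ftraceZ.
rewrite -ftrace1 -(mulfV cu0) -[(comb u)^-1]coordK mulr_sumr ftrace_sum big1 //.
by move=> j _; rewrite mulrCA ftraceZ tr0 mulr0.
Qed.

Variable t : F.
Hypotheses (t_neq0 : t != 0) (t_gt0 : 0 < w t).

Lemma base_val_scale (x : F) : exists N, forall j, (N <= j)%N -> t ^+ j * x \in W.
Proof.
have [->|x0] := eqVneq x 0; first by exists 0%N => j _; rewrite mulr0 rpred0.
exists `|w x|%N => j le_j; rewrite base_valringE ?mulf_neq0 ?expf_neq0 //.
rewrite base_valM ?expf_neq0 // rmorphXn dvalX ?fmorph_eq0 // -mulr_natl.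
have : (`|w x|%N%:Z <= j%:Z) by rewrite lez_nat.
move: t_gt0; rewrite /= natz; set a := v _; set b := v _ => a0 bj.
have : j%:Z * 1 <= j%:Z * a by rewrite ler_wpM2l.
by lia.
Qed.

(** A high power of [t] clears the denominators of the matrix of [z], so the multiple stabilises the
    span of [beta]. *)
Lemma integral_over_scale z : exists j, integral_over (iota t ^+ j * z).
Proof.
have /choice[N hN] (ij : 'I_n * 'I_n) := base_val_scale (mulmatrix z ij.1 ij.2).
exists (\max_ij N ij)%N, 'I_n, beta; split.
  apply: contrapT => nb; have := oner_neq0 K; rewrite -[1]coordK /comb big1 ?eqxx //.
  move=> i _; have [->|bi] := eqVneq (beta i) 0; first by rewrite mulr0.
  by case: nb; exists i.
move=> i; exists (fun j => t ^+ (\max_ij N ij)%N * mulmatrix z i j) => [j|].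
  by apply: (hN (i, j)); apply: leq_bigmax.
rewrite -mulrA -[z * beta i]coordK mulr_sumr; apply: eq_bigr => j _.
by rewrite rmorphM rmorphXn mulrA [mulmatrix z i j]mxE.
Qed.

(* An integral family with discriminant of minimal valuation. *)
Lemma integral_basis : n%:R != 0 :> F -> exists eta : 'I_n -> K,
  (forall i, integral_over (eta i)) /\ forall b, integral_over b -> wspan eta b.
Proof.
move=> n0.
pose Q m := exists eta : 'I_n -> K, [/\ forall i, integral_over (eta i),
  \det (gram eta) != 0 & w (\det (gram eta)) = m%:Z].
have QI (eta : 'I_n -> K) : (forall i, integral_over (eta i)) ->
    \det (gram eta) != 0 -> 0 <= w (\det (gram eta)).
  move=> eta_int det0; rewrite -base_valringE //.
  rewrite /determinant rpred_sum // => s _; rewrite rpredM ?rpredX ?rpredN ?rpred1 //.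
  by rewrite rpred_prod // => i _; rewrite mxE ftrace_integral //; apply: integral_overM.
have exQ : exists m, `[< Q m >].
  have /choice[j hj] i := integral_over_scale (beta i).
  pose eta i := iota t ^+ j i * beta i.
  have gE : gram eta = diag_mx (\row_i t ^+ j i) *m gram beta *m (diag_mx (\row_i t ^+ j i))^T.
    apply: gram_change => i; rewrite (bigD1 i) //= !mxE eqxx mulr1n rmorphXn big1 ?addr0 //.
    by move=> l li; rewrite !mxE eq_sym (negPf li) mulr0n rmorph0 mul0r.
  have det0 : \det (gram eta) != 0.
    rewrite gE !det_mulmx det_tr det_diag !mulf_neq0 ?gram_neq0 //.
      by apply/prodf_neq0 => i _; rewrite mxE expf_neq0.
    by apply/prodf_neq0 => i _; rewrite mxE expf_neq0.
  have := QI eta hj det0; case E : (w _) => [m|//] _.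
  by exists m; apply/asboolP; exists eta.
case: (ex_minnP exQ) => m /asboolP[eta [eta_int det0 wm]] minm.
exists eta; split=> // b b_int.
pose P := \matrix_i coord (eta i).
have gE : gram eta = P *m gram beta *m P^T.
  apply: gram_change => i; rewrite -[LHS]coordK.
  by apply: eq_bigr => j _; rewrite mxE.
have Pu : P \in unitmx.
  by move: det0; rewrite gE !det_mulmx det_tr !mulf_eq0 unitmxE unitfE; case: eqP.
pose f := coord b *m invmx P.
have bE : b = \sum_j iota (f 0 j) * eta j.
  rewrite -[LHS]coordK -[coord b](mulmxKV Pu) -/f mulmx_sum_row comb_sum.
  by apply: eq_bigr => j _; rewrite combZ rowK coordK.
exists (fun j => f 0 j) => // l.
apply: contrapT => /negP fl.
have fl0 : f 0 l != 0 by apply: contraNneq fl => ->; exact: rpred0.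
have wfl : w (f 0 l) < 0 by rewrite ltNge -base_valringE.
(* Exchanging [eta l] for [b] multiplies the discriminant by the square of [f 0 l], which has
   negative value: this contradicts minimality. *)
pose eta' i := if i == l then b else eta i.
pose P' := \matrix_i (if i == l then f else row i 1%:M).
have gE' : gram eta' = P' *m gram eta *m P'^T.
  apply: gram_change => i; rewrite /eta'; have [->|il] := eqVneq i l.
    by rewrite bE; apply: eq_bigr => j _; rewrite [in RHS]mxE eqxx.
  rewrite (bigD1 i) //= !mxE (negPf il) !mxE eqxx rmorph1 mul1r big1 ?addr0 //.
  by move=> j ji; rewrite !mxE (negPf il) !mxE eq_sym (negPf ji) rmorph0 mul0r.
have adj1 : \adj (1%:M : 'M[F]_n) = 1%:M.
  by rewrite -[LHS]mul1mx mul_mx_adj det1.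
have detP' : \det P' = f 0 l by rewrite det_replace_row adj1 mulmx1.
have eta'_int i : integral_over (eta' i) by rewrite /eta'; case: eqP.
have detE : \det (gram eta') = f 0 l * \det (gram eta) * f 0 l.
  by rewrite gE' !det_mulmx det_tr detP'.
have det0' : \det (gram eta') != 0 by rewrite detE !mulf_neq0.
have wE : w (\det (gram eta')) = w (f 0 l) + m%:Z + w (f 0 l).
  by rewrite detE !base_valM ?mulf_neq0 // wm.
have := QI eta' eta'_int det0'; case E : (w _) => [m'|//] _.
have := minm m'; rewrite asboolT; last by exists eta'.
by move=> /(_ isT); move: E wfl; rewrite wE /=; lia.
Qed.

End FiniteExtension.

(** Free families have at most [N] members, and one of maximal size is a basis. *)
Lemma dependent_basis (N : nat) :
  (forall f : 'I_N -> K, exists c : 'I_N -> F,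
     (exists i, c i != 0) /\ \sum_i iota (c i) * f i = 0) ->
  exists n (beta : 'I_n -> K) (coord : K -> 'rV[F]_n),
    cancel coord (comb beta) /\ cancel (comb beta) coord.
Proof.
move=> dep.
pose Q n := exists beta : 'I_n -> K,
  forall c : 'rV[F]_n, comb beta c = 0 -> c = 0.
have Q0 : exists n, `[< Q n >].
  by exists 0%N; apply/asboolP; exists (fun=> 0) => c _; apply/rowP; case.
have Qlt n : `[< Q n >] -> (n <= N)%N.
  move=> /asboolP[beta free]; rewrite leqNgt; apply/negP => lt_Nn.
  have [c [[i ci0] rel]] := dep (fun i => beta (widen_ord (ltnW lt_Nn) i)).
  pose c' : 'rV[F]_n := \row_j oapp c 0 (insub (val j)).
  have cc : comb beta c' = 0.
    rewrite -[RHS]rel /comb.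
    rewrite [RHS](eq_bigr (fun i : 'I_N => (fun j : 'I_n => iota (c' 0 j) * beta j) (widen_ord (ltnW lt_Nn) i))).
      rewrite (bigID (fun j : 'I_n => (j < N)%N)) /= [X in _ + X]big1 ?addr0 => [|j].
        by rewrite (big_ord_narrow (ltnW lt_Nn)).
      by rewrite mxE => jN; rewrite insubN // rmorph0 mul0r.
    by move=> j _; rewrite mxE /= valK.
  have /rowP/(_ (widen_ord (ltnW lt_Nn) i)) := free _ cc.
  by rewrite !mxE /= valK => /eqP; rewrite (negPf ci0).
case: (ex_maxnP Q0 Qlt) => n /asboolP[beta free] maxn.
have /choice[coord coordP] (z : K) : exists c, comb beta c = z.
  apply: contrapT => nz; suff : (n.+1 <= n)%N by rewrite ltnn.
  apply: maxn; apply/asboolP.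
  exists (fun i => oapp beta z (unlift ord_max i)) => c; rewrite /comb big_ord_recr /=.
  rewrite unlift_none /=; set S := (X in X + _) => rel.
  have SE : S = comb beta (\row_j c 0 (fintype.lift ord_max j)).
    apply: eq_bigr => j _; rewrite mxE.
    have -> : widen_ord (leqnSn n) j = fintype.lift ord_max j.
      by apply: val_inj; rewrite /= /bump leqNgt ltn_ord.
    by rewrite liftK.
  have [cz|cz] := eqVneq (c 0 ord_max) 0.
    move: rel; rewrite cz rmorph0 mul0r addr0 SE => /free /rowP h.
    apply/rowP => j; rewrite mxE; case: (unliftP ord_max j) => [i ->|->] //.
    by have := h i; rewrite !mxE.
  case: nz; exists (- (c 0 ord_max)^-1 *: (\row_j c 0 (fintype.lift ord_max j))).
  rewrite combZ -SE; move/eqP: rel; rewrite addr_eq0 => /eqP ->.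
  by rewrite rmorphN fmorphV mulrNN mulrA mulVf ?fmorph_eq0 // mul1r.
exists n, beta, coord; split=> // c.
apply/eqP; rewrite -subr_eq0; apply/eqP/free.
by rewrite combD -scaleN1r combZ rmorphN1 mulN1r coordP subrr.
Qed.

(** An element of the valuation ring is a quotient of integral elements with a unit as denominator,
    by [val_quotient_integral], and [integral_basis] spans the integral elements. The factor [s] is
    that denominator: the valuation ring is reached as a localization of the integral closure. *)
Lemma finite_extension_valring (N : nat) (t : F) : [pchar F] =i pred0 ->
  (forall f : 'I_N -> K, exists c : 'I_N -> F,
     (exists i, c i != 0) /\ \sum_i iota (c i) * f i = 0) ->
  t != 0 -> 0 < w t ->
  exists n (eta : 'I_n -> K), (forall i, eta i \in in_valring v) /\
    forall a, a \in in_valring v ->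
      exists s, [/\ s != 0, v s = 0, wspan eta s & wspan eta (a * s)].
Proof.
move=> char0 dep t0 vt; have [n [beta [coord [cK Kc]]]] := dependent_basis dep.
have n0 : n%:R != 0 :> F.
  have /pcharf0P -> := char0; apply: contraTneq (oner_neq0 K) => nz.
  by rewrite -[1]cK /comb big1 ?eqxx // => i; have := ltn_ord i; rewrite [X in (_ < X)%N -> _]nz.
have [eta [eta_int spanB]] := integral_basis cK Kc t0 vt n0.
exists n, eta; split=> [i|a aV]; first exact: integral_over_val.
have [c [c0 rel]] := dep (fun i => a ^+ i).
have [b [b0 vb bI abI]] := val_quotient_integral aV c0 rel.
by exists b; split=> //; apply: spanB.
Qed.

End TraceIntegral.

(** * Nonvanishing of the Jacobian ideal *)

Section ResidueIndependence.
Variables (k : fieldType) (d : nat).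
Local Notation R := {mpoly k[d]}.
Local Notation K := {fraction R}.
Variables (v : discrete_valuation K) (Rv : valring_contains v).
Local Notation V := (valring v).

Lemma residue_eq0 (z : V) : (residue z == 0) = in_valmax v (valring_val z).
Proof. by rewrite -[0](rmorph0 (@residue _ v)) -Quotient.idealrBE subr0. Qed.

Lemma residue_unit (z : V) : residue z != 0 -> valring_val z != 0 /\ v (valring_val z) = 0.
Proof.
rewrite residue_eq0 /in_valmax negb_or -leNgt => /andP[z0 vz]; split=> //.
by apply/eqP; rewrite eq_le vz valring_ge0.
Qed.

Definition valring_const : {rmorphism k -> V} := to_valring Rv \o @mpolyC d k.

(** Additivity in towers: [x] is independent over [k] modulo the center, [t] over the residue field
    of the center. A polynomial in [s + n] variables is reread by [f1] as one in [n] variables over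
    [{mpoly k[s]}]; a nonzero coefficient there stays nonzero when evaluated at [x] in the residue
    field. *)
Lemma residue_independent s n (x : 'I_s -> 'I_d) (t : 'I_n -> residue_field v) :
  is_prime (center v) -> indep_mod (center v) (fun i => 'X_(x i)) ->
  alg_indep (@center_residue_field _ v) t ->
  exists y : 'I_(s + n) -> V, forall p : {mpoly k[s + n]}, p != 0 ->
    residue (mmap valring_const y p) != 0.
Proof.
move=> centerP indx indt.
pose y (i : 'I_(s + n)) : V :=
  match split i with inl a => to_valring Rv 'X_(x a) | inr b => repr (t b) end.
exists y => p p0.
pose c1 : {rmorphism k -> {mpoly {mpoly k[s]}[n]}} := @mpolyC n {mpoly k[s]} \o @mpolyC s k.
pose u1 (i : 'I_(s + n)) : {mpoly {mpoly k[s]}[n]} :=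
  match split i with inl a => ('X_a)%:MP | inr b => 'X_b end.
pose f1 : {rmorphism {mpoly k[s + n]} -> {mpoly {mpoly k[s]}[n]}} := mmap c1 u1.
pose c0 : {rmorphism k -> {mpoly k[s + n]}} := @mpolyC (s + n) k.
pose g0 : {rmorphism {mpoly k[s]} -> {mpoly k[s + n]}} := mmap c0 (fun a => 'X_(lshift n a)).
pose g1 : {rmorphism {mpoly {mpoly k[s]}[n]} -> {mpoly k[s + n]}} :=
  mmap g0 (fun b => 'X_(rshift s b)).
have f1K : g1 \o f1 =1 (idfun : {rmorphism {mpoly k[s + n]} -> _}).
  apply: mpoly_rmorph_ext => [c|i] /=.
    by rewrite /f1 /= mmapC /c1 /= /g1 /= mmapC /g0 /= mmapC.
  rewrite /f1 /= mmapX mmap1U /u1; case: splitP => j ij /=.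
    rewrite /g1 /= mmapC /g0 /= mmapX mmap1U; congr ('X__).
    by apply: val_inj.
  rewrite /g1 /= mmapX mmap1U; congr ('X__).
  by apply: val_inj.
have f1p : f1 p != 0.
  by apply: contraNneq p0 => fp; have := f1K p; rewrite /= fp rmorph0 => <-.
pose cR : {rmorphism k -> R} := @mpolyC d k.
pose ev : {rmorphism {mpoly k[s]} -> R} := mmap cR (fun i => 'X_(x i)).
pose h0 : {rmorphism {mpoly k[s]} -> residue_field v} := @residue _ v \o (to_valring Rv \o ev).
pose lhs : {rmorphism {mpoly k[s + n]} -> residue_field v} := @residue _ v \o mmap valring_const y.
pose rhs : {rmorphism {mpoly k[s + n]} -> residue_field v} := mmap h0 t \o f1.
have lr : lhs =1 rhs.
  apply: mpoly_rmorph_ext => [c|i]; rewrite /lhs /rhs /f1 /=.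
    by rewrite !mmapC /= ?mmapC /= ?mmapC.
  rewrite !mmapX !mmap1U /y /u1; case: (split i) => j.
    by rewrite mmapC /h0 /= /ev /= mmapX mmap1U.
  by rewrite mmapX mmap1U [residue _]reprK.
apply/negP => /eqP resp; have : rhs p = 0 by rewrite -lr.
rewrite /rhs /= => evp.
have hm : map_mpoly h0 (f1 p) = 0.
  apply: indt.
    move=> m; rewrite mcoeff_map_mpoly /h0 /=; exists (to_valring Rv (ev (f1 p)@_m)) => //=.
    exists (ev (f1 p)@_m) => //; exists 1; last by rewrite tofrac1 divr1.
    by have [_ ] := centerP.
  rewrite -[RHS]evp /meval.
  pose l2 : {rmorphism {mpoly {mpoly k[s]}[n]} -> residue_field v} := meval t \o map_mpoly h0.
  pose r2 : {rmorphism {mpoly {mpoly k[s]}[n]} -> residue_field v} := mmap h0 t.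
  have : l2 =1 r2.
    apply: mpoly_rmorph_ext => [c|i]; rewrite /l2 /r2 /=.
      by rewrite map_mpolyC mevalC mmapC.
    by rewrite map_mpolyX mevalXU mmapX mmap1U.
  exact.
have [m fm] : exists m, (f1 p)@_m != 0.
  apply: contrapT => nm; case/eqP: f1p; apply/mpolyP => m; rewrite mcoeff0.
  by apply: contrapT => /eqP fm; apply: nm; exists m.
apply: (indx _ fm); have := congr1 (mcoeff m) hm.
rewrite mcoeff_map_mpoly mcoeff0 /h0 /= => /eqP; rewrite residue_eq0.
by [].
Qed.

(** The center has height [n.+1], [n] being the transcendence degree, and carries a chain of length
    [d - s]; so [d - s <= n.+1], and [r] is [s + n]. *)
Lemma divisorial_independent : is_divisorial v ->
  exists r (y : 'I_r -> V), (d <= r.+1)%N /\ forall p : {mpoly k[r]}, p != 0 ->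
    valring_val (mmap valring_const y p) != 0 /\ v (valring_val (mmap valring_const y p)) = 0.
Proof.
move=> [_ [n [[chc maxc] [t [indt _]]]]].
have cP : is_prime (center v) by have [c [cp _ <-]] := chc; apply: cp.
have [s [x [indx chx]]] := prime_chain_exists cP.
have [y hy] := residue_independent cP indx indt.
exists (s + n)%N, y; split; first by have := maxc _ chx; lia.
by move=> p /hy; exact: residue_unit.
Qed.

End ResidueIndependence.

Lemma fraction_lift (A : idomainType) (K : fieldType) (f : {rmorphism A -> K}) :
  (forall a, a != 0 -> f a != 0) ->
  exists iota : {rmorphism {fraction A} -> K}, forall a, iota a%:F = f a.
Proof.
move=> f_inj.
have /choice[ab hab] (z : {fraction A}) :
    exists ab : A * A, ab.2 != 0 /\ z = ab.1%:F / ab.2%:F.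
  by have [a [b h]] := fraction_split z; exists (a, b).
pose i z := f (ab z).1 / f (ab z).2.
have iE a b : b != 0 -> i (a%:F / b%:F) = f a / f b.
  move=> b0; have [] := hab (a%:F / b%:F); rewrite /i.
  move: (ab _) => [c e] /= e0 /eqP.
  have bF : b%:F != 0 by rewrite tofrac_eq0.
  have eF : e%:F != 0 by rewrite tofrac_eq0.
  rewrite eqr_div // -!tofracM tofrac_eq => /eqP h.
  by apply/eqP; rewrite eqr_div ?f_inj // -!rmorphM h.
have iF a : i a%:F = f a.
  by rewrite -[a%:F]divr1 -tofrac1 iE ?oner_eq0 // rmorph1 divr1.
have fr (z : {fraction A}) : exists a b, [/\ b%:F != 0, b != 0 & z = a%:F / b%:F].
  by have [a [b [b0 ->]]] := fraction_split z; exists a, b; split; rewrite ?tofrac_eq0.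
have zm : zmod_morphism i.
  move=> z1 z2; have [a [b [bF b0 ->]]] := fr z1; have [c [e [eF e0 ->]]] := fr z2.
  have -> : a%:F / b%:F - c%:F / e%:F = (a * e - c * b)%:F / (b * e)%:F.
    by rewrite -mulNr -tofracN addf_div // -!tofracM -tofracD mulNr.
  rewrite !iE ?mulf_neq0 // rmorphB !rmorphM -[in RHS]mulNr addf_div ?f_inj //.
  by rewrite mulNr.
have mm : monoid_morphism i.
  split; first by rewrite -tofrac1 iF rmorph1.
  move=> z1 z2; have [a [b [bF b0 ->]]] := fr z1; have [c [e [eF e0 ->]]] := fr z2.
  rewrite mulf_div -!tofracM !iE ?mulf_neq0 // !rmorphM mulf_div //.
pose I : {rmorphism {fraction A} -> K} := HB.pack i
  (GRing.isZmodMorphism.Build _ _ i zm) (GRing.isMonoidMorphism.Build _ _ i mm).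
by exists I => a; exact: iF.
Qed.

Section KahlerFinite.
Variables (k : fieldType) (d : nat).
Hypothesis char0 : [pchar k] =i pred0.
Local Notation R := {mpoly k[d]}.
Local Notation K := {fraction R}.
Variables (v : discrete_valuation K) (Rv : valring_contains v).
Local Notation V := (valring v).
Local Notation VK := (@valring_val K v).
Variables (r : nat) (y : 'I_r -> V) (pi0 : V).
Hypothesis le_dr : (d <= r.+1)%N.
Hypothesis y_indep : forall p : {mpoly k[r]}, p != 0 ->
  VK (mmap (valring_const Rv) y p) != 0 /\ v (VK (mmap (valring_const Rv) y p)) = 0.
Hypotheses (pi_neq0 : VK pi0 != 0) (v_pi : v (VK pi0) = 1).

Definition eval_y : {rmorphism {mpoly k[r]} -> V} := mmap (valring_const Rv) y.

Fact eval_y_comm : commr_rmorph eval_y pi0. Proof. by move=> x; exact: mulrC. Qed.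
Definition eval_ypi : {rmorphism {poly {mpoly k[r]}} -> V} := horner_morph eval_y_comm.
Definition eval_K : {rmorphism {poly {mpoly k[r]}} -> K} := VK \o eval_ypi.

Lemma eval_ypiX : eval_ypi 'X = pi0.
Proof. exact: horner_morphX. Qed.

Lemma eval_ypiC p : eval_ypi p%:P = eval_y p.
Proof. exact: horner_morphC. Qed.

(** The constant term is a unit because the residues of [y] are independent, and the rest is a
    multiple of [pi0]. So on polynomials in [y] and [pi0] the valuation is the order in [pi0]. *)
Lemma eval_K_unit (q : {poly {mpoly k[r]}}) : q`_0 != 0 ->
  eval_K q != 0 /\ v (eval_K q) = 0.
Proof.
have [q' qE] := poly_coef0_split q => q0; have [y0 vy] := y_indep q0.
have -> : eval_K q = VK (eval_y q`_0) + eval_K q' * VK pi0.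
  by rewrite [in LHS]qE rmorphD rmorphM addrC /= eval_ypiX eval_ypiC.
apply: val_unit_add => //; rewrite -[X in val_ge _ X]add0r.
apply: valM_ge; first by have := valring_valP (eval_ypi q').
by rewrite v_pi lexx orbT.
Qed.

Lemma eval_K_neq0 (q : {poly {mpoly k[r]}}) : q != 0 -> eval_K q != 0.
Proof.
move=> /poly_Xn_factor[a [q' [q'0 ->]]]; rewrite rmorphM rmorphXn.
have [u0 _] := eval_K_unit q'0; apply: mulf_neq0 u0 _; apply: expf_neq0.
by rewrite /= eval_ypiX.
Qed.

Lemma kdiff_unit_inv (A B : comNzRingType) (phi : {rmorphism A -> B}) (b c : B) :
  b * c = 1 -> kdiff phi c = - (c * c) *: kdiff phi b.
Proof.
move=> bc; have : kdiff phi (b * c) = 0 by rewrite bc -(rmorph1 phi) kdiff_alg.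
rewrite kdiffM => /(congr1 ( *:%R c)); rewrite scalerDr !scalerA scaler0 [c * b]mulrC bc scale1r.
by move/eqP; rewrite addr_eq0 => /eqP ->; rewrite scaleNr.
Qed.

(** The differential of an inverse is a multiple of the original differential, so [T] is a subring
    closed under inverting units. Generating the differentials thus reduces to generating the ring
    up to such inverses. *)
Lemma kahler_spanned (gens : seq V) (T : set V) :
  T = [set b | exists c : 'I_(size gens) -> V,
    kdiff (to_valring Rv) b = \sum_j c j *: kdiff (to_valring Rv) gens`_j] ->
  [/\ forall a b, T a -> T b -> T (a + b), forall a b, T a -> T b -> T (a * b),
      forall a : R, T (to_valring Rv a), forall b, b \in gens -> T b &
      forall b c, b * c = 1 -> T b -> T c].
Proof.
move=> TE; pose e (j : 'I_(size gens)) := kdiff (to_valring Rv) gens`_j.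
pose P : kahler (to_valring Rv) -> Prop :=
  fun x => exists c : 'I_(size gens) -> V, x = \sum_j c j *: e j.
have [P0 PD PZ Pe] := big_in_span (erefl P).
have TP b : T b = P (kdiff (to_valring Rv) b) by rewrite TE.
split.
- by move=> a b; rewrite !TP kdiffD; apply: PD.
- by move=> a b; rewrite !TP kdiffM => Pa Pb; apply: PD; apply: PZ.
- by move=> a; rewrite TP kdiff_alg.
- move=> b bg; rewrite TP -(nth_index 0 bg).
  by have := Pe (Ordinal (etrans (index_mem b gens) bg)).
- by move=> b c bc; rewrite !TP (kdiff_unit_inv _ bc); apply: PZ.
Qed.

Lemma eval_K_dependent : exists N, forall f : 'I_N -> K,
  exists p : 'I_N -> {poly {mpoly k[r]}},
    (exists i, p i != 0) /\ \sum_i eval_K (p i) * f i = 0.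
Proof.
pose u (i : 'I_r.+1) : K := oapp (fun j => VK (y j)) (VK pi0) (unlift ord_max i).
have [c hc] := fraction_lin_dep u.
(* With [M = c'.+1], the count [(c * M + c') ^ d] is at most [c.+1 ^ d * M ^ d], and [d <= r.+1]:
   one element more than [c.+1 ^ d] suffices. *)
exists ((c.+1) ^ d).+1 => f; have [c' hc'] := hc _ f.
have [|lam [[i0 [b0 lam0]] rel]] := hc' c'.+1 (ltn0Sn _).
  rewrite !card_ord; apply: (@leq_ltn_trans ((c.+1 * c'.+1) ^ d)).
    case: (d) => // d'; rewrite leq_exp2r // mulSn addnC leq_add //.
  rewrite expnMn mulSn -[X in (X < _)%N]add0n -addSn leq_add ?expn_gt0 //.
  by rewrite leq_mul // leq_pexp2l.
pose mon (b : {ffun 'I_r.+1 -> 'I_c'.+1}) : 'X_{1..r} :=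
  [multinom val (b (fintype.lift ord_max i)) | i < r].
pose p i : {poly {mpoly k[r]}} :=
  \sum_b (lam i b *: 'X_[mon b])%:P * 'X^(b ord_max).
exists p; split.
  exists i0; apply: contraNneq lam0 => /(congr1 (fun q : {poly {mpoly k[r]}} => (q`_(b0 ord_max))@_(mon b0))).
  rewrite coef0 mcoeff0 coef_sum raddf_sum /= (bigD1 b0) //=.
  rewrite coefCM coefXn eqxx mulr1 mcoeffZ mcoeffX eqxx mulr1 big1 ?addr0 => [->//|b bb0].
  rewrite coefCM coefXn; case: eqP => eb; last by rewrite mulr0 mcoeff0.
  rewrite mulr1 mcoeffZ mcoeffX; case: eqP => em; last by rewrite mulr0.
  case/eqP: bb0; apply/ffunP => j; apply: val_inj; case: (unliftP ord_max j) => [l ->|-> //].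
  by move/mnmP: em => /(_ l); rewrite !mnmE.
rewrite -[RHS]rel; apply: eq_bigr => i _; rewrite -mulr_suml; congr (_ * _).
rewrite /p (rmorph_sum eval_K); apply: eq_bigr => b _.
rewrite rmorphM rmorphXn [eval_K 'X]/= eval_ypiX.
rewrite (bigD1_ord ord_max) //= /u unlift_none /= mulrCA [RHS]mulrC; congr (_ * _).
rewrite /= eval_ypiC /eval_y /= mmapZ mmapX.
rewrite rmorphM rmorph_prod /=; congr (_ * _); apply: eq_bigr => l _.
by rewrite liftK /= rmorphXn mnmE.
Qed.

Lemma cancel_uniformizer (L : fieldType) (a b p : L) (i j : nat) : (j <= i)%N ->
  b != 0 -> p != 0 -> a * p ^+ i / (b * p ^+ j) * b = a * p ^+ (i - j).
Proof.
move=> le_ji b0 p0; rewrite -[in p ^+ i](subnK le_ji) exprD.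
by field; rewrite b0 expf_neq0.
Qed.

Lemma kahler_finite : exists gens : seq V, forall b : V,
  exists c : 'I_(size gens) -> V,
    kdiff (to_valring Rv) b = \sum_j c j *: kdiff (to_valring Rv) gens`_j.
Proof.
have [iota iotaE] := fraction_lift eval_K_neq0.
have [N dep] := eval_K_dependent.
have Fchar0 : [pchar {fraction {poly {mpoly k[r]}}}] =i pred0.
  pose c : {rmorphism k -> {fraction {poly {mpoly k[r]}}}} :=
    @FracField.tofrac _ \o (@polyC _ \o @mpolyC r k).
  by move=> q; rewrite (fmorph_pchar c) char0.
have X0 : ('X : {poly {mpoly k[r]}})%:F != 0 by rewrite tofrac_eq0 polyX_eq0.
have vX : 0 < v (iota ('X : {poly {mpoly k[r]}})%:F).
  by rewrite iotaE /= eval_ypiX v_pi.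
have depF (f : 'I_N -> K) : exists c : 'I_N -> {fraction {poly {mpoly k[r]}}},
     (exists i, c i != 0) /\ \sum_i iota (c i) * f i = 0.
  have [p [[i pi] rel]] := dep f; exists (fun i => (p i)%:F); split.
    by exists i; rewrite tofrac_eq0.
  by rewrite -[RHS]rel; apply: eq_bigr => j _; rewrite iotaE.
have [n [eta [etaV span]]] := finite_extension_valring Fchar0 depF X0 vX.
pose etaR i : V := ValRing (etaV i).
pose gens := [seq etaR i | i <- enum 'I_n] ++ [seq y i | i <- enum 'I_r] ++ [:: pi0].
exists gens; pose T := [set b | exists c : 'I_(size gens) -> V,
    kdiff (to_valring Rv) b = \sum_j c j *: kdiff (to_valring Rv) gens`_j].
have [TD TM TR Tg TV] := kahler_spanned (erefl T).
suff allT : forall b, T b by [].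
have Teta i : T (etaR i).
  by apply: Tg; rewrite mem_cat map_f ?mem_enum.
have Ty i : T (y i).
  by apply: Tg; rewrite !mem_cat; apply/or3P; constructor 2; rewrite map_f ?mem_enum.
have Tpi : T pi0 by apply: Tg; rewrite !mem_cat inE eqxx !orbT.
have T1 : T 1 by rewrite -(rmorph1 (to_valring Rv)); apply: TR.
have T0 : T 0 by rewrite -(rmorph0 (to_valring Rv)); apply: TR.
have TX a m : T a -> T (a ^+ m).
  by move=> Ta; elim: m => [|m IH]; rewrite ?expr0 // exprS; apply: TM.
have Tev p : T (eval_y p).
  elim/mpolyind: p => [|c m p _ _ IH]; first by rewrite rmorph0.
  rewrite (rmorphD eval_y); apply: (TD _ _ _ IH); rewrite /eval_y /= mmapZ mmapX.
  apply: (TM _ _ (TR _)).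
  by rewrite /mmap1; apply: (big_ind T T1 TM) => j _; apply: TX.
have Tevp q : T (eval_ypi q).
  rewrite -[q]coefK poly_def (rmorph_sum eval_ypi); apply: (big_ind T T0 TD) => i _.
  rewrite -mul_polyC rmorphM rmorphXn eval_ypiX eval_ypiC.
  by apply: TM => //; apply: TX.
have Tinv (a b : V) : VK a != 0 -> v (VK a) = 0 -> T a -> T (b * a) -> T b.
  move=> a0 va Ta Tba.
  have aV : (VK a)^-1 \in in_valring v by rewrite in_valringP ?invr_eq0 // dvalV // va.
  pose a' : V := ValRing aV.
  have aa' : a * a' = 1 by apply: val_inj; exact: mulfV.
  rewrite -[b]mulr1 -aa' mulrA; apply: TM => //; exact: TV aa' Ta.
(* In the smaller field [z] is a unit [qa] over a unit [qb] times the power [i - j] of [pi0]; as [z]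
   has nonnegative value, [j <= i], and only [qb] needs inverting. *)
have TW (z : V) f : VK z = iota f -> T z.
  have [-> |f0] := eqVneq f 0.
    by rewrite rmorph0 => z0; have -> : z = 0 by apply: val_inj.
  have [a [b [b0 fE]]] := fraction_split f.
  have a0 : a != 0 by apply: contraNneq f0 => a0; rewrite fE a0 tofrac0 mul0r.
  have [i [qa [qa0 aE]]] := poly_Xn_factor a0; have [j [qb [qb0 bE]]] := poly_Xn_factor b0.
  have [ua vua] := eval_K_unit qa0; have [ub vub] := eval_K_unit qb0.
  have pX m : VK pi0 ^+ m != 0 := expf_neq0 m pi_neq0.
  have A0 := mulf_neq0 ua (pX i); have B0 := mulf_neq0 ub (pX j).
  have evX (q : {poly {mpoly k[r]}}) m : iota (q * 'X^m)%:F = eval_K q * VK pi0 ^+ m.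
    by rewrite iotaE rmorphM rmorphXn [eval_K 'X]/= eval_ypiX.
  rewrite fE fmorph_div aE bE !evX => zE.
  have z0 : VK z != 0 by rewrite zE; exact: mulf_neq0 A0 (invr_neq0 B0).
  have le_ji : (j <= i)%N.
    have := valring_ge0 z0; rewrite zE (dvalM v A0 (invr_neq0 B0)) (dvalV v B0).
    rewrite (dvalM v ua (pX i)) (dvalM v ub (pX j)) vua vub !(dvalX v _ pi_neq0) v_pi !add0r !natz.
    by rewrite subr_ge0.
  apply: (Tinv (eval_ypi qb) z ub vub (Tevp qb)).
  have -> : z * eval_ypi qb = eval_ypi qa * pi0 ^+ (i - j).
    apply: val_inj; apply: (etrans (rmorphM VK z (eval_ypi qb))).
    apply: (etrans _ (esym (rmorphM VK (eval_ypi qa) (pi0 ^+ (i - j))))).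
    apply: (etrans (congr1 (fun w => w * VK (eval_ypi qb)) zE)).
    apply: (etrans (cancel_uniformizer (eval_K qa) le_ji ub pi_neq0)).
    by congr (_ * _); apply/esym/(rmorphXn VK).
  exact: TM (Tevp qa) (TX _ _ Tpi).
have Tspan (z : V) : wspan iota v eta (VK z) -> T z.
  move=> [c cW zE]; have cV i : iota (c i) \in in_valring v by have := cW i; rewrite unfold_in.
  have -> : z = \sum_i (ValRing (cV i) : V) * etaR i.
    apply: val_inj; apply: (etrans zE); apply/esym; apply: (etrans (rmorph_sum VK _ _ _)).
    by apply: eq_bigr => i _; exact: (rmorphM VK).
  by apply: (big_ind T T0 TD) => i _; exact: (TM _ _ (TW (ValRing (cV i)) (c i) erefl) (Teta i)).
move=> b; have [s [s0 vs Ss Sbs]] := span _ (valring_valP b).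
have sV : s \in in_valring v by rewrite in_valringP // vs.
exact: (Tinv (ValRing sV) b s0 vs (Tspan (ValRing sV) Ss) (Tspan (b * ValRing sV) Sbs)).
Qed.

End KahlerFinite.

Lemma val_min_exists (K : fieldType) (v : discrete_valuation K) (S : set K) :
  (exists2 x, S x & x != 0) -> (forall x, S x -> x != 0 -> 0 <= v x) ->
  exists n, val_min v S n.
Proof.
move=> [x Sx x0] S_ge0.
pose Q m := exists x, [/\ S x, x != 0 & v x = m%:Z].
have exQ : exists m, `[< Q m >].
  have := S_ge0 _ Sx x0; case E : (v x) => [m|//] _.
  by exists m; apply/asboolP; exists x.
case: (ex_minnP exQ) => m /asboolP Qm minm; exists m%:Z; split=> // z Sz z0.
have := S_ge0 _ Sz z0; case E : (v z) => [m'|//] _.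
by rewrite lez_nat; apply: minm; apply/asboolP; exists z.
Qed.

Section JacobianMin.
Variables (k : fieldType) (d : nat).
Hypothesis char0 : [pchar k] =i pred0.
Local Notation R := {mpoly k[d]}.
Local Notation K := {fraction R}.
Variables (v : discrete_valuation K).
Local Notation V := (valring v).
Local Notation VK := (@valring_val K v).

(** A generator [w] of the valuation ring is a fraction a/b of polynomials, and b dw = d(bw) = da =
    0. The denominators thus form a diagonal relation matrix with nonzero determinant. *)
Lemma jacobian_nonzero (Rv : valring_contains v) : is_divisorial v ->
  exists z, jacobian_ideal Rv z /\ VK z != 0.
Proof.
move=> /(divisorial_independent Rv)[r [y [le_dr y_indep]]].
have [u u0 vu] := dval_onto v 1.
have uV : u \in in_valring v by rewrite (in_valringP v u0) vu.
have [gens hgens] := kahler_finite (pi0 := ValRing uV) char0 le_dr y_indep u0 vu.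
have /choice[ab hab] (j : 'I_(size gens)) :
    exists ab : R * R, ab.2 != 0 /\ VK gens`_j = ab.1%:F / ab.2%:F.
  by have [a [b h]] := fraction_split (VK gens`_j); exists (a, b).
pose e (j : 'I_(size gens)) := kdiff (to_valring Rv) gens`_j.
pose P : kahler (to_valring Rv) -> Prop :=
  fun x => exists c : 'I_(size gens) -> V, x = \sum_j c j *: e j.
have [P0 PD PZ Pe] := big_in_span (erefl P).
pose C : 'M[V]_(size gens) := diag_mx (\row_j to_valring Rv (ab j).2).
exists (\det C); split; last first.
  have -> : VK (\det C) = \prod_j ((ab j).2)%:F.
    rewrite det_diag; apply: (etrans (rmorph_prod VK _ _ _)).
    by apply: eq_bigr => j _; rewrite mxE.
  by apply/prodf_neq0 => j _; rewrite tofrac_eq0; have [] := hab j.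
exists (size gens), e; split; first exact: (kahler_ind P0 PD PZ hgens).
move=> I [_ sub]; apply: sub; exists C => // i.
rewrite (bigD1 i) //= !mxE eqxx mulr1n big1 ?addr0; last first.
  by move=> j ji; rewrite !mxE eq_sym (negPf ji) mulr0n scale0r.
have [b0 gE] := hab i.
have := kdiffM (to_valring Rv) (to_valring Rv (ab i).2) gens`_i.
rewrite kdiff_alg scaler0 addr0 => <-.
have -> : to_valring Rv (ab i).2 * gens`_i = to_valring Rv (ab i).1.
  apply: val_inj; apply: (etrans (rmorphM VK (to_valring Rv (ab i).2) gens`_i)).
  apply: (etrans (congr1 (fun w => ((ab i).2)%:F * w) gE)).
  by apply: (etrans (mulrC _ _)); apply: divfK; rewrite tofrac_eq0.
exact: kdiff_alg.
Qed.

Lemma jacobian_min (Rv : valring_contains v) : is_divisorial v ->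
  exists b : int, [/\ val_min v [set VK z | z in jacobian_ideal Rv] b, 0 <= b &
    \sum_(i < d) v ('X_i : R)%:F - 1 <= b].
Proof.
move=> div_v; have [z [Jz z0]] := jacobian_nonzero Rv div_v.
have [||b hb] := @val_min_exists K v [set VK z | z in jacobian_ideal Rv].
- by exists (VK z) => //; exists z.
- by move=> _ [a Ja <-]; exact: valring_ge0.
exists b; split=> //; have [[_ [[a Ja <-] a0 <-]] _] := hb.
  exact: valring_ge0.
by have := jacobian_lower_bound Ja; rewrite /val_ge /= (negPf a0).
Qed.

End JacobianMin.

(** * The adjoint condition *)

(** Here [a i] plays the value of the variable of index [i] and [alpha] that of the ideal with
    monomials [S]. Indices start at 0, so x_g has index [g.-1]. *)
Lemma newton_bound (d g delta : nat) (a : 'I_d -> nat) (S : set 'X_{1..d})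
    (alpha : nat) (l m : 'X_{1..d}) :
  (2 <= g)%N -> (g <= d)%N -> (0 < delta)%N -> (0 < alpha)%N ->
  (forall u, S u -> alpha <= \sum_i a i * u i)%N ->
  (forall u : 'X_{1..d}, mdeg u = delta ->
     (exists i : 'I_d, (i < g.-1)%N /\ (0 < u i)%N) -> S u) ->
  (forall i : 'I_d, i = g.-1 :> nat -> S (U_(i) *+ delta)%MM) ->
  (l <= m)%MM -> mdeg l = delta -> S l -> (g * (delta - 1) < mdeg m)%N ->
  (g * alpha < \sum_i a i * m i + \sum_i a i)%N.
Proof.
move=> g2 le_gd delta0 alpha0 minS S1 S2 le_lm degl Sl degm.
have d0 : (0 < d)%N by lia.
pose i0 : 'I_d := Ordinal d0.
have hg : (g.-1 < d)%N by lia.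
pose ig : 'I_d := Ordinal hg.
case: (@arg_minnP _ i0 xpredT a isT) => p _ minp.
have i0g : (i0 < g.-1)%N by rewrite /=; lia.
case: (@arg_minnP _ i0 (fun i : 'I_d => (i < g.-1)%N) a i0g) => q qg minq.
have sumU i n : (\sum_j a j * (U_(i) *+ n)%MM j = a i * n)%N.
  rewrite (bigD1 i) //= mulmnE mnm1E eqxx mul1n big1 ?addn0 // => j ji.
  by rewrite mulmnE mnm1E eq_sym (negPf ji) muln0.
(* The monomial with one factor of index [q] and [delta - 1] of index [p] is in [S], because
   [q < g.-1]. *)
have alpha_q : (alpha <= a q + a p * (delta - 1))%N.
  rewrite -[a q]muln1 -(sumU q 1%N) -sumU -big_split /=.
  under eq_bigr do rewrite -mulnDr -mnmDE mulm1n.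
  apply/minS/S1; first by rewrite mdegD mdegMn !mdeg1; lia.
  by exists q; rewrite mnmDE mnm1E eqxx.
have alpha_g : (alpha <= a ig * delta)%N by rewrite -sumU; apply/minS/S2.
(* The source of the strict inequality. *)
have ag0 : (0 < a ig)%N by case: (a ig) alpha_g => //; lia.
have cardg : (\sum_(i < d | (i < g.-1)%N) 1 = g.-1)%N.
  by rewrite (big_ord_narrow (ltnW hg)) sum1_card card_ord.
have cardd : (\sum_(i < d | ~~ (i < g.-1)%N && (i != ig)) 1 = d - g)%N.
  have : (\sum_(i < d) 1 = d)%N by rewrite sum1_card card_ord.
  rewrite (bigID (fun i : 'I_d => (i < g.-1)%N)) /= cardg (bigD1 ig) /= ?ltnn //.
  by set c := (\sum_(_ | _) 1)%N; lia.
have sum_a : (a q * g.-1 + a ig + a p * (d - g) <= \sum_i a i)%N.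
  rewrite (bigID (fun i : 'I_d => (i < g.-1)%N)) /= -addnA leq_add //.
    rewrite -[X in (a q * X <= _)%N]cardg big_distrr /=.
    by apply: leq_sum => i ig1; rewrite muln1 minq.
  rewrite (bigD1 ig) /= ?ltnn // leq_add2l -[X in (a p * X <= _)%N]cardd big_distrr /=.
  by apply: leq_sum => i _; rewrite muln1 minp.
(* Divide [m] by [l]: the factor [l] contributes at least [alpha], and each remaining variable at
   least the least value [a p]. *)
have sum_m : (alpha + a p * (mdeg m - delta) <= \sum_i a i * m i)%N.
  have -> : (\sum_i a i * m i = \sum_i a i * l i + \sum_i a i * (m - l)%MM i)%N.
    rewrite -big_split /=; apply: eq_bigr => i _.
    by rewrite -mulnDr mnmBE subnKC //; apply/mnm_lepP.
  rewrite leq_add //; first exact: minS.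
  have -> : (mdeg m - delta = \sum_i (m - l)%MM i)%N.
    by rewrite -mdegE -[in mdeg m](submK le_lm) mdegD degl addnK.
  rewrite big_distrr /=; apply: leq_sum => i _.
  by rewrite leq_mul2r minp ?orbT.
have h1 : (g.-1 * alpha <= g.-1 * (a q + a p * (delta - 1)))%N by rewrite leq_mul2l alpha_q orbT.
have h2 : (a p * (g.-1 * (delta - 1)) <= a p * (mdeg m - delta))%N.
  rewrite leq_mul2l; apply/orP; right.
  have -> : (g.-1 * (delta - 1) = g * (delta - 1) - (delta - 1))%N.
    by rewrite -subn1 mulnBl mul1n.
  lia.
have eg : (g * alpha = alpha + g.-1 * alpha)%N by rewrite -mulSn prednK //; lia.
have e2 : (g.-1 * (a q + a p * (delta - 1)) = a q * g.-1 + a p * (g.-1 * (delta - 1)))%N.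
  by rewrite mulnDr [(g.-1 * a q)%N]mulnC mulnCA.
rewrite eg; rewrite e2 in h1; move: h1 h2 sum_m sum_a ag0.
move: (\sum_i a i * m i)%N (\sum_i a i)%N (g.-1 * alpha)%N (a p * (g.-1 * _))%N.
move: (a p * (mdeg m - delta))%N (a q * g.-1)%N (a p * (d - g))%N => *; lia.
Qed.

Section Assembly.
Variables (k : fieldType) (d : nat).
Local Notation R := {mpoly k[d]}.
Local Notation K := {fraction R}.
Variables (v : discrete_valuation K) (Rv : valring_contains v).

Lemma ideal_powP (A : comNzRingType) (I : set A) (x : A) n :
  I x -> ideal_pow I n (x ^+ n).
Proof.
move=> Ix; elim: n => [//|n IH]; rewrite exprS => J [_]; apply.
by exists x => //; exists (x ^+ n).
Qed.

Lemma val_mpolyX (a : 'I_d -> nat) (m : 'X_{1..d}) :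
  (forall i, v ('X_i : R)%:F = (a i)%:Z) ->
  ('X_[m] : R)%:F != 0 /\ v ('X_[m] : R)%:F = (\sum_i a i * m i)%N%:Z.
Proof.
move=> va; rewrite mpolyXE_id.
have X0 (i : 'I_d) : ('X_i : R)%:F != 0 by rewrite tofrac_eq0 mpolyXU_neq0.
rewrite (rmorph_prod (@FracField.tofrac _)); split.
  by apply/prodf_neq0 => i _; rewrite rmorphXn; apply: expf_neq0 (X0 i).
rewrite dval_prod => [|i _]; last by rewrite rmorphXn; apply: expf_neq0 (X0 i).
rewrite [RHS](big_morph Posz PoszD (erefl _)); apply: eq_bigr => i _.
by rewrite rmorphXn (dvalX v _ (X0 i)) va -mulr_natr natz -PoszM.
Qed.

Lemma val_mpoly_ge (f : R) (c : int) :
  (forall m, m \in msupp f -> val_ge v c ('X_[m] : R)%:F) -> val_ge v c f%:F.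
Proof.
move=> hm; rewrite [f]mpolyE (rmorph_sum (@FracField.tofrac _)) big_seq.
apply: val_ge_sum => m mf; rewrite -mul_mpolyC rmorphM -[X in val_ge _ X]add0r.
by apply: valM_ge; [have := Rv (f@_m)%:MP | apply: hm].
Qed.

Lemma adjoint_condition (g delta : nat) (L : set R) (f : R) :
  [pchar k] =i pred0 -> is_divisorial v ->
  (2 <= g)%N -> (g <= d)%N -> (0 < delta)%N ->
  (forall h m, L h -> m \in msupp h -> L 'X_[m]) ->
  (forall m, L 'X_[m] -> exists l, [/\ (l <= m)%MM, mdeg l = delta & L 'X_[l]]) ->
  (forall u : 'X_{1..d}, mdeg u = delta ->
     (exists i : 'I_d, (i < g.-1)%N /\ (0 < u i)%N) -> L 'X_[u]) ->
  (forall i : 'I_d, i = g.-1 :> nat -> L 'X_[U_(i) *+ delta]) ->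
  L f -> f != 0 -> (forall m, m \in msupp f -> (g * (delta - 1) < mdeg m)%N) ->
  exists a b : int,
    [/\ val_min v [set x%:F | x in ideal_pow L g] a,
        val_min v [set valring_val x | x in jacobian_ideal Rv] b & a - b <= v f%:F].
Proof.
move=> char0 div_v g2 le_gd delta0 Lsupp Lgen L1 L2 Lf f0 degf.
have [b [hb b0 b_lower]] := jacobian_min char0 Rv div_v.
have v_ge0 (x : R) : x%:F != 0 -> 0 <= v x%:F.
  by move=> x0; rewrite -(in_valringP v x0); apply: Rv.
have Xm_neq0 m : ('X_[m] : R)%:F != 0.
  rewrite tofrac_eq0; apply/eqP => /(congr1 (mcoeff m)).
  by rewrite mcoeffX eqxx mcoeff0 => /eqP; rewrite oner_eq0.
have [m0 m0f] : exists m, m \in msupp f.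
  have : msupp f != [::] by rewrite msupp_eq0.
  by case: (msupp f) => // m s _; exists m; rewrite inE eqxx.
have [||A hA] := @val_min_exists _ v [set x%:F | x in ideal_pow L g].
- exists ('X_[m0] ^+ g)%:F; last by rewrite tofracXn; exact: expf_neq0.
  by exists ('X_[m0] ^+ g) => //; apply/ideal_powP/(Lsupp f).
- by move=> _ [x _ <-]; exact: v_ge0.
exists A, b; split=> //.
have [||al [[_ [[l0 Ll0 <-] _ vl0]] minal]] :=
    @val_min_exists _ v [set ('X_[l] : R)%:F | l in [set l | L 'X_[l]]].
- by exists ('X_[m0] : R)%:F => //; exists m0 => //; apply: (Lsupp f).
- by move=> _ [l _ <-]; exact: v_ge0.
have le_A : A <= al *+ g.
  have [_ minA] := hA; rewrite -vl0 -(dvalX v _ (Xm_neq0 l0)) -tofracXn; apply: minA.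
    by exists ('X_[l0] ^+ g) => //; exact: ideal_powP.
  by rewrite tofracXn; exact: expf_neq0.
have al0 : 0 <= al by rewrite -vl0; exact: v_ge0.
have fF0 : f%:F != 0 by rewrite tofrac_eq0.
(* If the ideal has value 0, then [A <= 0] while [b] and the value of [f] are nonnegative;
   [newton_bound] requires a positive value. *)
have [al_eq0|al_neq0] := eqVneq al 0.
  have := v_ge0 f fF0; move: le_A; rewrite al_eq0 mul0rn; lia.
have va (i : 'I_d) : v ('X_i : R)%:F = `|v ('X_i : R)%:F|%N%:Z
  := esym (gez0_abs (v_ge0 _ (Xm_neq0 U_(i)%MM))).
have vX := fun m => (val_mpolyX m va).2.
have hal : `|al|%N%:Z = al := gez0_abs al0.
pose a i := `|v ('X_i : R)%:F|%N.
have sumaE : \sum_i v ('X_i : R)%:F = (\sum_i a i)%N%:Z.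
  by rewrite [RHS](big_morph Posz PoszD (erefl _)); apply: eq_bigr => i _; exact: va.
have : val_ge v (al *+ g - \sum_i v ('X_i : R)%:F + 1) f%:F.
  apply: val_mpoly_ge => m mf; apply/orP; right; rewrite vX.
  have [l [le_lm degl Ll]] := Lgen _ (Lsupp _ _ Lf mf).
  have := @newton_bound d g delta a [set l | L 'X_[l]] `|al|%N l m g2 le_gd delta0.
  rewrite -/a in vX *; move=> /(_ _ _ L1 L2 le_lm degl Ll (degf m mf)) h.
  have {h} : (g * `|al| < \sum_i a i * m i + \sum_i a i)%N.
    apply: h; first by rewrite absz_gt0.
    move=> u Lu; rewrite -lez_nat hal -(vX u).
    by apply: (minal _ _ (Xm_neq0 u)); exists u.
  rewrite sumaE -mulr_natl natz -[in X in X <= _]hal.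
  by move: (\sum_i a i)%N (\sum_i a i * m i)%N `|al|%N => x y z; lia.
rewrite /val_ge /= (negPf fF0) /=; apply: le_trans.
by apply: le_trans (lerB le_A b_lower) _; rewrite opprB addrA addrAC.
Qed.

End Assembly.

(** * Lex-segment ideals *)

Section IdealTheory.
Variable A : comNzRingType.
Implicit Types (I J L S T : set A).

Lemma ideal_gen_ideal S : is_ideal (ideal_gen S).
Proof.
split=> [|x y Sx Sy|a x Sx] I iI; have [I0 ID IM] := iI.1 => //.
  by apply: ID; [apply: Sx|apply: Sy].
by apply: IM; apply: Sx.
Qed.

Lemma ideal_gen_in S : S `<=` ideal_gen S.
Proof. by move=> x Sx I [_]; apply. Qed.

Lemma ideal_gen_min S T : is_ideal T -> S `<=` T -> ideal_gen S `<=` T.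
Proof. by move=> iT ST x; apply. Qed.

Lemma ideal_mul_ideal I J : is_ideal (ideal_mul I J).
Proof. exact: ideal_gen_ideal. Qed.

Lemma ideal_mul_in I J x y : I x -> J y -> ideal_mul I J (x * y).
Proof. by move=> Ix Jy; apply: ideal_gen_in; exists x => //; exists y. Qed.

Lemma ideal_mul_min I J T : is_ideal T ->
  (forall x y, I x -> J y -> T (x * y)) -> ideal_mul I J `<=` T.
Proof. by move=> iT h; apply: ideal_gen_min => // _ [x Ix [y Jy <-]]; apply: h. Qed.

Lemma ideal_mul_mono I I' J : I `<=` I' -> ideal_mul I J `<=` ideal_mul I' J.
Proof.
move=> II'; apply: ideal_mul_min; first exact: ideal_mul_ideal.
by move=> x y Ix Jy; apply: ideal_mul_in => //; apply: II'.
Qed.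

Lemma ideal_pow_ideal I n : is_ideal (ideal_pow I n).
Proof. by case: n => [|n]; [split|exact: ideal_mul_ideal]. Qed.

Lemma ideal_pow_in I n x y : I x -> ideal_pow I n y -> ideal_pow I n.+1 (x * y).
Proof. exact: ideal_mul_in. Qed.

End IdealTheory.

Section LexSegments.
Variables (k : fieldType) (d : nat) (L : set {mpoly k[d]}).
Local Notation R := {mpoly k[d]}.

Lemma monomial_ideal_ideal : monomial_ideal L -> is_ideal L.
Proof. by move=> [M ->]; exact: ideal_gen_ideal. Qed.

Lemma monomial_ideal_le (l m : 'X_{1..d}) : is_ideal L ->
  L 'X_[l] -> (l <= m)%MM -> L 'X_[m].
Proof.
by move=> [_ _ LM] Ll le_lm; rewrite -(submK le_lm) mpolyXD; apply: LM.
Qed.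

Lemma monomial_ideal_supp (f : R) m : monomial_ideal L ->
  L f -> m \in msupp f -> L 'X_[m].
Proof.
move=> monL; have iL := monomial_ideal_ideal monL; have [M LE] := monL.
pose T := [set f : R | forall m, m \in msupp f -> L 'X_[m]].
have iT : is_ideal T.
  split=> [m'|x y Tx Ty m'|a x Tx m'].
  - by rewrite msupp0.
  - by move=> /msuppD_le; rewrite mem_cat => /orP[/Tx|/Ty].
  - move=> /msuppM_le /allpairsP[[m1 m2] /= [_ m2x ->]].
    by apply: (@monomial_ideal_le m2 _ iL (Tx _ m2x)); exact: lem_addl.
have LT : L `<=` T.
  rewrite {1}LE; apply: ideal_gen_min => // _ [u Mu <-] m'.
  by rewrite msuppX inE => /eqP ->; rewrite LE; apply: ideal_gen_in; exists u.
by move=> /LT; apply.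
Qed.

Lemma monomial_ideal_from_supp (f : R) : is_ideal L ->
  (forall m, m \in msupp f -> L 'X_[m]) -> L f.
Proof.
move=> [L0 LD LM] h; rewrite [f]mpolyE big_seq.
elim/big_ind: _ => // m mf; rewrite -mul_mpolyC; apply: LM; exact: h.
Qed.

(** Among the divisors of [m] in [L], one of least degree is a minimal generator. *)
Lemma minimal_generator_below delta (m : 'X_{1..d}) :
  generated_in_degree L delta -> L 'X_[m] ->
  exists l, [/\ (l <= m)%MM, mdeg l = delta & L 'X_[l]].
Proof.
move=> gen Lm.
pose Q n := exists l, [/\ (l <= m)%MM, mdeg l = n & L 'X_[l]].
have exQ : exists n, `[< Q n >].
  by exists (mdeg m); apply/asboolP; exists m; split=> //; exact: lepm_refl.
case: (ex_minnP exQ) => n /asboolP[l [le_lm degl Ll]] minn.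
exists l; split=> //; apply: gen; split=> // l' Ll' le_l'l.
have : (n <= mdeg l')%N.
  apply: minn; apply/asboolP; exists l'; split=> //; exact: lepm_trans le_lm.
rewrite -degl -(submK le_l'l) mdegD -{2}[mdeg l']add0n leq_add2r leqn0 mdeg_eq0.
by move=> /eqP ->; rewrite add0m.
Qed.

Lemma mlex_ge_trans : transitive (@mlex_ge d).
Proof. by move=> y x z; rewrite /mlex_ge => yx zy; exact: le_trans zy yx. Qed.

Lemma mlex_ge_total : total (@mlex_ge d).
Proof. by move=> x y; rewrite /mlex_ge; exact: le_total. Qed.

Lemma mem_lex_monomials (m : 'X_{1..d}) : m \in lex_monomials d (mdeg m).
Proof.
rewrite mem_sort mem_filter eqxx /=; apply/mapP.
by exists (BMultinom (ltnSn (mdeg m))); rewrite ?mem_enum.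
Qed.

Lemma lex_segment_up (m m' : 'X_{1..d}) : lex_segment L ->
  L 'X_[m] -> mdeg m' = mdeg m -> mlex_ge m' m -> L 'X_[m'].
Proof.
move=> [_ seg] Lm degm' ge_m'm; have [n [_ Ln]] := seg (mdeg m).
have gm : graded_part L (mdeg m) 'X_[m] by split; rewrite ?dhomogX.
set s := take n _ in Ln.
have ms : m \in s.
  move: gm; rewrite Ln => -[c mE]; apply: contrapT => /negP nms.
  have := congr1 (mcoeff m) mE; rewrite mcoeffX eqxx raddf_sum /= big1 => [/eqP|i _].
    by rewrite oner_eq0.
  have hi : (i < size s)%N by rewrite -(size_map (fun m => 'X_[m] : R)) ltn_ord.
  rewrite mcoeffZ (nth_map m) // mcoeffX; case: eqP => [e|_]; last by rewrite mulr0.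
  by rewrite -e mem_nth in nms.
(* A monomial in the dropped tail of the sorted list is at most [m], so by antisymmetry it could
   only be [m] itself. *)
have m's : m' \in s.
  have : m' \in lex_monomials d (mdeg m) by rewrite -degm' mem_lex_monomials.
  rewrite -(cat_take_drop n (lex_monomials _ _)) mem_cat => /orP[//|m'd].
  have : sorted (@mlex_ge d) (lex_monomials d (mdeg m)) by exact: (sort_sorted mlex_ge_total).
  rewrite (sorted_pairwise mlex_ge_trans) -[X in pairwise _ X](cat_take_drop n) pairwise_cat.
  move=> /andP[/allrelP h _]; have := h _ _ ms m'd => ge_mm'.
  suff <- : m = m' by [].
  apply: val_inj; apply/eqP; rewrite -[_ == _]/((val m : d.-tuplelexi nat) == val m').
  by rewrite eq_le; apply/andP.
suff [] : graded_part L (mdeg m) 'X_[m'] by [].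
rewrite Ln; pose j := index m' s.
have hj : (j < size [seq 'X_[m] : R | m <- s])%N by rewrite size_map index_mem.
exists (fun i => (i == Ordinal hj)%:R).
rewrite (bigD1 (Ordinal hj)) //= eqxx scale1r big1 ?addr0 => [|i /negPf ->]; last by rewrite scale0r.
by rewrite (nth_map m) ?index_mem // nth_index.
Qed.

End LexSegments.

Section CoordinatePrimes.
Variables (k : fieldType) (d : nat).
Local Notation R := {mpoly k[d]}.

Definition kill_vars (r : nat) : {rmorphism R -> R} :=
  mmap (@mpolyC d k) (fun i : 'I_d => if (i < r)%N then 0 else 'X_i).

Arguments kill_vars : simpl never.

Lemma kill_varsC r c : kill_vars r c%:MP = c%:MP.
Proof. by rewrite /kill_vars /= mmapC. Qed.

Lemma kill_varsX r (i : 'I_d) : kill_vars r 'X_i = if (i < r)%N then 0 else 'X_i.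
Proof. by rewrite /kill_vars /= mmapX mmap1U. Qed.

(** The ideal of the variables of index below [r], given as the kernel of a map to a domain so that
    it is visibly prime. *)
Definition coordinate_prime (r : nat) : set R := [set f | kill_vars r f = 0].

Lemma coordinate_primeE r f : coordinate_prime r f = (kill_vars r f = 0).
Proof. by []. Qed.

Lemma coordinate_prime_prime r : is_prime (coordinate_prime r).
Proof.
split=> [||x y].
- split=> [|x y|a x]; rewrite !coordinate_primeE.
  + exact: rmorph0.
  + by move=> x0 y0; rewrite (rmorphD (kill_vars r)) x0 y0 addr0.
  + by move=> x0; rewrite (rmorphM (kill_vars r)) x0 mulr0.
- by rewrite coordinate_primeE (rmorph1 (kill_vars r)) => /eqP; rewrite oner_eq0.
- rewrite !coordinate_primeE (rmorphM (kill_vars r)) => /eqP; rewrite mulf_eq0.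
  by case/orP => /eqP; [left|right].
Qed.

Lemma kill_vars_comp r s : (r <= s)%N -> forall f, kill_vars s (kill_vars r f) = kill_vars s f.
Proof.
move=> le_rs.
pose h : {rmorphism R -> R} := kill_vars s \o kill_vars r.
suff : h =1 kill_vars s by [].
apply: mpoly_rmorph_ext => [c|i]; rewrite /h /=; first by rewrite !kill_varsC.
rewrite !kill_varsX; case: ltnP => ir; last by rewrite kill_varsX.
by rewrite (leq_trans ir le_rs) (rmorph0 (kill_vars s)).
Qed.

Lemma coordinate_prime_chain r : (r <= d)%N -> prime_chain (coordinate_prime r) r.
Proof.
move=> le_rd; exists coordinate_prime; split=> // [i _|i lt_ir].
  exact: coordinate_prime_prime.
have hi : (i < d)%N by exact: leq_trans lt_ir le_rd.
split=> [f fi|sub].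
  by rewrite coordinate_primeE -(kill_vars_comp (leqnSn i)) fi (rmorph0 (kill_vars _)).
have : coordinate_prime i 'X_(Ordinal hi).
  by apply: sub; rewrite coordinate_primeE kill_varsX /= ltnSn.
rewrite coordinate_primeE kill_varsX /= ltnn => /eqP.
by rewrite (negPf (mpolyXU_neq0 _ _)).
Qed.

(** The other [d - r] variables stay independent modulo this prime, so [prime_chain_indep] bounds
    every chain by [r]. *)
Lemma coordinate_prime_height r : (r <= d)%N -> prime_height (coordinate_prime r) r.
Proof.
move=> le_rd; split; first exact: coordinate_prime_chain.
move=> m chm.
have hj (j : 'I_(d - r)) : (r + j < d)%N by have := ltn_ord j; lia.
pose u (j : 'I_(d - r)) : R := 'X_(Ordinal (hj j)).
suff ind : indep_mod (coordinate_prime r) u by have := prime_chain_indep chm ind; lia.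
move=> p p0 pu; case/eqP: p0.
pose c : {rmorphism k -> R} := @mpolyC d k.
pose c' : {rmorphism k -> {mpoly k[d - r]}} := @mpolyC (d - r) k.
pose ev : {rmorphism {mpoly k[d - r]} -> R} := mmap c u.
pose rho : {rmorphism R -> {mpoly k[d - r]}} :=
  mmap c' (fun i : 'I_d => oapp (fun j => 'X_j) 0 (insub (i - r)%N)).
pose h : {rmorphism {mpoly k[d - r]} -> {mpoly k[d - r]}} := rho \o (kill_vars r \o ev).
have hid : h =1 (idfun : {rmorphism {mpoly k[d - r]} -> {mpoly k[d - r]}}).
  apply: mpoly_rmorph_ext => [a|j]; rewrite /h /ev /=.
    by rewrite [mmap c u _]mmapC [kill_vars _ _]kill_varsC /rho /= mmapC.
  rewrite [mmap c u _]mmapX mmap1U /u kill_varsX /= ltnNge leq_addr /=.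
  by rewrite /rho /= mmapX mmap1U /= addKn valK.
rewrite -[LHS]hid /h /= -[mmap c u p]/(mmap (@mpolyC d k) u p) [kill_vars r _]pu.
exact: rmorph0.
Qed.

End CoordinatePrimes.

Section LexStructure.
Variables (k : fieldType) (d g delta : nat) (L : set {mpoly k[d]}).
Hypotheses (lexL : lex_segment L) (htL : ideal_height L g) (g_ge2 : (2 <= g)%N).
Hypotheses (degL : generated_in_degree L delta) (delta_gt0 : (0 < delta)%N).

Lemma mlex_ge_first (m m' : 'X_{1..d}) (i : 'I_d) :
  (forall j : 'I_d, (j < i)%N -> m j = m' j) -> (m' i < m i)%N -> mlex_ge m m'.
Proof.
move=> eq_lt lt_i; apply: ltW; apply/Order.TupleLexiOrder.ltxi_tuplePlt.
exists i => [j ji|]; rewrite -!mnm_tnth; first by rewrite eq_lt.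
by rewrite ltEnat.
Qed.

Lemma lex_segment_height_le : (g <= d)%N.
Proof.
have [[P [Pp _ [chP _]]] _] := htL.
have u : 'I_0 -> {mpoly k[d]} by case.
suff ind : indep_mod P u by have := prime_chain_indep chP ind; rewrite addn0.
have [[_ _ PZ] nP1 _] := Pp.
move=> p; rewrite [p]nvar0_mpolyC mpolyC_eq0 => c0; rewrite mmapC => Pc; apply: nP1.
have -> : 1 = (p@_0%MM)^-1%:MP * (p@_0%MM)%:MP :> {mpoly k[d]}.
  by rewrite -mpolyCM mulVf // mpolyC1.
exact: PZ.
Qed.

(** Otherwise no generator, being of degree [delta], is lexicographically at least x_g^delta without
    involving one of x_1, ..., x_(g-1), and any generator below it would force x_g^delta into [L].
    So [L] lies in the prime of these [g.-1] variables, against its height. *)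
Lemma lex_segment_power (i : 'I_d) : i = g.-1 :> nat -> L 'X_[U_(i) *+ delta].
Proof.
move=> ig; apply: contrapT => nL.
have [_ minh] := htL; suff : (g <= g.-1)%N by lia.
have le_gd := lex_segment_height_le.
apply: minh; first exact: (coordinate_prime_prime k d g.-1).
  move=> f Lf; rewrite coordinate_primeE [f]mpolyE (rmorph_sum (kill_vars _ _ _)) big_seq.
  apply: big1 => m mf.
  have [l [le_lm degl Ll]] := minimal_generator_below degL (monomial_ideal_supp lexL.1 Lf mf).
  have [j [jg lj]] : exists j : 'I_d, (j < g.-1)%N /\ (0 < l j)%N.
    apply: contrapT => nj; apply: nL; apply: (lex_segment_up lexL Ll).
      by rewrite mdegMn mdeg1 degl mul1n.
    have l0 (j : 'I_d) : (j < i)%N -> l j = 0%N.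
      by rewrite ig => jg; apply/eqP; rewrite -leqn0 leqNgt; apply/negP => lj; apply: nj; exists j.
    have [eq_li|ne_li] := eqVneq l (U_(i) *+ delta)%MM.
      by rewrite eq_li /mlex_ge.
    apply: (@mlex_ge_first _ _ i) => [j ji|].
      by rewrite l0 // mulmnE mnm1E; case: eqP => [e|//]; rewrite e ltnn in ji.
    rewrite mulmnE mnm1E eqxx mul1n ltn_neqAle; apply/andP; split; last first.
      by rewrite -degl mdegE (bigD1 i) //= leq_addr.
    apply: contraNneq ne_li => li; apply/eqP/mnmP => j.
    rewrite mulmnE mnm1E; have [<-|ij] := eqVneq i j; first by rewrite mul1n.
    move: degl; rewrite mdegE (bigD1 i) //= (bigD1 j) 1?eq_sym //= li.
    by rewrite mul0n; lia.
  have le_jm : (U_(j) <= m)%MM.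
    by rewrite lep1mP -lt0n; apply: leq_trans lj _; apply/mnm_lepP.
  rewrite -mul_mpolyC -(submK le_jm) mpolyXD (rmorphM (kill_vars _ _ _)).
  by rewrite (rmorphM (kill_vars _ _ _)) kill_varsX jg !mulr0.
by apply: coordinate_prime_height; lia.
Qed.

Lemma lex_segment_first (u : 'X_{1..d}) : mdeg u = delta ->
  (exists i : 'I_d, (i < g.-1)%N /\ (0 < u i)%N) -> L 'X_[u].
Proof.
move=> degu [i0 [i0g ui0]].
have le_gd := lex_segment_height_le.
have hg : (g.-1 < d)%N by lia.
apply: (lex_segment_up lexL (lex_segment_power (i := Ordinal hg) erefl)).
  by rewrite mdegMn mdeg1 degu mul1n.
case: (@arg_minnP _ i0 (fun i => (0 < u i)%N) val ui0) => i ui mini.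
have ig : (i < g.-1)%N by exact: leq_ltn_trans (mini _ ui0) i0g.
have notg (j : 'I_d) : (j < g.-1)%N -> (U_(Ordinal hg) *+ delta)%MM j = 0%N.
  by move=> jg; rewrite mulmnE mnm1E -val_eqE /= gtn_eqF.
apply: (@mlex_ge_first _ _ i) => [j ji|]; rewrite notg //.
  by apply/eqP; rewrite -leqn0 leqNgt; apply/negP => /mini; rewrite /= leqNgt ji.
exact: ltn_trans ig.
Qed.

End LexStructure.

(** * The core and a special reduction *)

(** The preimage under [phi] of a reduction is a reduction with the same [m0]: both maps preserve
    the powers of [L], and [psi] carries the defining equation back. *)
Lemma core_invariant (A : comNzRingType) (L : set A) (phi psi : {rmorphism A -> A}) :
  cancel phi psi -> cancel psi phi ->
  (forall x, L x -> L (phi x)) -> (forall x, L x -> L (psi x)) ->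
  forall f, ideal_core L f -> ideal_core L (phi f).
Proof.
move=> phiK psiK Lphi Lpsi f coref J [iJ JL [m0 redJ]].
have [J0 JD JM] := iJ.
pose J' : set A := [set x | J (phi x)].
have iJ' : is_ideal J'.
  split=> [|x y|a x]; rewrite /J' /=; first by rewrite rmorph0.
    by rewrite rmorphD; apply: JD.
  by rewrite rmorphM; apply: JM.
have pow_stable (theta : {rmorphism A -> A}) : (forall x, L x -> L (theta x)) ->
    forall m x, ideal_pow L m x -> ideal_pow L m (theta x).
  move=> Lth; elim=> [//|m IH]; have [P0 PD PM] := ideal_pow_ideal L m.+1.
  apply: (@ideal_mul_min _ _ _ [set x | ideal_pow L m.+1 (theta x)]) => [|x y Lx Py].
    split=> [|x y|a x] /=; first by rewrite rmorph0.
      by rewrite rmorphD; apply: PD.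
    by rewrite rmorphM; apply: PM.
  by rewrite /= rmorphM; apply: ideal_pow_in; [apply: Lth|apply: IH].
have J'L : J' `<=` L by move=> x /JL/Lpsi; rewrite phiK.
have : is_reduction L J'; last by move/coref.
split=> //; exists m0 => m le_m; apply/seteqP; split=> [x Px|]; last exact: ideal_mul_mono.
have [Q0 QD QM] := ideal_mul_ideal J' (ideal_pow L m).
have : ideal_mul J (ideal_pow L m) (phi x) by rewrite -redJ //; apply: pow_stable.
have sub : ideal_mul J (ideal_pow L m) `<=` [set z | ideal_mul J' (ideal_pow L m) (psi z)].
  apply: ideal_mul_min => [|a b Ja Pb] /=.
    split=> [|y z|a y] /=; first by rewrite rmorph0.
      by rewrite rmorphD; apply: QD.
    by rewrite rmorphM; apply: QM.
  rewrite rmorphM; apply: ideal_mul_in; first by rewrite /J' /= psiK.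
  exact: pow_stable.
by move/sub; rewrite /= phiK.
Qed.

Section Shears.
Variables (k : fieldType) (d : nat).
Local Notation R := {mpoly k[d]}.

Definition shear (i : 'I_d) (h : R) : {rmorphism R -> R} :=
  mmap (@mpolyC d k) (fun j => if j == i then 'X_i + h else 'X_j).

Lemma shearC i h c : shear i h c%:MP = c%:MP.
Proof. by rewrite /shear /= mmapC. Qed.

Lemma shearX i h j : shear i h 'X_j = if j == i then 'X_i + h else 'X_j.
Proof. by rewrite /shear /= mmapX mmap1U. Qed.

Lemma shearZ i h c f : shear i h (c *: f) = c *: shear i h f.
Proof. by rewrite -!mul_mpolyC (rmorphM (shear i h)) shearC. Qed.

Lemma shearXm i h m : shear i h 'X_[m] =
  \prod_j (if j == i then 'X_i + h else 'X_j) ^+ m j.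
Proof. by rewrite /shear /= mmapX. Qed.

Lemma shearK i h : shear i (- h) h = h -> cancel (shear i h) (shear i (- h)).
Proof.
move=> hK; pose f : {rmorphism R -> R} := shear i (- h) \o shear i h.
suff : f =1 (idfun : {rmorphism R -> R}) by [].
apply: mpoly_rmorph_ext => [c|j]; first by rewrite /f /= [shear i h _]shearC [LHS]shearC.
rewrite /f /= [shear i h _]shearX; case: eqP => [->|ji].
  by rewrite (rmorphD (shear i (- h))) shearX eqxx hK subrK.
by rewrite [LHS]shearX; case: eqP.
Qed.

End Shears.
Arguments shear : simpl never.

Section WeightIdeal.
Variables (k : fieldType) (d g : nat).
Local Notation R := {mpoly k[d]}.

Definition weight (m : 'X_{1..d}) : nat := \sum_(i < d | (i < g)%N) m i.

(** The power of exponent [N] of the ideal of the variables of index below [g], described by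
    supports. *)
Definition weight_ideal (N : nat) : set R :=
  [set f | forall m, m \in msupp f -> (N <= weight m)%N].

Lemma weightD m1 m2 : weight (m1 + m2)%MM = (weight m1 + weight m2)%N.
Proof. by rewrite -big_split /=; apply: eq_bigr => i _; rewrite mnmDE. Qed.

Lemma weight_le_mdeg m : (weight m <= mdeg m)%N.
Proof. by rewrite mdegE [X in (_ <= X)%N](bigID (fun i : 'I_d => (i < g)%N)) /= leq_addr. Qed.

Lemma weight_idealM a b f h :
  weight_ideal a f -> weight_ideal b h -> weight_ideal (a + b) (f * h).
Proof.
move=> wf wh m /msuppM_le /allpairsP[[m1 m2] /= [m1f m2h ->]].
by rewrite weightD leq_add ?wf ?wh.
Qed.

Lemma weight_ideal_le a b f : (b <= a)%N -> weight_ideal a f -> weight_ideal b f.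
Proof. by move=> le_ba wf m mf; apply: leq_trans le_ba _; apply: wf. Qed.

Lemma weight_ideal0 f : weight_ideal 0 f. Proof. by []. Qed.

Lemma weight_ideal_ideal N : is_ideal (weight_ideal N).
Proof.
split=> [m|x y wx wy m|a x wx]; first by rewrite msupp0.
  by move=> /msuppD_le; rewrite mem_cat => /orP[/wx|/wy].
by rewrite -[N]add0n; apply: weight_idealM.
Qed.

Lemma weight_idealXm (m : 'X_{1..d}) N : (N <= weight m)%N -> weight_ideal N 'X_[m].
Proof. by move=> h m'; rewrite msuppX inE => /eqP ->. Qed.

Lemma weight_idealX a f n : weight_ideal a f -> weight_ideal (n * a) (f ^+ n).
Proof.
move=> wf; elim: n => [|n IH]; first by rewrite mul0n; exact: weight_ideal0.
by rewrite exprS mulSn; apply: weight_idealM.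
Qed.

Lemma weight1 (i : 'I_d) : (i < g)%N -> weight U_(i) = 1%N.
Proof.
move=> ig; rewrite /weight (bigD1 i) //= mnm1E eqxx big1 // => j /andP[_ ji].
by rewrite mnm1E eq_sym (negPf ji).
Qed.

Lemma weight_submultinom (m : 'X_{1..d}) N : (N <= weight m)%N ->
  exists u : 'X_{1..d}, [/\ (u <= m)%MM, mdeg u = N & forall i : 'I_d, (g <= i)%N -> u i = 0%N].
Proof.
elim: N => [|N IH] hN.
  exists 0%MM; split; [by apply/mnm_lepP => i; rewrite mnm0E|exact: mdeg0|].
  by move=> i _; rewrite mnm0E.
have [u [le_um degu u0]] := IH (ltnW hN).
have [i [ig lt_i]] : exists i : 'I_d, (i < g)%N /\ (u i < m i)%N.
  apply: contrapT => ni; move: hN; rewrite ltnNge => /negP; apply.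
  rewrite -degu mdegE [X in (_ <= X)%N](bigID (fun i : 'I_d => (i < g)%N)) /=.
  apply: leq_trans (leq_addr _ _); apply: leq_sum => i ig; rewrite leqNgt.
  by apply/negP => lt_i; apply: ni; exists i.
exists (u + U_(i))%MM; split.
- apply/mnm_lepP => j; rewrite mnmDE mnm1E; have [<-|_] := eqVneq i j.
    by rewrite addn1.
  by rewrite addn0; apply/mnm_lepP.
- by rewrite mdegD mdeg1 degu addn1.
- move=> j gj; rewrite mnmDE mnm1E u0 //; case: eqP => // e.
  by move: gj; rewrite -e leqNgt ig.
Qed.

Lemma shear_weight (i : 'I_d) (h : R) N : (i < g)%N -> weight_ideal 1 h ->
  forall f, weight_ideal N f -> weight_ideal N (shear i h f).
Proof.
move=> ig wh f wf; rewrite [f]mpolyE (rmorph_sum (shear i h)) big_seq.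
apply: ideal_sum => [|m mf]; first exact: weight_ideal_ideal.
rewrite shearZ -mul_mpolyC -[N]add0n; apply: weight_idealM => //.
apply: (@weight_ideal_le (weight m)); first exact: wf.
rewrite shearXm /weight big_mkcond /=.
elim/big_rec2: _ => // j y w _ wy.
apply: weight_idealM => //; case: ifP => jg //; rewrite -[X in weight_ideal X]muln1; apply: weight_idealX.
case: eqP => _; last by apply: weight_idealXm; rewrite weight1.
have [_ WD _] := weight_ideal_ideal 1; apply: WD => //.
by apply: weight_idealXm; rewrite weight1.
Qed.

End WeightIdeal.

Lemma ideal_add_ideal (A : comNzRingType) (I J : set A) : is_ideal I -> is_ideal J ->
  is_ideal [set x | exists u w, [/\ I u, J w & x = u + w]].
Proof.
move=> [I0 ID IM] [J0 JD JM]; split.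
- by exists 0, 0; rewrite addr0.
- move=> _ _ [u [w [Iu Jw ->]]] [u' [w' [Iu' Jw' ->]]].
  by exists (u + u'), (w + w'); rewrite addrACA; split; [apply: ID|apply: JD|].
- move=> a _ [u [w [Iu Jw ->]]]; exists (a * u), (a * w).
  by rewrite mulrDr; split; [apply: IM|apply: JM|].
Qed.

Section SpecialReduction.
Variables (k : fieldType) (d g delta : nat) (L : set {mpoly k[d]}) (i0 : 'I_d).
Local Notation R := {mpoly k[d]}.
Hypotheses (monL : monomial_ideal L) (degL : generated_in_degree L delta).
Hypotheses (i0_eq0 : i0 = 0%N :> nat) (g_gt0 : (0 < g)%N) (delta_gt0 : (0 < delta)%N).
Hypothesis pureL : forall u : 'X_{1..d}, mdeg u = delta ->
  (forall i : 'I_d, (g <= i)%N -> u i = 0%N) -> L 'X_[u].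
Local Notation weight := (@weight d g).
Local Notation QN := (@weight_ideal k d g).

Let iL : is_ideal L := monomial_ideal_ideal monL.

Definition tail_sum : R := \sum_(j < d | (0 < j < g)%N) 'X_j.

Lemma shear_tail h : shear i0 h tail_sum = tail_sum.
Proof.
rewrite /tail_sum (rmorph_sum (shear i0 h)); apply: eq_bigr => j /andP[j0 _].
by rewrite shearX; case: eqP => // e; rewrite e i0_eq0 in j0.
Qed.

Definition spread : {rmorphism R -> R} := shear i0 tail_sum.
Definition unspread : {rmorphism R -> R} := shear i0 (- tail_sum).

Lemma spreadK : cancel spread unspread.
Proof. by apply: shearK; rewrite shear_tail. Qed.

Lemma unspreadK : cancel unspread spread.
Proof.
have h : shear i0 (- - tail_sum) (- tail_sum) = - tail_sum.
  by rewrite (rmorphN (shear i0 _)) shear_tail.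
by move=> x; have := shearK h x; rewrite opprK.
Qed.

Lemma tail_weight : QN 1 tail_sum.
Proof.
rewrite /tail_sum; apply: ideal_sum => [|j /andP[_ jg]]; first exact: weight_ideal_ideal.
by apply: weight_idealXm; rewrite weight1.
Qed.

Lemma i0_lt_g : (i0 < g)%N. Proof. by rewrite i0_eq0. Qed.

Lemma spread_weight N f : QN N f -> QN N (spread f).
Proof. exact: (shear_weight i0_lt_g tail_weight). Qed.

Lemma unspread_weight N f : QN N f -> QN N (unspread f).
Proof.
apply: (shear_weight i0_lt_g).
exact: (idealN (weight_ideal_ideal _ _ _ _) tail_weight).
Qed.

(** The monomials that survive modulo the variables of index at least [g] and the powers of exponent
    [delta] of the others. *)
Definition small (m : 'X_{1..d}) : Prop :=
  forall i : 'I_d, if (i < g)%N then (m i < delta)%N else m i == 0%N.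

Lemma small_le m m' : (m <= m')%MM -> small m' -> small m.
Proof.
move=> /mnm_lepP le_mm' sm i; have := sm i; case: ifP => _.
  exact: leq_ltn_trans.
by move=> /eqP m'0; rewrite -leqn0 -m'0.
Qed.

(* A linear change of variables turns the quotient by this ideal, modulo the
   variables of index at least [g], into that by the [delta]-th powers of the
   other variables. *)
Definition special_reduction : set R :=
  [set f | L f /\ forall m, small m -> (spread f)@_m = 0].

Lemma mcoeff_mul_eq0 (P : 'X_{1..d} -> Prop) (f h : R) (m : 'X_{1..d}) :
  (forall m1 m2, P m1 -> (m2 <= m1)%MM -> P m2) ->
  (forall m', P m' -> h@_m' = 0) -> P m -> (f * h)@_m = 0.
Proof.
move=> Ple h0 Pm; rewrite mcoeffM big1 // => mm /eqP mE.
rewrite (h0 (val mm.2)) ?mulr0 //; apply: (Ple _ _ Pm).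
by rewrite [X in (_ <= X)%MM]mE; exact: lem_addl.
Qed.

Lemma special_reduction_ideal : is_ideal special_reduction.
Proof.
have [L0 LD LM] := iL; split=> [|x y [Lx x0] [Ly y0]|a x [Lx x0]].
- by split=> // m _; rewrite (rmorph0 spread) mcoeff0.
- split=> [|m sm]; first exact: LD.
  by rewrite (rmorphD spread) mcoeffD x0 // y0 // addr0.
- split=> [|m sm]; first exact: LM.
  rewrite (rmorphM spread); apply: (@mcoeff_mul_eq0 small) => // m1 m2 sm1 le21.
  exact: small_le sm1.
Qed.

Lemma special_nonpure (m : 'X_{1..d}) (i : 'I_d) : L 'X_[m] -> (g <= i)%N -> (0 < m i)%N ->
  special_reduction 'X_[m].
Proof.
move=> Lm gi mi; split=> // m' sm'.
have le_im : (U_(i) <= m)%MM by rewrite lep1mP -lt0n.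
rewrite -(submK le_im) mpolyXD (rmorphM spread) [spread 'X_i]shearX.
case: eqP => [e|_]; first by have := i0_lt_g; rewrite -e ltnNge gi.
apply: (@mcoeff_mul_eq0 small) sm' => [m1 m2 sm1 le21|m1 /(_ i)]; first exact: small_le sm1.
rewrite ltnNge gi /= mcoeffX => /eqP; case: eqP => // <-.
by rewrite mnm1E eqxx.
Qed.

Lemma lex_split (f : R) : L f ->
  exists j q, [/\ special_reduction j, L q, QN delta q & f = j + q].
Proof.
move=> Lf; pose pure (m : 'X_{1..d}) := [forall i : 'I_d, (g <= i)%N ==> (m i == 0%N)].
exists (\sum_(m <- msupp f | (m \in msupp f) && ~~ pure m) f@_m *: 'X_[m]).
exists (\sum_(m <- msupp f | (m \in msupp f) && pure m) f@_m *: 'X_[m]).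
have [_ _ LM] := iL; have [_ _ JM] := special_reduction_ideal.
have Lsupp m := @monomial_ideal_supp _ _ _ f m monL Lf.
split.
- apply: ideal_sum => [|m /andP[mf]]; first exact: special_reduction_ideal.
  rewrite negb_forall => /existsP[i]; rewrite negb_imply => /andP[gi mi].
  rewrite -mul_mpolyC; apply: JM; apply: (@special_nonpure m i) => //; first exact: Lsupp.
  by rewrite lt0n.
- apply: ideal_sum => // m /andP[mf _].
  by rewrite -mul_mpolyC; apply: LM; exact: Lsupp.
- apply: ideal_sum => [|m /andP[mf /forallP pm]]; first exact: weight_ideal_ideal.
  have [_ _ QM] := weight_ideal_ideal k d g delta.
  rewrite -mul_mpolyC; apply: QM; apply: weight_idealXm.
  have [l [le_lm <- _]] := minimal_generator_below degL (Lsupp _ mf).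
  have -> : weight m = mdeg m.
    rewrite mdegE [RHS](bigID (fun i : 'I_d => (i < g)%N)) /= [X in _ = (_ + X)%N]big1 ?addn0 //.
    by move=> i; rewrite -leqNgt => gi; apply/eqP; apply: (implyP (pm i)).
  by rewrite -(submK le_lm) mdegD leq_addl.
- by rewrite {1}[f]mpolyE big_seq (bigID pure) /= addrC.
Qed.

Lemma weight_pow n f : QN (n * delta) f -> ideal_pow L n f.
Proof.
move=> wf; apply: monomial_ideal_from_supp => [|m /wf]; first exact: ideal_pow_ideal.
elim: n m {wf} => [//|n IH] m; rewrite mulSn => le_wm.
have [u [le_um degu u0]] := weight_submultinom (leq_trans (leq_addr _ _) le_wm).
rewrite -(submK le_um) mpolyXD mulrC; apply: ideal_pow_in; first exact: pureL.
apply: IH; have := weight_le_mdeg g u; rewrite degu.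
by have := weightD g (m - u)%MM u; rewrite submK // => h; lia.
Qed.

Lemma weight_ideal_L f : QN delta f -> L f.
Proof.
rewrite -[delta]mul1n => /weight_pow; apply: ideal_mul_min => // x y Lx _.
by have [_ _ LM] := iL; rewrite mulrC; apply: LM.
Qed.

(** As [m.+1 * delta] exceeds [g * (delta - 1)], every monomial of [spread f] has an exponent at
    least [delta] at some index below [g]. The inverse change of variables sends that power into the
    reduction and the cofactor into [ideal_pow L m]. *)
Lemma weight_reduce m f : (g <= m.+1)%N -> QN (m.+1 * delta) f ->
  ideal_mul special_reduction (ideal_pow L m) f.
Proof.
move=> le_gm wf; rewrite -(spreadK f); have := spread_weight wf.
move: (spread f) => h wh.
rewrite [h]mpolyE (rmorph_sum unspread) big_seq.
apply: ideal_sum => [|r rh]; first exact: ideal_mul_ideal.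
have [i [ig ri]] : exists i : 'I_d, (i < g)%N /\ (delta <= r i)%N.
  apply: contrapT => ni; have := wh _ rh; rewrite leqNgt => /negP; apply.
  have : (weight r <= \sum_(i < d | (i < g)%N) (delta - 1))%N.
    apply: leq_sum => i ig; rewrite leqNgt; apply/negP => lt_i.
    by apply: ni; exists i; split=> //; lia.
  have : (\sum_(i < d | (i < g)%N) (delta - 1) <= g * (delta - 1))%N.
    rewrite sum_nat_const leq_mul2r; apply/orP; right.
    rewrite -sum1_card; have [le_gd|lt_dg] := leqP g d.
      by rewrite (eq_bigl (fun i : 'I_d => (i < g)%N)) // (big_ord_narrow le_gd) sum1_card card_ord.
    by rewrite sum1_card; apply: leq_trans (max_card _) _; rewrite card_ord ltnW.
  have : (g * (delta - 1) < m.+1 * delta)%N.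
    by apply: (@leq_ltn_trans (m.+1 * (delta - 1))); rewrite ?leq_mul2r ?le_gm ?orbT // ltn_mul2l /=; lia.
  by lia.
have le_ir : (U_(i) *+ delta <= r)%MM.
  apply/mnm_lepP => j; rewrite mulmnE mnm1E.
  by case: eqP => [<-|_]; rewrite ?mul1n ?mul0n.
have wi : QN delta ('X_[U_(i) *+ delta] : R).
  rewrite -mpolyXn -[X in QN X]muln1; apply: weight_idealX.
  by apply: weight_idealXm; rewrite weight1.
have [_ _ IM] := ideal_mul_ideal special_reduction (ideal_pow L m).
rewrite -mul_mpolyC (rmorphM unspread); apply: IM.
rewrite -(submK le_ir) mpolyXD (rmorphM unspread) mulrC; apply: ideal_mul_in.
  split; first by apply/weight_ideal_L/unspread_weight.
  move=> m' sm'; rewrite unspreadK mcoeffX; case: eqP => // e.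
  by have := sm' i; rewrite ig -e mulmnE mnm1E eqxx mul1n ltnn.
apply/weight_pow/unspread_weight; apply: weight_idealXm.
have : weight (U_(i) *+ delta)%MM = delta.
  rewrite /weight (bigD1 i) //= mulmnE mnm1E eqxx mul1n big1 ?addn0 // => j /andP[_ ji].
  by rewrite mulmnE mnm1E eq_sym (negPf ji).
have := wh _ rh; rewrite -{1}(submK le_ir) weightD mulSn; lia.
Qed.

Lemma special_reductionP : is_reduction L special_reduction.
Proof.
split; [exact: special_reduction_ideal | by move=> f [] |].
exists g => m le_gm.
have [M0 MD MM] := ideal_mul_ideal special_reduction (ideal_pow L m).
apply/seteqP; split; last by apply: ideal_mul_mono => f [].
(* Splitting the factors one at a time by [lex_split], a product either acquires a factor in the
   reduction or has weight at least [n.+1 * delta]; [weight_reduce] absorbs the latter. *)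
suff step n f : ideal_pow L n.+1 f -> exists u w,
    [/\ ideal_mul special_reduction (ideal_pow L n) u, QN (n.+1 * delta) w & f = u + w].
  by move=> f /step[u [w [Ju Qw ->]]]; apply: MD => //; apply: weight_reduce; rewrite ?leqW.
have iT n' : is_ideal [set f : R | exists u w,
    [/\ ideal_mul special_reduction (ideal_pow L n') u, QN (n'.+1 * delta) w & f = u + w]].
  exact: ideal_add_ideal (ideal_mul_ideal _ _) (weight_ideal_ideal _ _ _ _).
elim: n f => [|n IH] f; apply: (ideal_mul_min (iT _)) => {f} x y Lx.
  have [j [q [Jj Lq Qq ->]]] := lex_split Lx => _; exists (j * y), (q * y).
  split; rewrite ?mulrDl //; first exact: ideal_mul_in.
  have [_ _ QM] := weight_ideal_ideal k d g delta.
  by rewrite mul1n mulrC; apply: QM.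
move=> Py; have [u [w [Ju Qw yE]]] := IH y Py.
have [j [q [Jj Lq Qq xE]]] := lex_split Lx.
exists (x * u + j * w), (q * w); split.
- have [_ JD _] := ideal_mul_ideal special_reduction (ideal_pow L n.+1).
  apply: JD; last by apply: ideal_mul_in => //; exact: weight_pow.
  have {}iT : is_ideal [set z | ideal_mul special_reduction (ideal_pow L n.+1) (x * z)].
    have [K0 KD KM] := ideal_mul_ideal special_reduction (ideal_pow L n.+1).
    split=> [|a b Ka Kb|a b Kb] /=; first by rewrite mulr0.
      by rewrite mulrDr; apply: KD.
    by rewrite mulrCA; apply: KM.
  apply: (ideal_mul_min iT) Ju => a b Ja Pb /=.
  by rewrite mulrCA; apply: ideal_mul_in => //; exact: ideal_pow_in.
- by rewrite mulSn; exact: weight_idealM.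
- by rewrite yE xE; ring.
Qed.

End SpecialReduction.

(** * Degrees of elements of the core *)

Lemma coef1M (A : nzRingType) (p q : {poly A}) :
  (p * q)`_1 = p`_0 * q`_1 + p`_1 * q`_0.
Proof. by rewrite coefM !big_ord_recl big_ord0 addr0. Qed.

Lemma coef_linear (A : nzRingType) (a b : A) :
  (a%:P + b%:P * 'X)`_0 = a /\ (a%:P + b%:P * 'X)`_1 = b.
Proof. by rewrite !coefD !coefMX !coefC /= addr0 add0r. Qed.

Section CharacteristicZero.
Variables (k : fieldType) (d : nat).
Hypothesis char0 : [pchar k] =i pred0.
Local Notation R := {mpoly k[d]}.

Lemma natf_neq0_char0 n : (n.+1)%:R != 0 :> k.
Proof. by have /pcharf0P -> := char0. Qed.

(** Interpolation at 0, 1, 2, ..., which are distinct in characteristic zero: inverting the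
    Vandermonde matrix writes coefficients as linear combinations of values. *)
Lemma poly_coef_from_values (C : set R) (F : {poly R}) : is_ideal C ->
  (forall t : k, C F.[t%:MP]) -> forall l, C F`_l.
Proof.
move=> iC CF l; have [C0 CD CM] := iC.
have [le_l|lt_l] := leqP (size F) l; first by rewrite nth_default.
pose a : 'rV[k]_(size F) := \row_j (val j)%:R.
pose V := Vandermonde (size F) a.
have Vu : V \in unitmx.
  rewrite unitmxE unitfE det_Vandermonde; apply/prodf_neq0 => i _.
  apply/prodf_neq0 => j ij; rewrite !mxE -natrB 1?ltnW //.
  by have := natf_neq0_char0 (j - i).-1; rewrite prednK // subn_gt0.
have -> : F`_l = \sum_j (invmx V) j (Ordinal lt_l) *: F.[(a 0 j)%:MP].
  have hV i : \sum_j V i j * (invmx V) j (Ordinal lt_l) = (i == Ordinal lt_l)%:R.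
    by have /matrixP/(_ i (Ordinal lt_l)) := mulmxV Vu; rewrite !mxE.
  have inner (i : 'I_(size F)) :
      \sum_j (invmx V) j (Ordinal lt_l) *: (F`_i * (a 0 j)%:MP ^+ i) =
      (i == Ordinal lt_l)%:R *: F`_i.
    rewrite -hV scaler_suml; apply: eq_bigr => j _; rewrite mulrC -(rmorphXn (@mpolyC d k)) mul_mpolyC.
    by rewrite scalerA mulrC /V !mxE.
  under eq_bigr do rewrite horner_coef scaler_sumr.
  rewrite exchange_big /=; under eq_bigr do rewrite inner.
  rewrite (bigD1 (Ordinal lt_l)) //= eqxx scale1r big1 ?addr0 // => i /negPf ->.
  by rewrite scale0r.
by apply: ideal_sum => // j _; rewrite -mul_mpolyC; apply: CM.
Qed.

Definition shear_poly (i : 'I_d) (h : R) : {rmorphism R -> {poly R}} :=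
  mmap (@polyC R \o @mpolyC d k)
    (fun j => if j == i then ('X_i)%:P + h%:P * 'X else ('X_j)%:P).

Lemma shear_polyC i h c : shear_poly i h c%:MP = (c%:MP)%:P.
Proof. by rewrite /shear_poly /= mmapC. Qed.

Lemma shear_polyX i h j :
  shear_poly i h 'X_j = if j == i then ('X_i)%:P + h%:P * 'X else ('X_j)%:P.
Proof. by rewrite /shear_poly /= mmapX mmap1U. Qed.

Lemma horner_shear_poly i h (t : k) f :
  (shear_poly i h f).[t%:MP] = shear i (t *: h) f.
Proof.
pose F : {rmorphism R -> R} := horner_eval (t%:MP : R) \o shear_poly i h.
suff : F =1 shear i (t *: h) by move/(_ f).
apply: mpoly_rmorph_ext => [c|j]; rewrite /F /= /horner_eval.
  by rewrite [shear_poly i h _]shear_polyC hornerC shearC.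
rewrite [shear_poly i h _]shear_polyX shearX; case: eqP => _; last by rewrite hornerC.
by rewrite hornerD hornerMX !hornerC mulrC mul_mpolyC.
Qed.

Lemma shear_poly_coef i h f :
  (shear_poly i h f)`_0 = f /\ (shear_poly i h f)`_1 = h * f^`M(i).
Proof.
pose P f := (shear_poly i h f)`_0 = f /\ (shear_poly i h f)`_1 = h * f^`M(i).
have PC c : P c%:MP.
  by rewrite /P shear_polyC !coefC /= mderivC mulr0.
have PD x y : P x -> P y -> P (x + y).
  move=> [x0 x1] [y0 y1]; rewrite /P (rmorphD (shear_poly i h) x y).
  split; first exact: etrans (coefD _ _ _) (congr2 +%R x0 y0).
  apply: (etrans (coefD _ _ _)); apply: (etrans (congr2 +%R x1 y1)).
  by rewrite mderivD mulrDr.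
have PM x y : P x -> P y -> P (x * y).
  move=> [x0 x1] [y0 y1]; rewrite /P (rmorphM (shear_poly i h) x y).
  split; first exact: etrans (coef0M _ _) (congr2 *%R x0 y0).
  apply: (etrans (coef1M _ _)).
  apply: (etrans (congr2 +%R (congr2 *%R x0 y1) (congr2 *%R x1 y0))).
  by rewrite mderivM mulrDr addrC -mulrA [x * (h * _)]mulrCA.
have PX j : P 'X_j.
  rewrite /P shear_polyX mderivX mnm1E; case: eqP => [->|ji].
    have -> : (U_(i) - U_(i) = 0 :> 'X_{1..d})%MM.
      by apply/mnmP => l; rewrite mnmBE subnn mnm0E.
    by rewrite mpolyX0 scale1r mulr1; exact: coef_linear.
  by split; [exact: coefC|rewrite scale0r mulr0; exact: coefC].
elim/mpolyind: f => [|c m p _ _ IH]; first by rewrite -mpolyC0; exact: PC.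
apply: (PD _ _ _ IH); rewrite -mul_mpolyC; apply: (PM _ _ (PC c)).
rewrite mpolyXE_id; apply: (big_ind P) => [||j _]; [exact: (PC 1)|exact: PM|].
by elim: (m j) => [|n IHn]; [exact: (PC 1)|rewrite exprS; exact: (PM _ _ (PX j))].
Qed.

(** A relation [T] compatible with products need only be checked on variables. It is used for
    equality of degrees, and together with a bound on the exponents other than that of the largest
    variable. *)
Lemma shear_supp (T : 'X_{1..d} -> 'X_{1..d} -> Prop) (i : 'I_d) (h : R) :
  T 0%MM 0%MM ->
  (forall a b a' b', T a a' -> T b b' -> T (a + b)%MM (a' + b')%MM) ->
  (forall j, T U_(j)%MM U_(j)%MM) -> (forall p, p \in msupp h -> T p U_(i)%MM) ->
  forall m p, p \in msupp (shear i h 'X_[m]) -> T p m.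
Proof.
move=> T0 TD T1 Th m; rewrite shearXm [X in forall p, _ -> T p X]multinomUE_id.
pose Q (f : R) (m' : 'X_{1..d}) := forall p, p \in msupp f -> T p m'.
have QM f f' a a' : Q f a -> Q f' a' -> Q (f * f') (a + a')%MM.
  move=> Qf Qf' p /msuppM_le /allpairsP[[p1 p2] /= [/Qf p1f /Qf' p2f ->]].
  exact: TD.
have Q0 : Q 1 0%MM by move=> p; rewrite msupp1 inE => /eqP ->.
apply: (big_rec2 Q Q0) => j f a _; apply: (QM _ _ _ _).
elim: (m j) => [|n IH]; first by rewrite mulm0n.
rewrite exprS mulmS; apply: QM IH => p; case: eqP => [->|_].
  move=> /msuppD_le; rewrite mem_cat msuppX inE => /orP[/eqP ->|/Th] //.
by rewrite msuppX inE => /eqP ->.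
Qed.

End CharacteristicZero.

Lemma mdeg_sub d (l m : 'X_{1..d}) : (l <= m)%MM -> mdeg (m - l)%MM = (mdeg m - mdeg l)%N.
Proof. by move=> le_lm; rewrite -{2}(submK le_lm) mdegD addnK. Qed.

Section SumPowers.
Variables (k : fieldType) (d g : nat).
Local Notation R := {mpoly k[d]}.

(** A multinomial coefficient; being a positive integer, it is nonzero in characteristic zero, and
    its value does not matter. *)
Lemma sum_power_coef e (u : 'X_{1..d}) : mdeg u = e ->
  (forall i : 'I_d, (g <= i)%N -> u i = 0%N) ->
  exists n, ((\sum_(i < d | (i < g)%N) 'X_i : R) ^+ e)@_u = n.+1%:R.
Proof.
set S : R := \sum_(i < d | _) _.
elim: e u => [|e IH] u degu u0.
  exists 0%N; rewrite expr0; have /eqP := degu; rewrite mdeg_eq0 => /eqP ->.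
  by rewrite mcoeff1 eqxx.
have term (i : 'I_d) : (0 < u i)%N -> exists n, (S ^+ e * 'X_i)@_u = n.+1%:R.
  move=> ui; have le_iu : (U_(i) <= u)%MM by rewrite lep1mP -lt0n.
  have [|j jg|n nE] := IH (u - U_(i))%MM.
  - by rewrite mdeg_sub // mdeg1 degu subn1.
  - by rewrite mnmBE u0.
  exists n; rewrite -nE -{1}(submK le_iu) addmC; exact: mcoeffMX.
have [i ui] : exists i : 'I_d, (0 < u i)%N.
  apply: contrapT => nu; suff : mdeg u = 0%N by rewrite degu.
  rewrite mdegE big1 // => i _; apply/eqP; rewrite -leqn0 leqNgt.
  by apply/negP => ui; apply: nu; exists i.
have ig : (i < g)%N by rewrite ltnNge; apply/negP => /u0 ui0; rewrite ui0 in ui.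
have [n nE] := term i ui.
rewrite exprSr {2}/S mulr_sumr raddf_sum (bigD1 i) //= nE.
have [n' ->] : exists n', \sum_(j < d | (j < g)%N && (j != i)) (S ^+ e * 'X_j)@_u = n'%:R :> k.
  elim/big_rec: _ => [|j x _ [n' ->]]; first by exists 0%N.
  have [uj|] := ltnP 0 (u j); first by have [n2 ->] := term j uj; exists (n2.+1 + n')%N; rewrite natrD.
  rewrite leqn0 => /eqP uj; exists n'.
  rewrite (@mcoeff_mul_eq0 _ _ (fun m => m j = 0%N)) ?add0r //.
    by move=> m1 m2 m1j /mnm_lepP/(_ j); rewrite m1j leqn0 => /eqP.
  by move=> m mj; rewrite mcoeffX; case: eqP => // e'; rewrite -e' mnm1E eqxx in mj.
by exists (n + n')%N; rewrite -natrD addSn.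
Qed.

End SumPowers.

Section CoreDegree.
Variables (k : fieldType) (d g delta : nat) (L : set {mpoly k[d]}) (i0 : 'I_d).
Hypothesis char0 : [pchar k] =i pred0.
Local Notation R := {mpoly k[d]}.
Hypotheses (lexL : lex_segment L) (i0_eq0 : i0 = 0%N :> nat).

Let monL : monomial_ideal L := lexL.1.
Let iL : is_ideal L := monomial_ideal_ideal monL.

(** The substitution only turns factors ['X_i] into the largest variable, so the new monomials have
    the same degree and are lexicographically at least the old ones. *)
Lemma lex_segment_shear (i : 'I_d) (t : k) (f : R) : i != i0 ->
  L f -> L (shear i (t *: 'X_i0) f).
Proof.
move=> ii0 Lf; rewrite [f]mpolyE (rmorph_sum (shear i _)) big_seq.
have [_ _ LM] := iL.
apply: ideal_sum => // m mf; rewrite shearZ -mul_mpolyC; apply: LM.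
apply: monomial_ideal_from_supp => // p.
pose T (p m : 'X_{1..d}) := mdeg p = mdeg m /\ forall j, j != i0 -> (p j <= m j)%N.
move/(@shear_supp _ _ T) => [//|a b a' b' [da la] [db lb]|//|q qt|degp le_pm].
- split=> [|j ji]; first by rewrite !mdegD da db.
  by rewrite !mnmDE leq_add ?la ?lb.
- have : q \in msupp ('X_i0 : R) by exact: msuppZ_le qt.
  rewrite msuppX inE => /eqP ->; split=> [|j ji]; first by rewrite !mdeg1.
  by rewrite mnm1E eq_sym (negPf ji).
apply: (lex_segment_up lexL (monomial_ideal_supp monL Lf mf) degp).
have [eq0|ne0] := eqVneq (p i0) (m i0); last first.
  apply: (@mlex_ge_first _ _ _ i0) => [j|]; first by rewrite i0_eq0.
  rewrite ltn_neqAle eq_sym ne0 /=.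
  have le_sum : (\sum_(j | j != i0) p j <= \sum_(j | j != i0) m j)%N.
    by apply: leq_sum => j; exact: le_pm.
  move: degp; rewrite !mdegE (bigD1 i0) //= [in RHS](bigD1 i0) //= => degp.
  by rewrite -(leq_add2r (\sum_(j | j != i0) m j)) -degp leq_add2l.
suff -> : p = m by exact: lexx.
have le_pm' : (p <= m)%MM.
  by apply/mnm_lepP => j; have [->|ji] := eqVneq j i0; [rewrite eq0|exact: le_pm].
rewrite -[RHS](submK le_pm'); have /eqP : mdeg (m - p)%MM = 0%N by rewrite mdeg_sub // degp subnn.
by rewrite mdeg_eq0 => /eqP ->; rewrite add0m.
Qed.

Lemma ideal_core_ideal (A : comNzRingType) (I : set A) : is_ideal (ideal_core I).
Proof.
split=> [J|x y cx cy J rJ|a x cx J rJ].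
- by move=> -[[]].
- by have [[_ JD _] _ _] := rJ; apply: JD; [exact: cx|exact: cy].
- by have [[_ _ JM] _ _] := rJ; apply: JM; exact: cx.
Qed.

(* The core is stable under the flow of this derivation, hence, in
   characteristic zero, under the derivation itself. *)
Lemma core_derivation (i : 'I_d) (f : R) : i != i0 ->
  ideal_core L f -> ideal_core L ('X_i0 * f^`M(i)).
Proof.
move=> ii0 cf; have [_ <-] := shear_poly_coef i 'X_i0 f.
apply: (poly_coef_from_values char0); first exact: ideal_core_ideal.
move=> t; rewrite horner_shear_poly.
have fixt s t' : shear i (s *: 'X_i0) (t' *: 'X_i0) = t' *: 'X_i0 :> R.
  by rewrite shearZ shearX eq_sym (negPf ii0).
have Kt s : cancel (shear i (s *: 'X_i0 : R)) (shear i ((- s) *: 'X_i0)).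
  by rewrite scaleNr; apply: shearK; rewrite -scaleNr fixt.
apply: (core_invariant (psi := shear i ((- t) *: 'X_i0)) (Kt t)) => //.
- by have := Kt (- t); rewrite opprK.
- by move=> x; exact: lex_segment_shear.
- by move=> x; exact: lex_segment_shear.
Qed.

Hypotheses (htL : ideal_height L g) (g_ge2 : (2 <= g)%N).
Hypotheses (degL : generated_in_degree L delta) (delta_gt0 : (0 < delta)%N).

Lemma lex_segment_pure (u : 'X_{1..d}) : mdeg u = delta ->
  (forall i : 'I_d, (g <= i)%N -> u i = 0%N) -> L 'X_[u].
Proof.
move=> degu u0; have [ui|nu] := pselect (exists i : 'I_d, (i < g.-1)%N /\ (0 < u i)%N).
  exact: (lex_segment_first lexL htL g_ge2 degL delta_gt0 degu).
have hg : (g.-1 < d)%N by have := lex_segment_height_le htL; lia.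
have u0' (j : 'I_d) : j != Ordinal hg -> u j = 0%N.
  rewrite -val_eqE /= => jg; have [/u0 //|lt_j] := leqP g j.
  apply/eqP; rewrite -leqn0 leqNgt; apply/negP => uj; apply: nu; exists j.
  by split=> //; lia.
suff -> : u = (U_(Ordinal hg) *+ delta)%MM.
  exact: (lex_segment_power lexL htL g_ge2 degL).
apply/mnmP => j; rewrite mulmnE mnm1E; case: eqP => [<-|/eqP]; last first.
  by rewrite eq_sym => /u0' ->.
by rewrite mul1n -degu mdegE (bigD1 (Ordinal hg)) //= big1 ?addn0.
Qed.

Lemma special_reduction_lex : is_reduction L (special_reduction g delta L i0).
Proof. by apply: special_reductionP lex_segment_pure; rewrite // ltnW. Qed.

Lemma core_sub (f : R) : ideal_core L f -> L f.
Proof. by move=> cf; have [] := cf _ special_reduction_lex. Qed.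

Lemma spread_homog (m u : 'X_{1..d}) : mdeg m != mdeg u -> (spread k g i0 'X_[m])@_u = 0.
Proof.
move=> ne_mu; apply/eqP; rewrite mcoeff_eq0; apply: contraNN ne_mu.
move/(@shear_supp _ _ (fun p m => mdeg p = mdeg m)) => /(_ _ _ _ _)/eqP.
rewrite eq_sym; apply=> // [a b a' b'|q]; first by rewrite !mdegD => -> ->.
rewrite /tail_sum => /msupp_sum_le /flattenP[s /mapP[j _ ->]].
by rewrite msuppX inE => /eqP ->; rewrite !mdeg1.
Qed.

(** The component of degree [e] is a multiple of x_1^e, which [spread] sends to (x_1 + ... + x_g)^e;
    a small monomial of degree [e] occurs in it, against membership in the special reduction. *)
Lemma core_no_pure_power e (f : R) (m : 'X_{1..d}) : (e <= g * (delta - 1))%N ->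
  ideal_core L f -> (forall p, p \in msupp f -> mdeg p = e -> p i0 = e) ->
  m \in msupp f -> mdeg m = e -> False.
Proof.
move=> le_e cf f_top mf degm.
have le_gd := lex_segment_height_le htL.
have powE p : mdeg p = e -> p i0 = e -> p = (U_(i0) *+ e)%MM.
  move=> degp pi0; apply/mnmP => j; rewrite mulmnE mnm1E; case: eqP => [<-|/eqP ji].
    by rewrite mul1n.
  by move: degp; rewrite mdegE (bigD1 i0) //= (bigD1 j) 1?eq_sym //= pi0 mul0n; lia.
have mE := powE _ degm (f_top _ mf degm).
(* The largest small monomial; its degree [g * (delta - 1)] is why every such [e] admits a small
   [u]. *)
pose b : 'X_{1..d} := [multinom if (i < g)%N then (delta - 1)%N else 0%N | i < d].
have [|u [le_ub degu u0]] := @weight_submultinom d g b e.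
  rewrite /weight (eq_bigr (fun=> (delta - 1)%N)) => [|i ig]; last by rewrite mnmE ig.
  by rewrite (big_ord_narrow le_gd) sum_nat_const card_ord.
have smu : small g delta u.
  move=> i; move/mnm_lepP: (le_ub) => /(_ i); rewrite mnmE; case: ifP => _.
    by move=> h; apply: leq_ltn_trans h _; lia.
  by rewrite leqn0.
have [_ /(_ u smu)] := cf _ special_reduction_lex.
rewrite {1}[f]mpolyE (rmorph_sum (spread k g i0)) raddf_sum /=.
rewrite (bigD1_seq m) ?msupp_uniq //= big_seq_cond big1 ?addr0 => [|p /andP[pf pm]]; last first.
  rewrite -mul_mpolyC (rmorphM (spread k g i0)) [spread _ _ _ _%:MP]shearC mul_mpolyC.
  rewrite mcoeffZ spread_homog ?mulr0 // degu; apply: contraNneq pm => degp.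
  by rewrite mE (powE _ degp (f_top _ pf degp)).
rewrite [spread _ _ _ _]shearZ mcoeffZ {2}mE -mpolyXn (rmorphXn (shear i0 _)) shearX eqxx.
have -> : 'X_i0 + tail_sum k d g = \sum_(i < d | (i < g)%N) 'X_i.
  rewrite [RHS](bigD1 i0) /= ?i0_eq0 ?(ltnW g_ge2) //; congr (_ + _).
  by apply: eq_bigl => j; rewrite andbC -val_eqE /= i0_eq0 lt0n.
have [n ->] := sum_power_coef k degu u0.
move/eqP; rewrite mulf_eq0 mcoeff_eq0 mf /= => h.
by have := natf_neq0_char0 char0 n; rewrite h.
Qed.

(** Induction on a bound for [e - p i0] over the monomials [p] of degree [e]. A derivation from
    [core_derivation] keeps the degree and raises the exponent of x_1 by one in every surviving
    monomial, so the bound drops. *)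
Lemma core_degree (f : R) (m : 'X_{1..d}) :
  ideal_core L f -> m \in msupp f -> (g * (delta - 1) < mdeg m)%N.
Proof.
move=> cf mf; rewrite ltnNge; apply/negP; move: {-1}(mdeg m) (erefl (mdeg m)) => e degm le_e.
have : forall p, p \in msupp f -> mdeg p = e -> (e <= p i0 + e)%N by move=> *; lia.
move: {3}e => n; elim: n f m cf mf degm => [|n IH] f m cf mf degm top.
  apply: (core_no_pure_power le_e cf _ mf degm) => p pf degp.
  apply/eqP; rewrite eqn_leq; apply/andP; split.
    by rewrite -degp mdegE (bigD1 i0) //= leq_addr.
  by rewrite -[p i0]addn0; exact: top.
have [[i [p [ii0 pi pf degp]]]|none] :=
    pselect (exists i (p : 'X_{1..d}), [/\ i != i0, (0 < p i)%N, p \in msupp f & mdeg p = e]); last first.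
  apply: (core_no_pure_power le_e cf _ mf degm) => p pf degp.
  rewrite -degp mdegE (bigD1 i0) //= big1 ?addn0 // => i ii0.
  apply/eqP; rewrite -leqn0 leqNgt; apply/negP => pi; apply: none; exists i, p.
  by split.
have le_ip : (U_(i) <= p)%MM by rewrite lep1mP -lt0n.
apply: (IH ('X_i0 * f^`M(i)) (U_(i0) + (p - U_(i)))%MM).
- exact: core_derivation.
(* The coefficient is that of [p] in [f] times [p i], nonzero in characteristic zero; distinct
   monomials have distinct images, so nothing cancels. *)
- rewrite mcoeff_msupp mulrC mcoeffMX mcoeff_mderiv submK // -mulr_natr.
  by rewrite mulf_neq0 ?natf_neq0_char0 // -mcoeff_msupp.
- rewrite mdegD mdeg_sub // !mdeg1 degp add1n subn1 prednK //.
  by rewrite -degp mdegE (bigD1 i) //= ltn_addr.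
move=> q /msuppM_le /allpairsP[[q1 q2] /= [+ q2f ->]].
rewrite msuppX inE => /eqP ->; rewrite mdegD mdeg1 => degq.
have := top (q2 + U_(i))%MM; rewrite mdegD mdeg1 mnmDE mnm1E (negPf ii0).
rewrite !mnmDE mnm1E eqxx => h.
suff : (e <= q2 i0 + 0 + n.+1)%N by lia.
apply: h; last by lia.
move: q2f; rewrite !mcoeff_msupp mcoeff_mderiv; apply: contraNN => /eqP ->.
by rewrite mul0rn.
Qed.

End CoreDegree.

Theorem theorem6p16 (k : fieldType) (char0 : [pchar k] =i pred0)
  (d g delta : nat) (L : set {mpoly k[d]})
  (lexL : lex_segment L)
  (htL : ideal_height L g) (g_ge2 : (2 <= g)%N)
  (degL : generated_in_degree L delta) (delta_ge2 : (2 <= delta)%N) :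
  [set f%:F | f in ideal_core L] `<=` adjoint (ideal_pow L g).
Proof.
have le_gd := lex_segment_height_le htL.
have delta_gt0 := ltnW delta_ge2.
have d_gt0 : (0 < d)%N by lia.
move=> _ [f cf <-] v div_v.
have [->|f0] := eqVneq f 0; [left; exact: rmorph0|right].
pose i0 := Ordinal d_gt0.
have i0E : i0 = 0%N :> nat by [].
apply: (@adjoint_condition k d v div_v.1 g delta L f char0 div_v g_ge2 le_gd delta_gt0) => //.
- by move=> h m; exact: monomial_ideal_supp lexL.1.
- by move=> m; exact: minimal_generator_below.
- exact: lex_segment_first.
- exact: lex_segment_power.
- exact: (core_sub lexL i0E htL g_ge2 degL delta_gt0).
- by move=> m; exact: (core_degree char0 lexL i0E htL g_ge2 degL delta_gt0).
Qed.
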